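(* For all integers $m\ge3$, $d\ge2$, and $a\ge1$, the Cayley digraph $$\Gamma=\mathrm{Cay}\left(\mathbb Z_{am}\times\mathbb Z_m^{d-1},\ \{(1,0),(1,e_1),\ldots,(1,e_{d-1})\}\right)$$ has a decomposition into $d$ directed Hamilton cycles. The directed girth of $\Gamma$ is $am$. For $a>1$, $\Gamma$ is not isomorphic to $\vec C_{am}\square\vec C_m^{\,\square(d-1)}$.
   Context: $\mathbb Z_n=\mathbb Z/n\mathbb Z$; $e_1,\dots,e_{d-1}$ are the standard vectors of $\mathbb Z_m^{d-1}$. $\mathrm{Cay}(G,S)$ has vertex set $G$ and arcs $g\to g+s$, $s\in S$. $\vec C_n$ is the directed cycle of length $n$, and $\square$ is the Cartesian product of digraphs (an arc changes exactly one coordinate along an arc of that factor). The directed girth is the length of a shortest directed cycle. A decomposition into directed Hamilton cycles is a partition of the arc set into directed spanning cycles. *)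

(* Defs.v *)
From HB Require Import structures.
From mathcomp Require Import all_boot all_order all_algebra.

Set Implicit Arguments.
Unset Strict Implicit.
Unset Printing Implicit Defensive.

Import GRing.Theory.

Local Open Scope ring_scope.

(* A digraph on a finite vertex type T is given by its arc relation e : rel T
   (no parallel arcs; loops are not excluded a priori). *)
Definition arcs (T : finType) (e : rel T) : {set T * T} :=
  [set p : T * T | e p.1 p.2].

(* A directed cycle is a cyclic sequence c of distinct vertices; a loop counts
   as one of length 1, and the arcs run from each x in c to next c x. *)
Definition directed_cycle (T : finType) (e : rel T) (c : seq T) : bool :=
  (0 < size c)%N && ucycleb e c.

Definition cycle_arcs (T : finType) (c : seq T) : {set T * T} :=
  [set (x, next c x) | x in c].

Definition hamilton_arcs (T : finType) (e : rel T) (H : {set T * T}) : Prop :=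
  exists c : seq T,
    [/\ directed_cycle e c, forall x : T, x \in c & H = cycle_arcs c].

Definition hamilton_decomposable (T : finType) (e : rel T) (k : nat) : Prop :=
  exists P : {set {set T * T}},
    [/\ partition P (arcs e), #|P| = k
      & forall H : {set T * T}, H \in P -> hamilton_arcs e H].

Definition has_directed_girth (T : finType) (e : rel T) (g : nat) : Prop :=
  (exists2 c : seq T, directed_cycle e c & size c = g) /\
  (forall c : seq T, directed_cycle e c -> (g <= size c)%N).

Definition digraph_iso (T1 T2 : finType) (e1 : rel T1) (e2 : rel T2) : Prop :=
  exists2 f : T1 -> T2, bijective f & forall x y : T1, e2 (f x) (f y) = e1 x y.

(* The product of two finite additive groups has no finZmodType instance in
   finalg; both of its parents are already canonical. *)
HB.saturate prod.

Definition Cay (G : finZmodType) (S : {set G}) : rel G :=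
  [rel g h | [exists s in S, h == g + s]].

Definition dicycle (n : nat) : rel 'I_n := [rel i j | j == ordS i].
Arguments dicycle n : clear implicits.

Definition cart_prod (T1 T2 : finType) (e1 : rel T1) (e2 : rel T2) :
    rel (T1 * T2) :=
  [rel x y | (e1 x.1 y.1 && (x.2 == y.2)) || ((x.1 == y.1) && e2 x.2 y.2)].

(* The n-fold Cartesian power, on the vertex set of functions 'I_n -> T. *)
Definition cart_pow (T : finType) (e : rel T) (n : nat) :
    rel {ffun 'I_n -> T} :=
  [rel x y : {ffun 'I_n -> T} | [exists i : 'I_n,
     e (x i) (y i) && [forall j : 'I_n, (j != i) ==> (x j == y j)]]].
Arguments cart_pow {T} e n.

(* Only the range m, a * m > 1 is meaningful: 'Z_0 and 'Z_1 are both 'Z_2.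
   The vectors e_1, ..., e_(d-1) are delta_mx 0 i for i : 'I_(d - 1). *)
Definition Gam_group (m d a : nat) : finZmodType :=
  ('Z_(a * m) * 'rV['Z_m]_(d - 1))%type.

Definition Gam_conn (m d a : nat) : {set Gam_group m d a} :=
  (1, 0) |: [set ((1, delta_mx 0 i) : Gam_group m d a) | i : 'I_(d - 1)].

Definition Gam (m d a : nat) : rel (Gam_group m d a) := Cay (Gam_conn m d a).
Arguments Gam m d a : clear implicits.

(* Main.v *)
From HB Require Import structures.
Require Import Defs.
From mathcomp Require Import all_boot all_order all_algebra.
From mathcomp Require Import zify ring.

(** Every vertex of the digraph has [d] outgoing arcs, one for each generator.
    A decomposition into [d] Hamilton cycles is therefore a choice, at each
    vertex, of a bijection from [d] colours to the generators such that the map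
    following the arcs of one colour is a single cycle ([cyc], [Res]).

    Every generator advances the first coordinate by one.  When [a = 1], the
    change of variables [x_0 = s - (r_1 + ... + r_(d-1))] turns the digraph into
    the [d]-dimensional torus, the product of [d] directed cycles of length [m].
    For larger [a] the colouring of the torus is used while the first coordinate
    is below [m], and each colour keeps a fixed generator in the other
    [(a - 1) m] layers: these displace the other coordinates by a multiple of
    [m], hence not at all, and the colours stay cyclic ([colour_cyc]).  The same
    first coordinate gives the girth: it must return to its start, so the length
    of a closed walk is a multiple of [a m].  In the product of cycles one can
    turn around a cycle of length [m], which is shorter when [a > 1].

    The torus is decomposed by induction on the dimension ([torus]).

    Even dimensions: two copies of a decomposition with [p] colours are joined
    ([res_join]).  Number both copies of a Hamilton cycle by [Z/M].  Let the
    cycle of the first copy and that of the second exchange their roles where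
    the two numbers add up to zero.  In terms of the sum and of one number each
    colour is an odometer: the sum advances at each step, and the number once in
    each turn.

    Odd dimensions need more, since in dimension 3 the exchanges along lines
    give the wrong parity of the three permutations when [m] is even.
    Dimension 3 is done by layers: all generators advance the sum of the three
    coordinates, so a colour is cyclic once the composite of its [m] layer maps
    on [(Z/m)^2] is, and the layers are explicit patterns of permutations
    ([good_slices_exist]).  These patterns keep two layers (almost) in a
    default shape, in which the third colour only moves the last coordinate and
    the first two form a decomposition of the first two coordinates.

    In dimension [2 p + 3] the points are triples [(u, v, w)] with [u] and [v] in
    [p]-dimensional tori and [w] in the 3-dimensional one.  In a single fibre
    [(us, vs)] the three last colours follow the patterns of dimension 3, and
    default maps elsewhere.  In the default layers 1 and 2 every one of the
    three last colours exchanges roles with some colour of [u] or of [v], its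
    host.  Such an exchange lets it walk through all fibres ([grid_cyc], which
    merges cycles by splicing them), and lets the host walk through all [w]
    ([event_cyc], [host_event]).  In layer 0 the colours of [u] are joined with
    those of [v] as in the even case; to make a host cyclic the number of rows
    in which it plays host has to be prime to the number of its exits, which
    restricts how often each colour serves ([hosts]).  For [p = 1] the colours
    of a single 2-dimensional torus can serve as hosts ([res_five],
    dimension 5). *)

Set Implicit Arguments.
Unset Strict Implicit.
Unset Printing Implicit Defensive.

Import GRing.Theory.

(** * Cyclic maps *)

(** On a finite type this makes [f] a permutation with a single cycle, so that the
    arcs from [x] to [f x] form a directed Hamilton cycle. *)
Definition cyc (T : Type) (f : T -> T) := forall x y, exists n, iter n f x = y.

Section Cyc.
Variable T : finType.
Implicit Types (f : T -> T) (x y : T).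

Lemma fconnectP f x y : reflect (exists n, iter n f x = y) (fconnect f x y).
Proof.
apply: (iffP idP) => [h|[n <-]]; last exact: fconnect_iter.
by exists (findex f x y); apply: iter_findex.
Qed.

Lemma cycE f : cyc f <-> forall x y, fconnect f x y.
Proof. by split=> h x y; apply/fconnectP; apply: h. Qed.

Lemma cyc_inj f : cyc f -> injective f.
Proof.
move=> hf; have surj y : exists x, f x = y.
  by have [n <-] := hf (f y) y; exists (iter n f y); rewrite -iterSr -iterS.
apply/injectiveP; rewrite /injectiveb/dinjectiveb -/(codom f).
apply/card_uniqP; rewrite size_codom; apply: eq_card => y.
by rewrite inE; have [x <-] := surj y; apply: codom_f.
Qed.

(** For a permutation of a finite type reachability is symmetric, so the orbits
    need only meet in one point. *)
Lemma cyc_base f x0 : injective f -> (forall x, fconnect f x x0) -> cyc f.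
Proof.
move=> inj h; apply/cycE => x y.
by apply: connect_trans (h x) _; rewrite fconnect_sym.
Qed.

Lemma cyc_order f x : cyc f -> order f x = #|T|.
Proof. by move/cycE => h; apply: eq_card => y; rewrite inE; apply: h. Qed.

Lemma cyc_iter_card f x : cyc f -> iter #|T| f x = x.
Proof.
by move=> hf; rewrite -(cyc_order x hf) iter_order //; apply: cyc_inj.
Qed.

Lemma iter_fix n k f x : iter n f x = x -> iter (k * n) f x = x.
Proof. by move=> h; elim: k => // k IH; rewrite mulSn iterD IH. Qed.

Lemma cyc_iter_mod f n x : cyc f -> iter (n %% #|T|) f x = iter n f x.
Proof.
move=> hf; rewrite [in RHS](divn_eq n #|T|) addnC iterD.
by rewrite iter_fix //; apply: cyc_iter_card.
Qed.

Lemma cyc_iter_eq f n k x : cyc f ->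
  iter n f x = iter k f x -> n = k %[mod #|T|].
Proof.
move=> hf; rewrite -(cyc_iter_mod n x hf) -(cyc_iter_mod k x hf) => h.
have T0 : 0 < #|T| by apply/card_gt0P; exists x.
have := findex_iter (f := f) (x := x) (i := n %% #|T|).
rewrite (cyc_order x hf) ltn_mod T0 => /(_ isT) <-.
by rewrite h findex_iter // (cyc_order x hf) ltn_mod.
Qed.

(** A cyclic map on [N] points generates a group of order [N], in which the powers
    prime to [N] are generators again. *)
Lemma cyc_iter f e : cyc f -> coprime e #|T| -> cyc (iter e f).
Proof.
move=> hf co x y; have [n hn] := hf x y.
have T0 : 0 < #|T| by apply/card_gt0P; exists x.
have E k z : iter k (iter e f) z = iter (k * e) f z.
  by elim: k => // k IH; rewrite iterS IH -iterD mulSn.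
case: (posnP e) => [e0|e0].
  move: co; rewrite e0 /coprime gcd0n => /eqP T1; exists 0 => /=.
  by apply: (fintype_le1P _ _ _); rewrite T1.
have [u [v huv]] : exists u v, u * e = v * #|T| + 1.
  by case: (egcdnP #|T| e0) => u v h _; exists u, v; rewrite h (eqP co).
exists (n * u); rewrite E -mulnA huv mulnDr muln1 addnC iterD.
by rewrite mulnA iter_fix //; apply: cyc_iter_card.
Qed.

End Cyc.

Lemma cyc_conj (S T : Type) (h : S -> T) (f : S -> S) (g : T -> T) :
  injective h -> (forall x, h (f x) = g (h x)) -> cyc g -> cyc f.
Proof.
move=> hi hfg hg x y; have [n hn] := hg (h x) (h y).
exists n; apply: hi; rewrite -hn; elim: n {hn} => //= n IH.
by rewrite hfg IH.
Qed.

Lemma iter_conj (S T : Type) (h : S -> T) (f : S -> S) (g : T -> T) n x :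
  (forall x, h (f x) = g (h x)) -> h (iter n f x) = iter n g (h x).
Proof. by move=> hfg; elim: n => //= n IH; rewrite hfg IH. Qed.

(** * First return maps *)

Section Return.
Variables (U V : finType) (i : V -> U).
Hypothesis i_inj : injective i.

(** A relation rather than a function: the return times have no useful closed
    form, and are never needed. *)
Definition returns (F : U -> U) x y :=
  exists n, iter n.+1 F (i x) = i y /\
    forall k, k < n -> iter k.+1 F (i x) \notin codom i.

Lemma return_exists (F : U -> U) x :
  (exists n, iter n.+1 F (i x) \in codom i) -> exists y, returns F x y.
Proof.
move=> ex; case: (ex_minnP ex) => n /codomP[y hy] hmin.
by exists y, n; split=> // k kn; apply/negP => /hmin; rewrite leqNgt kn.
Qed.

(** The orbit of a section point meets all the others, one return after the
    other. *)
Lemma return_cyc (F : U -> U) : cyc F ->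
  exists2 r : V -> V, cyc r & forall x, returns F x (r x).
Proof.
move=> hF; have ex x : exists y, returns F x y.
  apply: return_exists; have [n hn] := hF (F (i x)) (i x).
  by exists n; rewrite iterSr hn codom_f.
have exb x : exists y, [exists n : 'I_#|U|.+1, (iter n.+1 F (i x) == i y) &&
    [forall k : 'I_n, iter k.+1 F (i x) \notin codom i]].
  have [y [n [hn hk]]] := ex x; exists y.
  have nU : n < #|U|.+1.
    rewrite ltnS leqNgt; apply/negP => ltU.
    have U0 : 0 < #|U| by apply/card_gt0P; exists (i x).
    have := hk _ (leq_ltn_trans (leq_pred _) ltU).
    by rewrite prednK // (cyc_iter_card _ hF) codom_f.
  apply/existsP; exists (Ordinal nU); rewrite hn eqxx /=.
  by apply/forallP => k; apply: hk.
pose r x := xchoose (exb x).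
have hr x : returns F x (r x).
  have /existsP[n /andP[/eqP h1 /forallP h2]] := xchooseP (exb x).
  by exists n; split=> // k kn; apply: (h2 (Ordinal kn)).
exists r => // x y; have [n hn] := hF (i x) (i y).
elim/ltn_ind: n x hn => -[|n] IH x hn.
  by exists 0; apply: i_inj.
have [k [hk hlt]] := hr x.
have kn : k <= n.
  rewrite leqNgt; apply/negP => /hlt; rewrite hn; apply/negP.
  by rewrite negbK codom_f.
have lt : n - k < n.+1 by rewrite ltnS leq_subr.
have [|l hl] := IH _ lt (r x); last by exists l.+1; rewrite iterSr.
by rewrite -hk -iterD addnS subnK.
Qed.

End Return.

(** * Integers mod n *)
Section Zn.
Variable n : nat.
Hypothesis n1 : 1 < n.
Local Open Scope ring_scope.

Lemma iter_addZ (b : 'Z_n) k : iter k (fun x => x + 1) b = b + k%:R.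
Proof. by elim: k => [|k IH] /=; rewrite ?addr0 // IH mulrSr addrA. Qed.

Lemma Zn_nat (b : 'Z_n) : b = (b : nat)%:R.
Proof. by rewrite natr_Zp. Qed.

Lemma Zn_lt (b : 'Z_n) : (b < n)%N.
Proof. by rewrite -[X in (_ < X)%N](Zp_cast n1). Qed.

Lemma Zn_n : n%:R = 0 :> 'Z_n.
Proof. exact: pchar_Zp. Qed.

Lemma val_ZnR k : (k%:R : 'Z_n) = (k %% n)%N :> nat.
Proof. by rewrite val_Zp_nat. Qed.

Lemma ZnR_eq k l : (k%:R == l%:R :> 'Z_n) = (k == l %[mod n]).
Proof. by rewrite -val_eqE /= !val_ZnR. Qed.

Lemma card_Zn : #|'Z_n| = n.
Proof. by rewrite card_ord Zp_cast. Qed.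

Lemma cyc_addZ : cyc (fun x : 'Z_n => x + 1).
Proof.
move=> x y; exists (y - x : 'Z_n); rewrite iter_addZ -Zn_nat.
by rewrite addrC subrK.
Qed.

Lemma cyc_addZ_coprime k : coprime k n -> cyc (fun x : 'Z_n => x + k%:R).
Proof.
move=> co; have : cyc (iter k (fun x : 'Z_n => x + 1)).
  by apply: cyc_iter; [exact: cyc_addZ | rewrite card_Zn].
move=> h x y; have [j <-] := h x y; exists j.
by apply: eq_iter => z; rewrite iter_addZ.
Qed.

Definition red N (x : 'Z_N) : 'Z_n := (x : nat)%:R.

Lemma red_nat N k : (1 < N)%N -> (n %| N)%N -> red (k%:R : 'Z_N) = k%:R.
Proof.
move=> N1 dv; rewrite /red val_Zp_nat //; apply/eqP.
by rewrite ZnR_eq modn_dvdm.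
Qed.

Lemma redD N (x y : 'Z_N) : (1 < N)%N -> (n %| N)%N ->
  red (x + y) = red x + red y.
Proof.
move=> N1 dv; rewrite -[x]natr_Zp -[y]natr_Zp -natrD !red_nat //.
by rewrite natrD.
Qed.

Lemma red1 N : (1 < N)%N -> (n %| N)%N -> red (1 : 'Z_N) = 1.
Proof. by move=> N1 dv; apply: (red_nat 1 N1 dv). Qed.

Lemma red0 N : red (0 : 'Z_N) = 0.
Proof. by []. Qed.

End Zn.

(** * Odometers *)

(** An odometer: [G] moves in a row [U] by [F b], and changes to the next row at
    the points of the section [i], where all the row maps agree. *)
Section Rows.
Variables (U V : finType) (i : V -> U) (n : nat).
Hypotheses (i_inj : injective i) (n1 : 1 < n).
Variables (F : 'Z_n -> U -> U) (s : V -> U).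
Hypothesis F_inj : forall b, injective (F b).
Hypothesis Fs : forall b x, F b (i x) = s x.
Hypothesis F_reach : forall b u, exists k, iter k (F b) u \in codom i.
Variable G : U * 'Z_n -> U * 'Z_n.
Hypothesis GE : forall u b,
  G (u, b) = (F b u, (if u \in codom i then b + 1 else b)%R).
Variable r : 'Z_n -> V -> V.
Hypothesis rP : forall b x, returns i (F b) x (r b x).
Local Open Scope ring_scope.

Lemma rows_inj : injective G.
Proof.
move=> [u b] [u' b']; rewrite !GE => -[].
have aux w w' c c' : w \in codom i -> F c w = F c' w' -> c + 1 = c' -> w' = w.
  by move=> /codomP[x ->]; rewrite Fs -(Fs c') => /F_inj <-.
case: ifP => hu; case: ifP => hu'.
- by move=> h /addIr e; move: h; rewrite e => /F_inj ->.
- by move=> h e; move: hu'; rewrite (aux _ _ _ _ hu h e) hu.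
- move=> h e; move: hu; rewrite (aux _ _ _ _ hu' (esym h) (esym e)).
  by rewrite hu'.
- by move=> h e; move: h; rewrite e => /F_inj ->.
Qed.

Lemma rows_run b u k :
  (forall j, (j < k)%N -> iter j (F b) u \notin codom i) ->
  iter k G (u, b) = (iter k (F b) u, b).
Proof.
elim: k => // k IH h; rewrite iterS IH => [|j jk]; last exact/h/ltnW.
by rewrite GE (negPf (h k _)).
Qed.

Lemma rows_next b x : fconnect G (i x, b) (i (r (b + 1) x), b + 1).
Proof.
have [k [hk hlt]] := rP (b + 1) x.
apply/fconnectP; exists k.+1; rewrite iterSr GE codom_f Fs -(Fs (b + 1)).
rewrite rows_run -?iterSr ?hk // => j jk.
by rewrite -iterSr; apply: hlt.
Qed.

Fixpoint word k x :=
  if k is k'.+1 then r (k'%:R) (word k' x) else x.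

Lemma rows_word k x : fconnect G (i x, -1) (i (word k x), k%:R - 1).
Proof.
elim: k => [|k IH] /=; first by rewrite sub0r.
apply: connect_trans IH _.
by have := rows_next (k%:R - 1) (word k x); rewrite subrK mulrSr addrK.
Qed.

(** The rows are traversed cyclically; each traversal acts on the section by
    the product of the return maps of all rows. *)
Lemma rows_cyc : cyc (word n) -> cyc G.
Proof.
move=> hw [u0 b0].
have [k0 /codomP[x0 _]] := F_reach b0 u0.
move: (u0, b0); apply: (cyc_base (x0 := (i x0, -1)) rows_inj) => -[u b].
have [x hx] : exists x, fconnect G (u, b) (i x, b).
  have ex := F_reach b u; case: (ex_minnP ex) => k /codomP[x hx] kmin.
  exists x; apply/fconnectP; exists k; rewrite rows_run ?hx // => j jk.
  by apply/negP => /kmin; rewrite leqNgt jk.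
apply: connect_trans hx _.
have [y hy] : exists y, fconnect G (i x, b) (i y, -1).
  have step k : exists y, fconnect G (i x, b) (i y, b + k%:R).
    elim: k => [|k [y hy]]; first by exists x; rewrite addr0.
    exists (r (b + k%:R + 1) y); apply: connect_trans hy _.
    by rewrite mulrSr addrA rows_next.
  have [y] := step (- 1 - b : 'Z_n); rewrite -Zn_nat.
  by rewrite addrC subrK => h; exists y.
apply: connect_trans hy _.
have [k <-] := hw y x0; elim: k => //= k IH.
apply: connect_trans IH _.
by have := rows_word n (iter k (word n) y); rewrite Zn_n // sub0r.
Qed.

End Rows.

Section RowsCor.
Variables (U V : finType) (i : V -> U) (n : nat).
Hypotheses (i_inj : injective i) (n1 : 1 < n).
Variables (F0 FE : U -> U) (s : V -> U) (E : pred nat).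
Hypotheses (F0_inj : injective F0) (FE_cyc : cyc FE).
Hypotheses (F0s : forall x, F0 (i x) = s x) (FEs : forall x, FE (i x) = s x).
Hypothesis F0_reach : forall u, exists k, iter k F0 u \in codom i.
Variable V0 : V.
Variable G : U * 'Z_n -> U * 'Z_n.
Hypothesis GE : forall u b,
  G (u, b) = (if E b then FE u else F0 u, (if u \in codom i then b + 1 else b)%R).

Lemma rows_cyc_gen (r0 : V -> V) :
  (forall x, returns i F0 x (r0 x)) ->
  (forall rE : V -> V, cyc rE ->
     cyc (fun x => foldl (fun y k => if E k then rE y else r0 y) x (iota 0 n))) ->
  cyc G.
Proof.
move=> h0 hw; have [rE rE_cyc hE] := return_cyc i_inj FE_cyc.
pose F (b : 'Z_n) u := if E b then FE u else F0 u.
pose r (b : 'Z_n) x := if E b then rE x else r0 x.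
apply: (@rows_cyc U V i n n1 F s _ _ _ G _ r).
- by move=> b; rewrite /F; case: (E b) => //; apply: cyc_inj.
- by move=> b x; rewrite /F; case: (E b).
- move=> b u; rewrite /F; case: (E b) => //.
  by have [k hk] := FE_cyc u (i V0); exists k; rewrite hk codom_f.
- by move=> u b; rewrite GE.
- by move=> b x; rewrite /F /r; case: (E b).
move=> x y; have [k <-] := hw _ rE_cyc x y; exists k; apply: eq_iter => z.
have: forall l, l <= n -> word r l z =
    foldl (fun y k => if E k then rE y else r0 y) z (iota 0 l).
  elim=> // l IH ln; rewrite -[in RHS]addn1 iotaD foldl_cat add0n /= -IH; last exact: ltnW.
  by rewrite /r val_ZnR // modn_small.
exact.
Qed.

(** Trivial rows bring each section point back to itself, so one round through all
    rows is a power of the cyclic return map of the other rows. *)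
Lemma rows_cyc_id : (forall x, returns i F0 x x) ->
  coprime (count E (iota 0 n)) #|V| -> cyc G.
Proof.
move=> h0 co; apply: (rows_cyc_gen h0) => rE hE x y.
have [k <-] := cyc_iter hE co x y; exists k; apply: eq_iter => z.
elim: (iota 0 n) z => //= a l IH z; rewrite IH.
by case: (E a); rewrite // add1n iterSr.
Qed.

(** The trivial rows, in even number and one after the other, contribute an even
    power of an involution, and again a power of a cyclic map is left. *)
Lemma rows_cyc_swap (r0 : V -> V) e : involutive r0 ->
  (forall x, returns i F0 x (r0 x)) ->
  (forall k, k < n -> E k = (k < e)) -> e <= n -> ~~ odd (n - e) ->
  coprime e #|V| -> cyc G.
Proof.
move=> inv h0 hEe en ev co; apply: (rows_cyc_gen h0) => rE hE x y.
have [k <-] := cyc_iter hE co x y; exists k; apply: eq_iter => z.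
have -> : iota 0 n = iota 0 e ++ iota e (n - e) by rewrite -iotaD subnKC.
rewrite foldl_cat.
have -> : foldl (fun y k => if E k then rE y else r0 y) z (iota 0 e)
   = iter e rE z.
  have: forall l, l <= e -> foldl (fun y k => if E k then rE y else r0 y) z
    (iota 0 l) = iter l rE z.
    elim=> // l IH le; rewrite -[in LHS]addn1 iotaD foldl_cat /= add0n IH; last exact: ltnW.
    by rewrite hEe ?le //; apply: leq_trans en.
  exact.
move: (iter e rE z) => {}z.
have: forall l, l <= n - e -> foldl (fun y k => if E k then rE y else r0 y) z
    (iota e l) = iter l r0 z.
  elim=> // l IH le; rewrite -[in LHS]addn1 iotaD foldl_cat /= IH; last exact: ltnW.
  by rewrite hEe ?(leq_trans _ (ltnSn _)) //; [rewrite ltnNge leq_addr | lia].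
move=> -> //; rewrite -[n - e]odd_double_half (negPf ev) add0n.
by elim: (n - e)./2 => //= l IH; rewrite inv.
Qed.

End RowsCor.

Lemma fconnect_iter_sub (T S : finType) (f : T -> T) (g : S -> S) (h : T -> S) x y :
  (forall z, fconnect g (h z) (h (f z))) -> fconnect f x y ->
  fconnect g (h x) (h y).
Proof.
move=> hz /fconnectP[n <-]; elim: n => //= n IH.
exact: connect_trans IH (hz _).
Qed.

(** * Splicing cycles *)

(** A permutation [f0] is redirected along the cycles of another permutation [p] of
    the exceptional set [E].  The value [key] is constant on [f0]-cycles, so that
    the cycle of a [sole] point contains no other point of [E]. *)
Section Splice.
Variables (X : finType) (K : eqType) (f0 f1 p : X -> X) (E : pred X).
Variable key : X -> K.
Hypotheses (f0_inj : injective f0) (p_inj : injective p).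
Hypothesis f1_off : forall x, ~~ E x -> f1 x = f0 x.
Hypothesis pE : forall x, E x -> E (p x).
Hypothesis f1_on : forall x, E x -> f1 x = f0 (p x).
Hypothesis keyE : forall x, key (f0 x) = key x.

Definition sole x := forall y, E y -> key y = key x -> y = x.
Hypothesis tree : forall x n, E x ->
  sole x \/ iter n p x = x \/ sole (iter n p x).

Lemma splice_iterE n x : E x -> E (iter n p x).
Proof. by move=> Ex; elim: n => //= n; apply: pE. Qed.

Lemma splice_inj : injective f1.
Proof.
move=> x y; have [Ex|nEx] := boolP (E x); have [Ey|nEy] := boolP (E y).
- by rewrite !f1_on // => /f0_inj/p_inj.
- rewrite f1_on // f1_off // => /f0_inj h.
  by move: nEy; rewrite -h pE.
- rewrite f1_off // f1_on // => /f0_inj h.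
  by move: nEx; rewrite h pE.
- by rewrite !f1_off // => /f0_inj.
Qed.

(** Up to its return to [q] the [f0]-orbit meets no exceptional point, so [f1]
    follows it. *)
Lemma splice_sole q : sole q -> fconnect f1 (f0 q) q.
Proof.
move=> sq; have/fconnectP[n hn] : fconnect f0 (f0 q) q.
  by rewrite fconnect_sym // fconnect1.
have ex : exists n, iter n f0 (f0 q) == q by exists n; rewrite hn.
case: (ex_minnP ex) => k /eqP hk kmin {n hn ex}.
apply/fconnectP; exists k; rewrite -[RHS]hk.
have : k <= k by []; elim: {-2}k => // j IH jk; rewrite /= IH ?(ltnW jk) //.
apply: f1_off; apply/negP => /sq h.
have kq l : key (iter l f0 (f0 q)) = key q by elim: l => //= l IH'; rewrite !keyE.
by have := kmin j; rewrite h ?kq // eqxx leqNgt jk => /(_ isT).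
Qed.

Lemma splice_stepP q : E q -> sole (p q) -> fconnect f1 q (p q).
Proof.
move=> Eq sq; apply: connect_trans (splice_sole sq).
by rewrite -f1_on // fconnect1.
Qed.

(** Redirecting along a [p]-cycle merges the [f0]-cycles it meets, provided
    all of them but at most one meet no other redirected point. *)
Lemma splice_p x : E x -> fconnect f1 x (p x).
Proof.
move=> Ex; have [h|] := tree 1 (pE Ex).
  exact: splice_stepP.
have sym := fconnect_sym splice_inj.
move=> _; have Ep := pE Ex.
case: (tree (order p (p x)).-1 Ep) => [h|_]; first exact: splice_stepP.
have hx : iter (order p (p x)).-1 p (p x) = x.
  by apply: p_inj; rewrite -iterS prednK ?order_gt0 // iter_order.
have run n : n < order p (p x) -> sole (p x) \/ fconnect f1 (p x) (iter n p (p x)).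
  elim: n => [|n IH] lt; first by right; apply: connect0.
  case: (IH (ltnW lt)) => [|c]; first by left.
  case: (tree n.+1 Ep) => [|[eq|s]]; first by left.
    have := findex_iter lt; rewrite eq findex0 => e; discriminate e.
  right; apply: connect_trans c _; rewrite iterS.
  by apply: splice_stepP => //; apply: splice_iterE.
case: (run (order p (p x)).-1); rewrite ?prednK ?order_gt0 //.
  exact: splice_stepP.
by rewrite hx sym.
Qed.

Lemma splice_f0 x : fconnect f1 x (f0 x).
Proof.
have [Ex|nEx] := boolP (E x); last by rewrite -f1_off // fconnect1.
have sym := fconnect_sym splice_inj.
pose y := iter (order p x).-1 p x.
have hy : p y = x by rewrite /y -iterS prednK ?order_gt0 // iter_order.
have Ey : E y by apply: splice_iterE.
have : fconnect f1 y (f1 y) by apply: fconnect1.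
rewrite f1_on // hy; apply: connect_trans.
by rewrite sym -[x in X in connect _ _ X]hy; apply: splice_p.
Qed.

Lemma splice_conn x y : fconnect f0 x y -> fconnect f1 x y.
Proof. exact: (fconnect_iter_sub (h := id) splice_f0). Qed.

End Splice.

(** * Colours sliding over a grid *)

(** The movement of one of the last three colours over the fibres [w] above a grid
    of points [(u, v)].  By default it follows [g] in each fibre, except [L] in
    the slice [(us, vs)].  The orbits of [g] are the classes of [cl].  At the
    points of [E1] the colour is exchanged with one that slides along a line of
    the grid (in direction [u] or [v] according to [mode]), and on one line also
    in the other direction at the points of [E2]. *)
Section Grid.
Variables (A B W : finType) (C : eqType) (cl : W -> C) (mode : C -> bool).
Variables (g L : W -> W) (us : A) (vs : B).
Hypotheses (g_inj : injective g) (L_cyc : cyc L).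
Hypothesis cl_g : forall w, cl (g w) = cl w.
Hypothesis cl_conn : forall w w', cl w = cl w' -> fconnect g w w'.

Let X : finType := (A * B * W)%type.

Variables (E1 E2 : A -> B -> W -> bool) (u1 : A) (v1 : B).
Variables (H1 H2 : C -> B -> A -> A) (K1 K2 : C -> A -> B -> B).
Hypotheses (H1_cyc : forall c v, cyc (H1 c v)) (K1_cyc : forall c u, cyc (K1 c u)).
Hypotheses (H2_cyc : forall c v, cyc (H2 c v)) (K2_cyc : forall c u, cyc (K2 c u)).

Definition slide (H : C -> B -> A -> A) (K : C -> A -> B -> B) (m : C -> bool)
    (x : X) : X :=
  let: (u, v, w) := x in
  if m (cl w) then (H (cl w) v u, v, w) else (u, K (cl w) u v, w).

(** An exchange is a detour of the default map: sliding amounts to a permutation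
    of the exceptional points, [slide] followed by this, before the default
    step. *)
Definition gback (x : X) : X := (x.1, finv g x.2).

Definition grid0 (x : X) : X :=
  let: (u, v, w) := x in
  if (u == us) && (v == vs) then (u, v, L w) else (u, v, g w).
Definition exch (E : A -> B -> W -> bool) (x : X) := E x.1.1 x.1.2 x.2.
Definition grid1 (x : X) : X :=
  if exch E1 x then slide H1 K1 mode x else grid0 x.
Definition grid2 (x : X) : X :=
  if exch E2 x then slide H2 K2 (predC mode) x else grid1 x.

Hypothesis E1_closed : forall x, exch E1 x -> exch E1 (gback (slide H1 K1 mode x)).
Hypothesis E1_uniq : forall u v w w',
  E1 u v w -> E1 u v w' -> cl w = cl w' -> w = w'.
Hypothesis E1_ex : forall u v w, exists2 w', cl w' = cl w & E1 u v w'.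
Hypothesis E1_slice : forall w, E1 us vs w -> L w = g w.
Hypothesis E2_closed : forall x, exch E2 x ->
  exch E2 (gback (slide H2 K2 (predC mode) x)).
Hypothesis E2_uniq : forall u v w w',
  E2 u v w -> E2 u v w' -> cl w = cl w' -> w = w'.
Hypothesis E2_1 : forall u v w, E2 u v w ->
  ~~ E1 u v w /\ (if mode (cl w) then u = u1 else v = v1).
Hypotheses (u1P : u1 != us) (v1P : v1 != vs \/ forall c, mode c).
Hypothesis E2_row : forall w, mode (cl w) ->
  (forall v v' : B, v = v') \/ (forall v, exists2 w', cl w' = cl w & E2 u1 v w').
Hypothesis E2_col : forall w, ~~ mode (cl w) ->
  forall u, exists2 w', cl w' = cl w & E2 u v1 w'.

Let finv_g w : g (finv g w) = w. Proof. exact: f_finv. Qed.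
Let cl_finv w : cl (finv g w) = cl w. Proof. by rewrite -[in RHS](finv_g w) cl_g. Qed.

Lemma gback_slide_inj H K m : (forall c v, injective (H c v)) ->
  (forall c u, injective (K c u)) -> injective (fun x => gback (slide H K m x)).
Proof.
move=> Hi Ki [[u v] w] [[u' v'] w'] /=; rewrite /gback /=.
have fi := can_inj (f_finv g_inj).
case: ifP => h; case: ifP => h' /= -[].
- by move=> e ev /fi e'; move: e; rewrite e' ev => /Hi ->.
- by move=> _ _ /fi e; rewrite e h' in h.
- by move=> _ _ /fi e; rewrite e h' in h.
- by move=> eu e /fi e'; move: e; rewrite e' eu => /Ki ->.
Qed.

Lemma grid0_inj : injective grid0.
Proof.
move=> [[u v] w] [[u' v'] w'] /=; case: ifP => h; case: ifP => h' -[].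
- by move=> -> -> /(cyc_inj L_cyc) ->.
- by move=> e1 e2; rewrite e1 e2 h' in h.
- by move=> e1 e2; rewrite e1 e2 h' in h.
- by move=> -> -> /g_inj ->.
Qed.

(** The cycles of [grid0] are the slice and the classes above the other points. *)
Definition key0 (x : X) : option (A * B * C) :=
  let: (u, v, w) := x in
  if (u == us) && (v == vs) then None else Some (u, v, cl w).

(** The exchanges of [E1] merge a class above a line into one cycle, and every line
    through the slice with the slice. *)
Definition key1 (x : X) : option ((B + A) * C) :=
  let: (u, v, w) := x in
  if mode (cl w) then if v == vs then None else Some (inl v, cl w)
  else if u == us then None else Some (inr u, cl w).

Let p1 x := gback (slide H1 K1 mode x).
Let p2 x := gback (slide H2 K2 (predC mode) x).

Lemma grid1_on x : exch E1 x -> grid1 x = grid0 (p1 x).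
Proof.
move=> Ex; rewrite /grid1 Ex; have := E1_closed Ex; rewrite -/(p1 x).
case: x Ex => -[u v] w Ex; rewrite /p1 /gback /exch /=.
by case: ifP => hm /=; case: ifP => [/andP[/eqP -> /eqP ->]|_];
  rewrite ?finv_g // => /E1_slice ->; rewrite finv_g.
Qed.

Lemma p1_iter n u v w : exists u' v' w', [/\ iter n p1 (u, v, w) = (u', v', w'),
  cl w' = cl w & if mode (cl w) then v' = v else u' = u].
Proof.
elim: n => [|n [u' [v' [w' [e1 e2 e3]]]]] /=.
  by exists u, v, w; split=> //; case: ifP.
rewrite e1 /p1 /gback /= e2; case: ifP e3 => hm e3 /=.
  by exists (H1 (cl w) v' u'), v', (finv g w'); rewrite cl_finv e2.
by exists u', (K1 (cl w) u' v'), (finv g w'); rewrite cl_finv e2.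
Qed.

Lemma p2_iter n u v w : exists u' v' w', [/\ iter n p2 (u, v, w) = (u', v', w'),
  cl w' = cl w & if mode (cl w) then u' = u else v' = v].
Proof.
elim: n => [|n [u' [v' [w' [e1 e2 e3]]]]] /=.
  by exists u, v, w; split=> //; case: ifP.
rewrite e1 /p2 /gback /= e2; case: ifP e3 => hm e3 /=.
  by exists u', (K2 (cl w) u' v'), (finv g w'); rewrite cl_finv e2.
by exists (H2 (cl w) v' u'), v', (finv g w'); rewrite cl_finv e2.
Qed.

Lemma sole1 x : exch E1 x -> key0 x != None -> sole (exch E1) key0 x.
Proof.
case: x => -[u v] w; rewrite /exch /= => Ex; case: ifP => // h _.
move=> [[u' v'] w'] Ey /=; rewrite h; case: ifP => // h' -[e1 e2 e3].
by move: Ey; rewrite /exch /= e1 e2 => Ey; rewrite (E1_uniq Ey Ex e3).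
Qed.

Lemma tree1 x n : exch E1 x -> 
  sole (exch E1) key0 x \/ iter n p1 x = x \/ sole (exch E1) key0 (iter n p1 x).
Proof.
move=> Ex; have [hx|hx] := eqVneq (key0 x) None; last by left; apply: sole1.
right; have En := splice_iterE (p := p1) E1_closed n Ex.
have [hn|hn] := eqVneq (key0 (iter n p1 x)) None; last by right; apply: sole1.
left; case: x Ex hx En hn => -[u v] w Ex hx.
have [u' [v' [w' [-> e2 e3]]]] := p1_iter n u v w.
move: hx; rewrite /exch /= in Ex *; case: ifP => // /andP[/eqP hu /eqP hv] _.
move=> Ey; case: ifP => // /andP[/eqP hu' /eqP hv'] _.
rewrite hu' hv' hu hv in Ex Ey *; by rewrite (E1_uniq Ey Ex e2).
Qed.

Lemma sole2 x : exch E2 x -> key1 x != None -> sole (exch E2) key1 x.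
Proof.
case: x => -[u v] w; rewrite /exch /= => Ex; have [_] := E2_1 Ex.
case: ifP => hm hx; case: ifP => // h _ [[u' v'] w'];
  rewrite /exch /= => Ey; have [_] := E2_1 Ey;
  case: ifP => hm' hy; case: ifP => // h'; rewrite hm h => -[] // e1 e2.
  by rewrite e1 hx hy in Ex Ey *; rewrite (E2_uniq Ey Ex e2).
by rewrite e1 hx hy in Ex Ey *; rewrite (E2_uniq Ey Ex e2).
Qed.

Lemma tree2 x n : exch E2 x -> 
  sole (exch E2) key1 x \/ iter n p2 x = x \/ sole (exch E2) key1 (iter n p2 x).
Proof.
move=> Ex; have [hx|hx] := eqVneq (key1 x) None; last by left; apply: sole2.
right; have En := splice_iterE (p := p2) E2_closed n Ex.
have [hn|hn] := eqVneq (key1 (iter n p2 x)) None; last by right; apply: sole2.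
left; case: x Ex hx En hn => -[u v] w Ex hx.
have [u' [v' [w' [-> e2 e3]]]] := p2_iter n u v w.
move: hx; rewrite /exch /= in Ex * => hx Ey; rewrite e2 => hn.
case hm: (mode (cl w)) e3 hx hn => e3 hx hn.
  move: hx hn; case: eqP => // hv _; case: eqP => // hv' _.
  by rewrite e3 hv' hv in Ex Ey *; rewrite (E2_uniq Ey Ex e2).
move: hx hn; case: eqP => // hv _; case: eqP => // hv' _.
by rewrite e3 hv' hv in Ex Ey *; rewrite (E2_uniq Ey Ex e2).
Qed.

Lemma key0E x : key0 (grid0 x) = key0 x.
Proof.
case: x => -[u v] w /=; case: ifP => h /=; first by rewrite h.
by rewrite h cl_g.
Qed.

Lemma key1E x : key1 (grid1 x) = key1 x.
Proof.
case: x => -[u v] w; rewrite /grid1; case: ifP => Ex /=.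
  by case: ifP => hm /=; rewrite hm.
case: ifP => [/andP[/eqP -> /eqP ->]|h] /=; last by rewrite cl_g.
by rewrite !eqxx; case: ifP; case: ifP.
Qed.

Lemma grid2_on x : exch E2 x -> grid2 x = grid1 (p2 x).
Proof.
case: x => -[u v] w Ex; rewrite /grid2 Ex; have := E2_closed Ex.
rewrite -/(p2 _) => Ey; have [nE1 _] := E2_1 Ey.
rewrite /grid1 {1}/exch (negPf nE1); move: Ey; rewrite /exch /= in Ex.
have [_] := E2_1 Ex; rewrite /p2 /gback /=.
case: ifP => hm hx /= Ey.
  by rewrite hx (negPf u1P) /= finv_g.
case: v1P => [h|h]; last by rewrite h in hm.
by rewrite hx (negPf h) andbF /= finv_g.
Qed.

Let inj1 : injective p1.
Proof. by apply: gback_slide_inj => *; apply: cyc_inj. Qed.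
Let inj2 : injective p2.
Proof. by apply: gback_slide_inj => *; apply: cyc_inj. Qed.

Let grid1_off x : ~~ exch E1 x -> grid1 x = grid0 x.
Proof. by rewrite /grid1 => /negPf ->. Qed.
Let grid2_off x : ~~ exch E2 x -> grid2 x = grid1 x.
Proof. by rewrite /grid2 => /negPf ->. Qed.

Let grid1_inj : injective grid1 :=
  splice_inj grid0_inj inj1 grid1_off E1_closed grid1_on.
Let conn1 := splice_conn grid0_inj inj1 grid1_off E1_closed grid1_on key0E tree1.
Let step1 := splice_p grid0_inj inj1 grid1_off E1_closed grid1_on key0E tree1.
Let conn2 := splice_conn grid1_inj inj2 grid2_off E2_closed grid2_on key1E tree2.
Let step2 := splice_p grid1_inj inj2 grid2_off E2_closed grid2_on key1E tree2.

Let R := fconnect grid2.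
Let R_cl u v w w' : cl w = cl w' -> R (u, v, w) (u, v, w').
Proof.
move=> h; apply/conn2/conn1; have [hs|hs] := boolP ((u == us) && (v == vs)).
  have /cycE c := L_cyc.
  apply: (fconnect_iter_sub (f := L) (h := fun w => (u, v, w))) (c w w') => z.
  by apply/fconnectP; exists 1; rewrite /= hs.
apply: (fconnect_iter_sub (f := g) (h := fun w => (u, v, w))) (cl_conn h) => z.
by apply/fconnectP; exists 1; rewrite /= (negPf hs).
Qed.

Let R_main u v w : R (u, v, w)
  (if mode (cl w) then (H1 (cl w) v u, v, w) else (u, K1 (cl w) u v, w)).
Proof.
have [w' e Ew] := E1_ex u v w.
apply: connect_trans (R_cl u v (esym e)) _.
have := conn2 (step1 (x := (u, v, w')) Ew); rewrite /p1 /gback /= e.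
case: ifP => hm /= h; apply: connect_trans h _; apply: R_cl;
  by rewrite cl_finv.
Qed.

Let R_row u u' v w : mode (cl w) -> R (u, v, w) (u', v, w).
Proof.
move=> hm; have /cycE c := H1_cyc (cl w) v.
apply: (fconnect_iter_sub (f := H1 (cl w) v) (h := fun u => (u, v, w))) (c u u').
by move=> z; have := R_main z v w; rewrite hm.
Qed.

Let R_col u v v' w : ~~ mode (cl w) -> R (u, v, w) (u, v', w).
Proof.
move=> hm; have /cycE c := K1_cyc (cl w) u.
apply: (fconnect_iter_sub (f := K1 (cl w) u) (h := fun v => (u, v, w))) (c v v').
by move=> z; have := R_main u z w; rewrite (negPf hm).
Qed.

Let R_all u v u' v' w : R (u, v, w) (u', v', w).
Proof.
have [hm|hm] := boolP (mode (cl w)).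
  have [h|h] := E2_row hm; first by rewrite (h v v'); apply: R_row.
  apply: connect_trans (R_row u u1 v hm) _.
  apply: connect_trans (R_row u1 u' v' hm).
  have /cycE c := K2_cyc (cl w) u1.
  apply: (fconnect_iter_sub (f := K2 (cl w) u1) (h := fun v => (u1, v, w)))
    (c v v') => z.
  have [w' e Ew] := h z; apply: connect_trans (R_cl u1 z (esym e)) _.
  have := step2 (x := (u1, z, w')) Ew; rewrite /p2 /gback /= e hm /= => h'.
  by apply: connect_trans h' _; apply: R_cl; rewrite cl_finv.
apply: connect_trans (R_col u v v1 hm) _.
apply: connect_trans (R_col u' v1 v' hm).
have /cycE c := H2_cyc (cl w) v1.
apply: (fconnect_iter_sub (f := H2 (cl w) v1) (h := fun u => (u, v1, w)))
  (c u u') => z.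
have [w' e Ew] := E2_col hm z; apply: connect_trans (R_cl z v1 (esym e)) _.
have := step2 (x := (z, v1, w')) Ew; rewrite /p2 /gback /= e (negPf hm) /= => h'.
by apply: connect_trans h' _; apply: R_cl; rewrite cl_finv.
Qed.

(** By splicing, points related by a default step or by a sliding stay in one cycle
    ([R_cl], [R_main]).  Hence each class above a line is connected, the lines
    are connected by [E2], and all classes meet in the slice, on which [L] is
    cyclic. *)
Lemma grid_cyc : cyc grid2.
Proof.
move=> x y; case: x => -[u v] w; case: y => -[u' v'] w'; apply/fconnectP.
rewrite -/(R _ _); apply: connect_trans (R_all u v us vs w) _.
apply: (connect_trans (y := (us, vs, w'))); last exact: R_all.
have /cycE c := L_cyc; apply/conn2/conn1.
apply: (fconnect_iter_sub (f := L) (h := fun w => (us, vs, w))) (c w w') => z.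
by apply/fconnectP; exists 1; rewrite /= !eqxx.
Qed.

End Grid.

Local Open Scope ring_scope.


(** * Return maps of a clock *)

Lemma pairE (S T : Type) (p q : S * T) : p = q -> p.1 = q.1 /\ p.2 = q.2.
Proof. by move=> ->. Qed.

Lemma addZ_neq n (b : 'Z_n) k : (1 < n)%N -> (0 < k < n)%N -> b + k%:R != b.
Proof.
move=> n1 /andP[k0 kn]; rewrite -subr_eq0 addrAC subrr add0r.
by rewrite (ZnR_eq n1 k 0) mod0n modn_small // -lt0n.
Qed.

Lemma iter_addZ1 n (W : Type) k (T : 'Z_n) (w : W) :
  iter k (fun x : 'Z_n * W => (x.1 + 1, x.2)) (T, w) = (T + k%:R, w).
Proof. by elim: k => [|k IH] /=; rewrite ?addr0 // IH /= mulrSr addrA. Qed.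

Section AddZ.
Variables (n : nat) (W : finType) (g : W -> 'Z_n).
Hypothesis n1 : (1 < n)%N.
Let F0 (x : 'Z_n * W) := (x.1 + 1, x.2).

Lemma addZ_inj : injective F0.
Proof. move=> [T w] [T' w']; rewrite /F0 => /pairE /= [h ->]. by move: h => /addIr ->. Qed.

Lemma addZ_reach (T : 'Z_n) w : exists k, iter k F0 (T, w) = (g w, w).
Proof. by exists (g w - T); rewrite iter_addZ1 -Zn_nat addrC subrK. Qed.

Definition sect w : 'Z_n * W := (g w, w).

Lemma sect_inj : injective sect.
Proof. by move=> w w' []. Qed.

Lemma sectP T w : ((T, w) \in codom sect) = (T == g w).
Proof. by apply/codomP/eqP => [[w' [-> ->]]|->]; last exists w. Qed.

Lemma sect_return w : returns sect F0 w w.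
Proof.
exists n.-1; split=> [|k kn].
  by rewrite iter_addZ1 prednK ?(ltnW n1) // Zn_n // addr0.
rewrite iter_addZ1 sectP addZ_neq //=.
by rewrite -ltnS prednK ?(ltnW n1) // in kn *.
Qed.

(** A second point on the fibre of [w0] turns the trivial return map into a
    transposition. *)
Variables (w0 : W) (e : nat).
Hypothesis e_lt : (0 < e < n)%N.

Definition sect2 (o : option W) : 'Z_n * W :=
  if o is Some w then (g w, w) else (g w0 + e%:R, w0).

Lemma sect2_inj : injective sect2.
Proof.
have ne := addZ_neq (g w0) n1 e_lt.
move=> [w|] [w'|] //= []; first by move=> _ ->.
  by move=> + h; rewrite h => /eqP; rewrite eq_sym (negPf ne).
by move=> + h; rewrite -h => /eqP; rewrite (negPf ne).
Qed.

Lemma sect2P T w :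
  ((T, w) \in codom sect2) = (T == g w) || (w == w0) && (T == g w0 + e%:R).
Proof.
apply/codomP/idP => [[[w'|] /= [-> ->]]|].
- by rewrite eqxx.
- by rewrite !eqxx orbT.
- by case/orP => [/eqP ->|/andP[/eqP -> /eqP ->]];
    [exists (Some w)|exists None].
Qed.

Definition swap2 (o : option W) : option W :=
  if o is Some w then if w == w0 then None else Some w else Some w0.

Lemma swap2K : involutive swap2.
Proof.
by move=> [w|] /=; [case: ifP => /= [/eqP ->|->] | rewrite eqxx].
Qed.

Lemma sect2_return o : returns sect2 F0 o (swap2 o).
Proof.
have [e0 en] := andP e_lt; case: o => [w|] /=.
  have [->|ne] := eqVneq w w0.
    exists e.-1; rewrite iter_addZ1 prednK //; split=> // k ke.
    have k1 : (k.+1 < e)%N by rewrite -(prednK e0) ltnS in ke *.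
    rewrite iter_addZ1 sect2P eqxx /= negb_or addZ_neq //=; last by lia.
    have -> : e = (k.+1 + (e - k.+1))%N by lia.
    by rewrite natrD addrA eq_sym addZ_neq //; lia.
  have [k [h1 h2]] := sect_return w.
  exists k; split=> // j jk; have := h2 j jk.
  by rewrite !iter_addZ1 sectP sect2P (negPf ne) orbF.
exists (n - e).-1; rewrite iter_addZ1 prednK ?subn_gt0 //; split.
  by rewrite -addrA -natrD subnKC ?(ltnW en) // Zn_n // addr0.
move=> k ke; have k1 : (e + k.+1 < n)%N by lia.
rewrite iter_addZ1 sect2P eqxx /= negb_or -addrA -natrD addZ_neq //=; last by lia.
by rewrite natrD addrA addZ_neq //; lia.
Qed.

End AddZ.

Section Theta.
Variables (m Q : nat) (s : 'Z_m).
Hypotheses (m1 : (1 < m)%N) (Q1 : (1 < Q)%N) (mQ : (m %| Q)%N).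
Hypothesis coQ : coprime m.-1 Q.

(** A clock [x.1] that stops for one tick of [x.2] whenever the sum of both is [s]
    modulo [m]. *)
Definition theta (x : 'Z_Q * 'Z_m) : 'Z_Q * 'Z_m :=
  if red m x.1 + x.2 == s then (x.1, x.2 + 1) else (x.1 + 1, x.2).

Lemma theta_inj : injective theta.
Proof.
have h d z : red m d + z = s -> red m (d - 1 : 'Z_Q) + (z + 1) == s.
  by move=> <-; rewrite -[X in _ == red m X + _](subrK 1 d) [X in _ == X + _]redD // red1 // addrA addrAC.
move=> [d z] [d' z']; rewrite /theta /=.
case: eqP => e; case: eqP => e' /pairE /= [].
- by move=> -> /addIr ->.
- by move=> ed ez; case: e'; apply/eqP; rewrite -ez; have := h _ _ e;
    rewrite ed addrK.
- by move=> ed ez; case: e; apply/eqP; rewrite ez; have := h _ _ e';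
    rewrite -ed addrK.
- by move=> /addIr -> ->.
Qed.

Lemma theta_run d z k : (forall j, (j < k)%N -> red m d + z + j%:R != s) ->
  iter k theta (d, z) = (d + k%:R, z).
Proof.
elim: k => [|k IH] h /=; first by rewrite addr0.
rewrite IH => [|j jk]; last exact/h/ltnW.
rewrite /theta /= redD // red_nat // addrAC (negPf (h k _)) //.
by rewrite mulrSr addrA.
Qed.

(** Between two ticks of [x.2] the clock advances [m - 1] times, which is prime to
    its period, so the points where it stops are permuted cyclically. *)
Lemma theta_cyc : cyc theta.
Proof.
apply: (cyc_base (x0 := (0, s)) theta_inj) => -[d z].
have sec : (0 : 'Z_Q, s) = (0 : 'Z_Q, s - red m (0 : 'Z_Q)).
  by rewrite red0 subr0.
rewrite sec.
have sym := fconnect_sym theta_inj.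
pose q : 'Z_m := s - red m d - z; pose d' : 'Z_Q := d + (q : nat)%:R.
apply: (@connect_trans _ _ (d', s - red m d')).
  apply/fconnectP; exists q; rewrite theta_run.
    by rewrite /d' redD // red_nat // -Zn_nat /q; congr pair; ring.
  move=> j jk; apply/eqP => h; move: jk.
  have -> : q = j%:R by rewrite /q -h; ring.
  by rewrite val_ZnR // ltnNge leq_mod.
move: d' => {z q} d'.
have co : cyc (fun d : 'Z_Q => d + m.-1%:R) by apply: cyc_addZ_coprime.
have [k <-] := co d' 0; elim: k => [|k IH] /=; first exact: connect0.
apply: connect_trans IH _; move: (iter k _ d') => {}d'.
apply/fconnectP; exists m.-1.+1; rewrite iterSr {2}/theta /= addrC subrK eqxx.
rewrite theta_run.
  have -> : s - red m d' + 1 = s - (red m d' + m.-1%:R); last by rewrite redD ?red_nat.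
  have -> : m.-1%:R = -1 :> 'Z_m.
    by apply/eqP; rewrite -addr_eq0 natr1 prednK ?(ltnW m1) // Zn_n.
  by ring.
move=> j jk; apply/eqP.
have -> : red m d' + (s - red m d' + 1) + j%:R = s + (j.+1)%:R.
  by rewrite mulrSr; ring.
apply/eqP/addZ_neq => //=.
by rewrite -ltnS prednK ?(ltnW m1) // in jk *.
Qed.

End Theta.

(** * Lifting cycles *)

Lemma count_Zn n (S : {set 'Z_n}) : (1 < n)%N ->
  count (fun k => (k%:R : 'Z_n) \in S) (iota 0 n) = #|S|.
Proof.
move=> n1; rewrite -sum1_count -sum1_card.
rewrite -[X in iota 0 X](Zp_cast n1) -[X in iota 0 X]subn0 -/(index_iota 0 _) big_mkord.
by apply: eq_bigl => k; rewrite natr_Zp.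
Qed.

Lemma sum_cyc (S : finType) (f : S -> S) (P : S -> nat) x : cyc f ->
  (\sum_(j < #|S|) P (iter j f x) = \sum_y P y)%N.
Proof.
move=> hf; pose h (j : 'I_#|S|) := iter j f x.
have hi : injective h.
  move=> j k /(cyc_iter_eq hf); rewrite !modn_small // => e.
  exact: val_inj.
have [h' hK Kh] : bijective h by apply: inj_card_bij; rewrite // card_ord.
by rewrite [RHS](reindex h) //; exists h' => y _; [apply: hK|apply: Kh].
Qed.

Section Lift.
Variables (Q N : nat) (W : finType).
Hypotheses (Q1 : (1 < Q)%N) (N1 : (1 < N)%N) (QN : (Q %| N)%N).
Variables (b : 'Z_Q -> W -> bool) (nx : 'Z_Q -> W -> W).

Definition lstep K (x : 'Z_K * W) : 'Z_K * W :=
  (x.1 + (b (red Q x.1) x.2 : nat)%:R, nx (red Q x.1) x.2).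

Let redQ (x : 'Z_Q) : red Q x = x. Proof. exact: natr_Zp. Qed.

(** One turn of the cycle below advances the lifted clock by [Q d].  As [d] is
    prime to [N], repeated turns reach all points above a given one. *)
Lemma lift_cyc d : cyc (@lstep Q) -> 
  (\sum_(x : 'Z_Q * W) b x.1 x.2 = Q * d)%N -> coprime d N -> cyc (@lstep N).
Proof.
move=> hc hD co.
have it k T w : exists a : nat,
    [/\ iter k (@lstep N) (T, w) = (T + a%:R, (iter k (@lstep Q) (red Q T, w)).2),
        red Q (T + a%:R) = (iter k (@lstep Q) (red Q T, w)).1
      & a = (\sum_(j < k) let x := iter j (@lstep Q) (red Q T, w) in b x.1 x.2)%N].
  elim: k => [|k [a [h1 h2 h3]]]; first by exists 0%N; rewrite big_ord0 !addr0.
  case e: (iter k (@lstep Q) _) h1 h2 => [t x] /= h1 h2.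
  exists (a + b t x)%N; rewrite !e h1 /lstep /= !redQ h2 natrD addrA; split=> //.
    by rewrite redD // h2 red_nat.
  by rewrite big_ord_recr /= -h3 e.
move=> [T w] [T' w'].
have [n hn] := hc (red Q T, w) (red Q T', w').
have [a [h1 h2 _]] := it n T w; rewrite hn /= in h1 h2.
set T1 := T + _ in h1 h2.
pose q : 'Z_N := T' - T1.
have /dvdnP[l hl] : (Q %| q)%N.
  have : red Q q = 0.
    by apply: (addIr (red Q T1)); rewrite -redD // /q subrK add0r.
  by move/eqP; rewrite (ZnR_eq Q1 q 0) mod0n.
have d0 : (0 < d)%N.
  by case: d co {hD} => //; rewrite /coprime gcd0n; case: N N1 => [|[]].
have [u [v huv]] : exists u v, (u * d = v * N + 1)%N.
  by case: (egcdnP N d0) => u v h _; exists u, v; rewrite h (eqP co).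
have loop k : iter (k * #|{: 'Z_Q * W}|) (@lstep N) (T1, w') =
    (T1 + (k * (Q * d))%:R, w').
  elim: k => [|k IH]; first by rewrite mul0n addr0.
  rewrite mulSn iterD IH.
  have [a' [h1' _ h3']] := it #|{: 'Z_Q * W}| (T1 + (k * (Q * d))%:R) w'.
  have sm := sum_cyc (fun x : 'Z_Q * W => b x.1 x.2 : nat) _ hc.
  rewrite h1' h3' sm hD (cyc_iter_card _ hc) /= mulSn [(_ * d + _)%N]addnC.
  by rewrite natrD addrA.
exists (u * l * #|{: 'Z_Q * W}| + n)%N; rewrite iterD h1 loop; congr pair.
have -> : (u * l * (Q * d) = q + v * (l * Q) * N)%N by rewrite hl; nia.
rewrite natrD natrM Zn_n // mulr0 addr0 natr_Zp.
by rewrite /q addrC subrK.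
Qed.

End Lift.

(** * Exchanges along a chain and on a line *)

(** The colour of a host, reduced to its clock and the guest coordinates [(y, z)].
    In the layer [s1] it takes over the guest colour [eta] along a chain of
    points [T + idx y = c z], and in the layer [s2] the last coordinate of the
    lines [y] in [S].  The clock stands still during an exchange. *)
Section Event.
Variables (m Q : nat) (Y : finType) (eta : Y -> Y) (idx : Y -> 'Z_Q).
Hypotheses (m1 : (1 < m)%N) (Q1 : (1 < Q)%N) (mQ : (m %| Q)%N).
Hypotheses (coQ : coprime m.-1 Q) (cardY : #|Y| = Q).
Hypotheses (idx_inj : injective idx) (idx_eta : forall y, idx (eta y) = idx y + 1).
Variables (c : 'Z_m -> 'Z_Q) (S : {set Y}) (s1 s2 : 'Z_m).
Hypotheses (cP : forall z, red m (c z) + z = s1) (s12 : s1 != s2).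
Hypothesis coS : coprime #|S| m.
Let W : finType := (Y * 'Z_m)%type.

Definition on_chain (t : 'Z_Q) (w : W) := t + idx w.1 == c w.2.
Definition on_line (t : 'Z_m) (w : W) :=
  (w.1 \in S) && (t + red m (idx w.1) + w.2 == s2).

Definition event N (x : 'Z_N * W) : 'Z_N * W :=
  if on_chain (red Q x.1) x.2 then (x.1, (eta x.2.1, x.2.2))
  else if on_line (red m x.1) x.2 then (x.1, (x.2.1, x.2.2 + 1))
  else (x.1 + 1, x.2).

Let redQ (x : 'Z_Q) : red Q x = x. Proof. exact: natr_Zp. Qed.

(** The two kinds of exchange never meet, as they belong to different layers. *)
Lemma chain_layer t w : on_chain t w -> red m t + red m (idx w.1) + w.2 = s1.
Proof. by move=> /eqP h; rewrite -redD // h cP. Qed.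

(** With [T + idx y] as the new clock, the chain becomes the exit from row [idx y]
    to the next row.  In the rows of [S] the map is [theta], and in the others a
    trivial clock. *)
Lemma event_base_cyc : cyc (@event Q).
Proof.
pose h (x : 'Z_Q * W) := ((x.1 + idx x.2.1, x.2.2), idx x.2.1).
have h_inj : injective h.
  move=> [T [y z]] [T' [y' z']] /pairE /= [/pairE /= [e ->] e'].
  by move: e; rewrite e' => /addIr ->; rewrite (idx_inj e').
pose E k := (k%:R : 'Z_Q) \in idx @: S.
pose G (x : ('Z_Q * 'Z_m) * 'Z_Q) : ('Z_Q * 'Z_m) * 'Z_Q :=
  (if E x.2 then theta s2 x.1 else (x.1.1 + 1, x.1.2),
   if x.1 \in codom (sect c) then x.2 + 1 else x.2).
apply: (cyc_conj (g := G) h_inj) => [[T [y z]]|].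
  rewrite /h /event /G /= redQ /on_chain /on_line /= sectP.
  have -> : E (idx y) = (y \in S).
    by rewrite /E natr_Zp; apply: mem_imset.
  rewrite /theta /= redD //; case: eqP => [e|ne] /=.
    rewrite idx_eta addrA -redD // e cP (negPf s12).
    by case: ifP.
  case hS: (y \in S) => /=; last by rewrite addrAC.
  by case: ifP => hl //=; rewrite addrAC.
apply: (@rows_cyc_id ('Z_Q * 'Z_m)%type 'Z_m (sect c) Q (@sect_inj Q _ c) Q1
  (fun x => (x.1 + 1, x.2)) (theta s2) (fun z => (c z + 1, z)) E).
- exact: addZ_inj.
- exact: theta_cyc.
- by [].
- by move=> z; rewrite /theta /= cP (negPf s12).
- move=> [T z]; have [k hk] := addZ_reach c T z.
  by exists k; rewrite hk; apply: (codom_f (sect c)).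
- exact: 0.
- by move=> u b.
- exact: sect_return.
by rewrite /E count_Zn // card_imset // card_Zn.
Qed.

(** The stops are [Q m] for the chain and [Q #|S|] for the lines, so a turn on
    [Z/Q] advances the clock by [Q (Q m - m - #|S|)], and the second factor is a
    unit modulo [m]. *)
Lemma event_cyc N k : (1 < N)%N -> (Q %| N)%N -> (N %| m ^ k)%N -> cyc (@event N).
Proof.
move=> N1 QN Nm; have mN := dvdn_trans mQ QN.
pose b (t : 'Z_Q) w := ~~ on_chain t w && ~~ on_line (red m t) w.
pose nx (t : 'Z_Q) w : W := if on_chain t w then (eta w.1, w.2)
  else if on_line (red m t) w then (w.1, w.2 + 1) else w.
have redr K (T : 'Z_K) : (1 < K)%N -> (Q %| K)%N -> red m (red Q T) = red m T.
  by move=> K1 QK; apply: (red_nat m1 (T : nat) Q1 mQ).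
have ls K : (1 < K)%N -> (Q %| K)%N -> forall x, event x = lstep b nx (x : 'Z_K * W).
  move=> K1 QK [T [y z]]; rewrite /event /lstep /b /nx /= redr //.
  by case: ifP => _ /=; [rewrite addr0|case: ifP; rewrite ?addr0].
have lc : cyc (@lstep Q W b nx Q).
  move=> x y; have [j <-] := event_base_cyc x y; exists j.
  by apply: eq_iter => z; rewrite ls.
suff : cyc (@lstep Q W b nx N).
  move=> h x y; have [j <-] := h x y; exists j; apply: eq_iter => z.
  by rewrite ls.
pose e1 := [set x : 'Z_Q * W | on_chain x.1 x.2].
pose e2 := [set x : 'Z_Q * W | on_line (red m x.1) x.2].
have c1 : #|e1| = (Q * m)%N.
  pose f (w : W) : 'Z_Q * W := (c w.2 - idx w.1, w).
  have -> : e1 = f @: [set: W].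
    apply/setP => -[T w]; rewrite inE /= /on_chain; apply/eqP/imsetP => /=.
      by move=> e; exists w; rewrite ?inE // /f -e addrK.
    by case=> w' _ [-> ->]; rewrite subrK.
  rewrite card_imset ?cardsT; last by move=> w w' [].
  by rewrite card_prod cardY card_Zn.
have c2 : #|e2| = (Q * #|S|)%N.
  pose f (x : 'Z_Q * Y) : 'Z_Q * W :=
    (x.1, (x.2, s2 - red m x.1 - red m (idx x.2))).
  have -> : e2 = f @: setX [set: 'Z_Q] S.
    apply/setP => -[T [y z]]; rewrite inE /= /on_line /=; apply/andP/imsetP.
      case=> yS /eqP e; exists (T, y); first by rewrite !inE.
      by rewrite /f /= -e; congr (_, (_, _)); ring.
    by case=> -[T' y']; rewrite !inE /= => yS [-> -> ->]; split=> //; apply/eqP; ring.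
  rewrite card_imset; last by move=> [T y] [T' y'] [-> ->].
  by rewrite cardsX cardsT card_Zn.
have dis : e1 :&: e2 = set0.
  apply/setP => -[T w]; rewrite !inE /=; apply/negP => /andP[h /andP[_ /eqP h2]].
  by move: s12; rewrite -h2 -(chain_layer h) eqxx.
have Sle : (#|S| <= Q)%N by rewrite -cardY; apply: max_card.
apply: (lift_cyc Q1 N1 QN (d := Q * m - m - #|S|)%N lc).
  have -> : (\sum_x b x.1 x.2 = #|~: (e1 :|: e2)|)%N.
    rewrite -sum1_card [RHS]big_mkcond /=; apply: eq_bigr => x _.
    by rewrite !inE negb_or /b; case: (_ && _).
  rewrite cardsCs setCK cardsU dis cards0 subn0 c1 c2.
  by rewrite !card_prod cardY !card_Zn // !mulnBr subnDA.
apply: (coprime_dvdr Nm); apply: coprimeXr.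
rewrite /coprime; apply/eqP/gcdn_def; rewrite ?dvd1n // => q q1 q2.
have le : (#|S| <= Q * m - m)%N.
  have aux a b' : (1 < a -> 1 < b' -> a + b' <= a * b')%N by clear; nia.
  by apply: (leq_trans Sle); rewrite -(leq_add2r m) subnK ?aux // leq_pmull // ltnW.
have : (q %| #|S|)%N.
  rewrite -(dvdn_addr #|S| q1) subnK //.
  by apply: dvdn_sub => //; apply: dvdn_mull.
by move: coS => /eqP <- h; rewrite dvdn_gcd h.
Qed.

End Event.

(** Numbers the points along the cycle, from a start that makes the numbers agree
    with the given grading modulo [m]. *)
Lemma idx_exists (m M : nat) (T : finType) (f : T -> T) (l : T -> 'Z_m) :
  (1 < m)%N -> (1 < M)%N -> (m %| M)%N -> #|T| = M -> cyc f ->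
  (forall x, l (f x) = l x + 1) ->
  exists idx : T -> 'Z_M, [/\ injective idx, forall x, idx (f x) = idx x + 1
    & forall x, red m (idx x) = l x].
Proof.
move=> m1 M1 mM cT hf hl.
have /card_gt0P[x0 _] : (0 < #|T|)%N by rewrite cT ltnW.
pose k x := findex f x0 x.
have kP x : iter (k x) f x0 = x by apply: iter_findex; move/cycE: hf.
have kl x : (k x < M)%N.
  by rewrite -cT -(cyc_order x0 hf); apply: findex_max; move/cycE: hf.
exists (fun x => (k x)%:R + (l x0 : nat)%:R); split.
- move=> x y /addIr /eqP; rewrite ZnR_eq // !modn_small // => /eqP e.
  by rewrite -(kP x) e kP.
- move=> x; rewrite addrAC natr1; congr (_ + _); apply/eqP.
  rewrite ZnR_eq // -cT; apply/eqP/(cyc_iter_eq (f := f) (x := x0)) => //.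
  by rewrite iterS !kP.
move=> x; rewrite redD // !red_nat // natr_Zp -[in RHS](kP x).
by elim: (k x) => [|n IH] /=; rewrite ?add0r // hl -IH mulrSr addrAC.
Qed.

(** * Resolutions *)

Section Res.
Implicit Types X Y I J : finType.

(** The maps [F i] are the arcs leaving each point; a resolution assigns at each
    point one arc to each colour so that every colour is a Hamilton cycle. *)
Definition Res X I (F : I -> X -> X) :=
  exists2 rho : X -> I -> I, forall x, injective (rho x)
    & forall c, cyc (fun x => F (rho x c) x).

Lemma res_refine X I (F D : I -> X -> X) (rho : X -> I -> I) :
  (forall x, injective (rho x)) -> (forall c x, D c x = F (rho x c) x) ->
  Res D -> Res F.
Proof.
move=> ri DE [s si sc]; exists (fun x => rho x \o s x).
  by move=> x; apply: inj_comp.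
by move=> c x y; have [n <-] := sc c x y; exists n; apply: eq_iter => z /=; rewrite DE.
Qed.

Lemma res_conj X Y I J (h : X -> Y) (k : I -> J) (F : I -> X -> X) (G : J -> Y -> Y) :
  injective h -> bijective k -> (forall i x, h (F i x) = G (k i) (h x)) ->
  Res G -> Res F.
Proof.
move=> hi [k' kK k'K] hFG [r ri rc].
exists (fun x => k' \o r (h x) \o k) => [x|c].
  by apply: inj_comp; [apply: inj_comp => //; apply: can_inj k'K|apply: can_inj kK].
by apply: (cyc_conj hi _ (rc (k c))) => x /=; rewrite hFG k'K.
Qed.

(** * Tori *)
Variable m : nat.
Hypothesis m1 : (1 < m)%N.

Definition tor I := {ffun I -> 'Z_m}.
Definition bump I (i : I) (x : tor I) : tor I :=
  [ffun j => x j + (j == i : nat)%:R].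
Definition lay I (x : tor I) : 'Z_m := \sum_i x i.

Definition TorRes I := Res (@bump I).

Lemma lay_bump I (i : I) x : lay (bump i x) = lay x + 1.
Proof.
rewrite /lay (eq_bigr (fun j => x j + (j == i : nat)%:R)) => [|j _]; last by rewrite ffunE.
by rewrite big_split /= [X in _ + X](bigD1 i) //= eqxx [X in _ + (_ + X)]big1 ?addr0 // => j /negPf ->.
Qed.

Lemma card_tor I : #|{: tor I}| = (m ^ #|I|)%N.
Proof. by rewrite card_ffun card_Zn. Qed.

Lemma torres_card I J : #|I| = #|J| -> TorRes I -> TorRes J.
Proof.
move=> e; have [k [k' kK k'K]] : exists k : J -> I, bijective k.
  exists (fun j => enum_val (cast_ord (esym e) (enum_rank j))).
  exists (fun i => enum_val (cast_ord e (enum_rank i))) => x.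
    by rewrite enum_valK cast_ordKV enum_rankK.
  by rewrite enum_valK cast_ordK enum_rankK.
apply: (@res_conj _ _ _ _ (fun x : tor J => [ffun i => x (k' i)] : tor I) k).
- by move=> x y /ffunP h; apply/ffunP => j; have := h (k j); rewrite !ffunE kK.
- by exists k'.
move=> j x; apply/ffunP => i; rewrite !ffunE.
by rewrite -(can_eq k'K) kK.
Qed.

Definition tsum I J X Y (F : I -> X -> X) (G : J -> Y -> Y) (c : I + J)
  (x : X * Y) : X * Y :=
  match c with inl i => (F i x.1, x.2) | inr j => (x.1, G j x.2) end.

Lemma torres_sum I J : Res (tsum (@bump I) (@bump J)) -> TorRes (I + J)%type.
Proof.
apply: (@res_conj _ _ _ _ (fun x : tor (I + J)%type =>
   ([ffun i => x (inl i)] : tor I, [ffun j => x (inr j)] : tor J)) id).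
- move=> x y /pairE /= [/ffunP h1 /ffunP h2]; apply/ffunP => -[i|j].
    by have := h1 i; rewrite !ffunE.
  by have := h2 j; rewrite !ffunE.
- by exists id.
by case=> [i|j] x /=; congr pair; apply/ffunP => k; rewrite !ffunE //= addr0.
Qed.

(** The arcs of a factor may be replaced by the colours of any assignment on it. *)
Lemma res_sum X Y I J (F D : I -> X -> X) (G E : J -> Y -> Y) r s :
  (forall x, injective (r x)) -> (forall c x, D c x = F (r x c) x) ->
  (forall y, injective (s y)) -> (forall c y, E c y = G (s y c) y) ->
  Res (tsum D E) -> Res (tsum F G).
Proof.
move=> ri DE si EG.
apply: (@res_refine _ _ _ _ (fun x c => match c with inl i => inl (r x.1 i) | inr j => inr (s x.2 j) end)).
  by move=> x [i|j] [i'|j'] // [] => [/ri|/si] ->.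
by case=> [i|j] x /=; rewrite ?DE ?EG.
Qed.

Lemma torres1 : TorRes unit.
Proof.
exists (fun _ => id) => [? ? ?|[]] //=.
apply: (@cyc_conj (tor unit) 'Z_m (fun x => x tt) _ (fun x => x + 1)).
- by move=> x y h; apply/ffunP => -[].
- by move=> x; rewrite ffunE.
exact: cyc_addZ.
Qed.

End Res.

(** * Colours with exits and events *)

(** One of two colours [H] and [K], on a product, that exchange their roles at the
    exits [J].  In the rows [E] it also takes part in events, which let it move
    in [W].  The sum of the two indices is its clock and [iK] its row. *)
Section Host.
Variables (M : nat) (A B W : finType) (H : A -> A) (K : B -> B).
Variables (iH : A -> 'Z_M) (iK : B -> 'Z_M).
Hypotheses (M1 : (1 < M)%N) (iH_inj : injective iH) (iK_inj : injective iK).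
Hypotheses (iHE : forall u, iH (H u) = iH u + 1) (iKE : forall v, iK (K v) = iK v + 1).
Variables (g : W -> 'Z_M) (FE : 'Z_M * W -> 'Z_M * W).
Variables (stay : 'Z_M -> W -> bool) (nx : 'Z_M -> W -> W) (E : pred nat).
Hypotheses (FE_cyc : cyc FE) (w0 : W).
Hypothesis FEE : forall T w,
  FE (T, w) = if stay T w then (T, nx T w) else (T + 1, w).
Variables (J : 'Z_M -> W -> bool) (C : A * B * W -> A * B * W).
Hypothesis stayJ : forall T w, J T w -> ~~ stay T w.
Hypothesis CE : forall u v w, let T := iH u + iK v in
  C (u, v, w) = if E (iK v) && stay T w then (u, v, nx T w)
    else if J T w then (u, K v, w) else (H u, v, w).

Let h (x : A * B * W) : ('Z_M * W) * 'Z_M := ((iH x.1.1 + iK x.1.2, x.2), iK x.1.2).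
Let h_inj : injective h.
Proof.
move=> [[u v] w] [[u' v'] w'] /pairE /= [/pairE /= [e ->] e'].
by move: e; rewrite e' => /addIr /iH_inj ->; rewrite (iK_inj e').
Qed.
Let F0 (x : 'Z_M * W) := (x.1 + 1, x.2).
Let G (x : ('Z_M * W) * 'Z_M) := (if E x.2 then FE x.1 else F0 x.1,
   if J x.1.1 x.1.2 then x.2 + 1 else x.2).

Let hC x : h (C x) = G (h x).
Proof.
case: x => -[u v] w; rewrite CE /h /G /= FEE /F0 /=.
case: ifP => [/andP[-> st]|ns] /=.
  by rewrite st (negbTE (contraL (@stayJ _ _) st)).
case: ifP => j /=; rewrite ?iKE ?iHE.
  by rewrite (negPf (stayJ j)) addrA; case: ifP.
move: ns; case: (E _) => //= [->|_]; first by rewrite addrAC.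
by rewrite addrAC.
Qed.

Lemma host_id : (forall T w, J T w = (T == g w)) ->
  coprime (count E (iota 0 M)) #|W| -> cyc C.
Proof.
move=> JE co; apply: (cyc_conj h_inj hC).
apply: (@rows_cyc_id ('Z_M * W)%type W (sect g) M (@sect_inj M _ g) M1
  F0 FE (fun w => (g w + 1, w)) E) => //.
- exact: addZ_inj.
- by move=> w; rewrite FEE (negPf (stayJ _)) // JE.
- move=> [T w]; have [k hk] := addZ_reach g T w.
  by exists k; rewrite hk; apply: (codom_f (sect g)).
- by move=> [T w] b; rewrite /G /= sectP JE.
exact: sect_return.
Qed.

(** With a second exit above a single point [w0] a trivial row acts as a
    transposition instead of the identity.  This allows the number of event rows
    to be a multiple of [m], as the section has one point
    more. *)
Lemma host_swap e n : (0 < e < M)%N ->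
  (forall T w, J T w = (T == g w) || (w == w0) && (T == g w0 + e%:R)) ->
  (forall k, (k < M)%N -> E k = (k < n)%N) -> (n <= M)%N -> ~~ odd (M - n) ->
  coprime n #|W|.+1 -> cyc C.
Proof.
move=> eM JE En nM ev co; apply: (cyc_conj h_inj hC).
pose s2 o : 'Z_M * W := let x := sect2 g w0 e o in (x.1 + 1, x.2).
apply: (@rows_cyc_swap ('Z_M * W)%type (option W) (sect2 g w0 e) M
  (sect2_inj M1 eM) M1 F0 FE s2 E _ _ _ _ _ (Some w0) G _ (swap2 w0) n) => //.
- exact: addZ_inj.
- case=> [w|]; rewrite /s2 /= FEE (negPf (stayJ _)) // JE ?eqxx //.
  by rewrite orbT.
- move=> [T w]; have [k hk] := addZ_reach g T w.
  by exists k; rewrite hk; apply: (codom_f (sect2 g w0 e) (Some w)).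
- by move=> [T w] b; rewrite /G /= sect2P JE.
- exact: swap2K.
- exact: sect2_return.
by rewrite card_option.
Qed.

End Host.

Lemma idx_family (m M : nat) (X I : finType) (F : I -> X -> X) (l : X -> 'Z_m) :
  (1 < m)%N -> (1 < M)%N -> (m %| M)%N -> #|X| = M -> (forall i, cyc (F i)) ->
  (forall i x, l (F i x) = l x + 1) ->
  exists idx : I -> X -> 'Z_M, forall i, [/\ injective (idx i),
    forall x, idx i (F i x) = idx i x + 1 & forall x, red m (idx i x) = l x].
Proof.
move=> m1 M1 mM cX Fc Fl.
have ex i : exists idx : X -> 'Z_M, [/\ injective idx,
    forall x, idx (F i x) = idx x + 1 & forall x, red m (idx x) = l x].
  by apply: idx_exists.
exact: (fin_all_exists ex).
Qed.

(** The colours exchange their roles where the clock is zero: then the clock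
    advances at each step, and the row once in each turn. *)
Lemma res_join (m M : nat) (A B I : finType) (H : I -> A -> A) (K : I -> B -> B)
    (lA : A -> 'Z_m) (lB : B -> 'Z_m) :
  (1 < m)%N -> (1 < M)%N -> (m %| M)%N -> #|A| = M -> #|B| = M ->
  (forall i, cyc (H i)) -> (forall i, cyc (K i)) ->
  (forall i x, lA (H i x) = lA x + 1) -> (forall i x, lB (K i x) = lB x + 1) ->
  Res (tsum H K).
Proof.
move=> m1 M1 mM cA cB Hc Kc Hl Kl.
have [iH iHP] := idx_family m1 M1 mM cA Hc Hl.
have [iK iKP] := idx_family m1 M1 mM cB Kc Kl.
pose J i (x : A * B) := iH i x.1 + iK i x.2 == 0.
pose sw x (c : I + I) := match c with
  | inl i => if J i x then inr i else inl i
  | inr i => if J i x then inl i else inr i end.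
exists sw => [x|].
  have swK : involutive (sw x) by case=> i /=; case: ifP => /= ->.
  exact: can_inj swK.
have cT : cyc (fun x : 'Z_M * unit => (x.1 + 1, x.2)).
  apply: (@cyc_conj _ _ fst _ (fun x => x + 1)) => [[x []] [y []] /= -> //|//|].
  exact: cyc_addZ.
case=> i; have [iHi iHE _] := iHP i; have [iKi iKE _] := iKP i.
  pose C (x : A * B * unit) := (if J i x.1 then (x.1.1, K i x.1.2, x.2)
    else (H i x.1.1, x.1.2, x.2)).
  apply: (@cyc_conj _ _ (fun x : A * B => (x, tt)) _ C) => [x y [] //||].
    by move=> x; rewrite /= /C /=; case: ifP.
  by apply: (@host_id M A B unit (H i) (K i) (iH i) (iK i) M1 iHi iKi iHE iKE
    (fun _ => 0) _ (fun _ _ => false) (fun _ => id) pred0 cT tt _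
    (fun T _ => T == 0) C) => //; rewrite count_pred0 card_unit.
pose C (x : B * A * unit) := (if J i (x.1.2, x.1.1) then (x.1.1, H i x.1.2, x.2)
  else (K i x.1.1, x.1.2, x.2)).
apply: (@cyc_conj _ _ (fun x : A * B => ((x.2, x.1), tt)) _ C).
- by move=> [x1 x2] [y1 y2] [-> ->].
- by move=> [x1 x2]; rewrite /= /C /=; case: ifP.
apply: (@host_id M B A unit (K i) (H i) (iK i) (iH i) M1 iKi iHi iKE iHE
    (fun _ => 0) _ (fun _ _ => false) (fun _ => id) pred0 cT tt _
    (fun T _ => T == 0) C) => //; last by rewrite count_pred0 card_unit.
by move=> u v w; rewrite /C /J /= addrC.
Qed.

Local Close Scope ring_scope.

(** * Layer patterns for even m *)

(** The code [pijk] is the permutation that gives the colours 0, 1, 2 the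
    generators [i], [j], [k].  A layer is seen through the last two coordinates,
    so that generator 0 does not move, and generators 1 and 2 advance the first
    and the second one. *)
Definition p012 := [:: 0; 1; 2].
Definition p021 := [:: 0; 2; 1].
Definition p102 := [:: 1; 0; 2].
Definition p120 := [:: 1; 2; 0].
Definition p201 := [:: 2; 0; 1].
Definition p210 := [:: 2; 1; 0].

Section Patterns.
Variable m : nat.

Definition succ_wrap x := if x.+1 == m then 0 else x.+1.
Definition move g (x : nat * nat) :=
  if g == 0 then x else if g == 1 then (succ_wrap x.1, x.2) else (x.1, succ_wrap x.2).
Definition layer_step (p : nat -> nat -> seq nat) k x := move (nth 0 (p x.1 x.2) k) x.

(** Along a row, a column or an antidiagonal two generators can be exchanged
    without losing injectivity.  Here all three kinds of lines meet, and the
    pattern near their crossing makes the three layer maps injective with the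
    parities that lines alone cannot give. *)
Definition pG i j :=
  if i == 0 then
    if j == m.-1 then p120 else if j == 1 then p201 else p210
  else if i == 1 then
    if j == m.-1 then p201 else if j == 0 then p120 else p012
  else if j == 0 then p102 else if i + j == m then p021 else p012.
Definition pRow r (i j : nat) := if j == r then p102 else p012.
Definition pC (i j : nat) := if i == 0 then p012 else p210.
Definition pR (i j : nat) := if j == 0 then p012 else p102.
Definition pD (i j : nat) :=
  if (i + j == 2) || (i + j == m + 2) then p021 else p012.
Definition coast x := if x < 6 then x + (m - 6) else x - 6.
Definition coast_rest k (x : nat * nat) :=
  if k == 0 then x else if k == 1 then (coast x.1, x.2) else (x.1, coast x.2).

(** One round of colour [k] through the layers: the crossing of lines, the two
    default layers, one pattern with a column, a row and an antidiagonal each,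
    and [m - 6] trivial layers. *)
Definition even_ret k x :=
  coast_rest k (layer_step pD k (layer_step pR k (layer_step pC k (layer_step (pRow 0) k (layer_step (pRow m.-1) k (layer_step pG k x)))))).

Definition even_tab0 i j :=
  if j == 0 then
    if i == 0 then (1, 1) else if i == m - 2 then (0, 0)
    else if i + 3 < m then (i + 3, 1) else (i + 3 - m, 1)
  else if j == m.-1 then
    if i == 0 then (2, 0) else if i == 1 then (3, 1)
    else if i == m.-1 then (1, m.-1) else (i.+1, 0)
  else if (i == 0) && (j == m - 2) then (1, 0)
  else (succ_wrap i, j.+1).

End Patterns.

(** Decides the tests of a piecewise defined map by linear arithmetic, and splits
    into cases on those that remain open. *)
Ltac decide_ifs := repeat match goal with
  | |- context [if ?b then _ else _] =>
    lazymatch b with context [if _ then _ else _] => fail | _ =>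
      first [ have -> : b = true by lia | have -> : b = false by lia
            | let E := fresh "E" in case E : b ] end; cbn [fst snd nth]
  end.
Ltac sim1 := match goal with
  | |- context [layer_step ?m ?p ?k (?i, ?j)] =>
    let t := eval cbv beta delta [move pD pC pR pRow pG p012 p021 p102 p120 p201 p210 succ_wrap]
      in (move m (nth 0 (p i j) k) (i, j)) in
    change (layer_step m p k (i, j)) with t; cbn [fst snd]; decide_ifs
  end.
Ltac sim := cbn [fst snd]; decide_ifs; repeat sim1;
  rewrite /coast_rest /coast; cbn [fst snd eqn eq_op]; decide_ifs; first [congr pair; lia | exfalso; lia | idtac].

Lemma ret0E m i j : 6 <= m -> i < m -> j < m -> even_ret m 0 (i, j) = even_tab0 m i j.
Proof.
move=> m6 im jm; rewrite /even_ret /even_tab0 /succ_wrap.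
sim.
Qed.

Definition even_tab2 m i j :=
  if (i == 0) && (j == 0) then (0, m.-1)
  else if (i == 0) && (j == 1) then (1, m.-1)
  else if (i == 1) && (j == 0) then (1, m - 2)
  else if (i == m.-1) && (j == 1) then (0, 0)
  else if (i + j == m) || (i + j == m - 2) || (i + j == m + m - 2) then
    (succ_wrap m i, if j < 2 then j + m - 2 else j - 2)
  else (i, if j == 0 then m.-1 else j.-1).

Lemma ret2E m i j : 6 <= m -> i < m -> j < m -> even_ret m 2 (i, j) = even_tab2 m i j.
Proof.
move=> m6 im jm; rewrite /even_ret /even_tab2 /succ_wrap.
sim.
Qed.

Definition sub_wrap m k i := if i < k then i + m - k else i - k.
Definition even_tab1 m i j :=
  if j == 0 then
    if i == 0 then (m.-1, 0) else if i == 1 then (m.-1, 1)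
    else if i == m.-1 then (m - 4, 1) else (i - 2, 0)
  else if j == m.-1 then
    if i == 0 then (m - 2, 0) else if i == 1 then (m - 3, 0)
    else (i - 2, m.-1)
  else if (i == 0) && (j == 1) then (m - 2, 1)
  else if (i == 2) && (j == m - 2) then (m.-1, m.-1)
  else if (i + j == m) || (i + j == m - 2) then (sub_wrap m 2 i, j.+1)
  else (sub_wrap m 1 i, j).
Lemma ret1E m i j : 6 <= m -> i < m -> j < m -> even_ret m 1 (i, j) = even_tab1 m i j.
Proof.
move=> m6 im jm; rewrite /even_ret /even_tab1 /sub_wrap.
sim.
Qed.

(** * Orbits of the three return maps *)

Definition reach (T : Type) (R : T -> T) x y := exists n, iter n R x = y.

Lemma reach_trans T (R : T -> T) y x z : reach R x y -> reach R y z -> reach R x z.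
Proof. by move=> [n hn] [k hk]; exists (k + n); rewrite iterD hn. Qed.
Lemma reach1 T (R : T -> T) x y : R x = y -> reach R x y.
Proof. by exists 1. Qed.
Lemma reach0 T (R : T -> T) x : reach R x x.
Proof. by exists 0. Qed.

Ltac table := rewrite /succ_wrap /sub_wrap; cbn [fst snd]; decide_ifs; try (congr pair; lia).

Section Even.
Variable m : nat.
Hypotheses (m6 : 6 <= m) (ev : ~~ odd m).

(** Colour 0 generically moves diagonally upwards.  It meets row 0 in the columns
    0, 1, 3, 5, ..., m - 1, 2, 4, ..., m - 2 and then 0 again. *)
Section C0.
Let R := even_ret m 0.
Let step i j x : i < m -> j < m -> even_tab0 m i j = x -> reach R (i, j) x.
Proof. by move=> im jm <-; apply: reach1; apply: ret0E. Qed.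

Let diag i j s : i + s < m -> 1 <= j -> j + s <= m - 2 -> reach R (i, j) (i + s, j + s).
Proof.
elim: s => [|s IH] h1 h2 h3; first by rewrite !addn0; apply: reach0.
apply: (@reach_trans _ _ (i + s, j + s)); first by apply: IH; lia.
by apply: step; try lia; rewrite /even_tab0; table.
Qed.

Let diagw i j s : i < m -> m <= i + s < m + m -> 1 <= j -> j + s <= m - 2 ->
  reach R (i, j) (i + s - m, j + s).
Proof.
move=> im h1 h2 h3; apply: (@reach_trans _ _ (m.-1, j + (m.-1 - i))).
  have h := @diag i j (m.-1 - i); have e : i + (m.-1 - i) = m.-1 by lia.
  by rewrite e in h; apply: h; lia.
apply: (@reach_trans _ _ (0, j + (m - i))); first by apply: step; try lia; rewrite /even_tab0; table.
have -> : (i + s - m, j + s) = (0 + (i + s - m), (j + (m - i)) + (i + s - m)).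
  by congr pair; lia.
by apply: diag; lia.
Qed.

Let up_diag c i j : c < m -> i < m -> 1 <= j <= m - 2 -> c != 0 -> c != m - 2 ->
  (c + 3 + j.-1 == i) || (c + 3 + j.-1 == i + m) ->
  reach R (c, 0) (i, j).
Proof.
move=> cm im jm c0 c2 e.
have [c' [c'm e1 e2]] : exists c', [/\ c' < m, (c' == c + 3) || (c' + m == c + 3)
   & reach R (c, 0) (c', 1)].
  exists (if c + 3 < m then c + 3 else c + 3 - m); split; try by case: ifP; lia.
  by apply: step; try lia; rewrite /even_tab0; table.
apply: reach_trans e2 _; have ej : j = 1 + j.-1 by lia.
have [lt|ge] := ltnP (c' + j.-1) m.
  have -> : i = c' + j.-1 by lia.
  by rewrite {2}ej; apply: diag; lia.
have -> : i = c' + j.-1 - m by lia.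
by rewrite {2}ej; apply: diagw; lia.
Qed.


Let row2 i : 1 <= i <= m - 3 -> reach R (i, 0) (i + 2, 0).
Proof.
move=> h; apply: (@reach_trans _ _ (i.+1, m.-1)); last first.
  by apply: step; try lia; rewrite /even_tab0; table.
by apply: (@reach_trans _ _ (i, m - 2)); [apply: up_diag; lia | apply: step; try lia; rewrite /even_tab0; table].
Qed.

Let loop0 i j : i = j -> i < m -> reach R (0, 0) (i, j).
Proof.
move=> <-; case: i => [|i] im; first exact: reach0.
apply: (@reach_trans _ _ (1, 1)); first by apply: step; try lia; rewrite /even_tab0; table.
have [lt|ge] := ltnP i.+1 m.-1.
  by rewrite -add1n; apply: diag; lia.
apply: (@reach_trans _ _ (1 + (m - 3), 1 + (m - 3))); first by apply: diag; lia.
by apply: step; try lia; rewrite /even_tab0; table.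
Qed.

Let loop1 j : 1 <= j <= m - 2 -> reach R (0, 0) (if j == m - 2 then 0 else j + 2, j).
Proof.
move=> h; apply: (@reach_trans _ _ (m.-1, m.-1)); first by apply: loop0; lia.
apply: (@reach_trans _ _ (1, m.-1)); first by apply: step; try lia; rewrite /even_tab0; table.
apply: (@reach_trans _ _ (3, 1)); first by apply: step; try lia; rewrite /even_tab0; table.
case: ifP => e.
  have -> : (0, j) = (3 + (m - 3) - m, 1 + (m - 3)) by congr pair; lia.
  by apply: diagw; lia.
have -> : (j + 2, j) = (3 + j.-1, 1 + j.-1) by congr pair; lia.
by apply: diag; lia.
Qed.

Let rows i : i < m -> reach R (0, 0) (i, 0).
Proof.
have odds k : k.*2.+1 < m -> reach R (0, 0) (k.*2.+1, 0).
  elim: k => [|k IH] h.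
    apply: (@reach_trans _ _ (0, m - 2)); last by apply: step; try lia; rewrite /even_tab0; table.
    by have := @loop1 (m - 2); rewrite eqxx; apply; lia.
  by apply: reach_trans (IH _) _; [lia | rewrite doubleS -addn2; apply: row2; lia].
have evens k : k.*2.+2 < m -> reach R (0, 0) (k.*2.+2, 0).
  elim: k => [|k IH] h.
    apply: (@reach_trans _ _ (m./2.-1.*2.+1, 0)); first by apply: odds; lia.
    have -> : m./2.-1.*2.+1 = m.-1 by lia.
    apply: (@reach_trans _ _ (0, m.-1)); last by apply: step; try lia; rewrite /even_tab0; table.
    by apply: (@reach_trans _ _ (m.-1, m - 2)); [apply: up_diag; lia | apply: step; try lia; rewrite /even_tab0; table].
  by apply: reach_trans (IH _) _; [lia | rewrite doubleS -[_.+2.+2]addn2; apply: row2; lia].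
move=> im; case: i im => [|i] im; first exact: reach0.
case o: (odd i); last by have -> : i.+1 = i./2.*2.+1 by [lia]; apply: odds; lia.
by have -> : i.+1 = i./2.*2.+2 by [lia]; apply: evens; lia.
Qed.

Let low i j : i < m -> 1 <= j <= m - 2 -> reach R (0, 0) (i, j).
Proof.
move=> im h; have [->|ne] := eqVneq i j; first by apply: loop0; lia.
have [e|ne2] := eqVneq i (if j == m - 2 then 0 else j + 2); first by rewrite e; apply: loop1.
pose c := if j + 2 < i then i - (j + 2) else if j + 2 < i + m then i + m - (j + 2) else 0.
have cP : [&& c < m, c != 0, c != m - 2 &
  (c + 3 + j.-1 == i) || (c + 3 + j.-1 == i + m)].
  by move: ne2; rewrite /c; do 3?case: ifP; lia.
have /and4P[c1 c2 c3 c4] := cP.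
by apply: reach_trans (rows c1) _; apply: up_diag.
Qed.

Lemma even0 i j : i < m -> j < m -> reach R (0, 0) (i, j).
Proof.
move=> im jm; case: (posnP j) => [->|j0]; first exact: rows.
have [le|gt] := leqP j (m - 2); first by apply: low; lia.
have -> : j = m.-1 by lia.
have [->|n1] := eqVneq i 1.
  apply: (@reach_trans _ _ (m.-1, m.-1)); first by apply: loop0; lia.
  by apply: step; try lia; rewrite /even_tab0; table.
apply: (@reach_trans _ _ (if i == 0 then m.-1 else i.-1, m - 2)).
  by apply: low; try case: ifP; lia.
by case: ifP => e; apply: step; try lia; rewrite /even_tab0; table.
Qed.

Lemma even0_back : R (m - 2, 0) = (0, 0).
Proof. by rewrite /R ret0E ; try lia; rewrite /even_tab0; table. Qed.

End C0.

(** Colour 2 generically moves from an antidiagonal to the preceding one.  It meets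
    the antidiagonal 0 in the columns 0, 2, 4, ..., m - 2, 1, 3, ..., m - 1 and then 0
    again. *)
Section C2.
Let R := even_ret m 2.
Let step i j x : i < m -> j < m -> even_tab2 m i j = x -> reach R (i, j) x.
Proof. by move=> im jm <-; apply: reach1; apply: ret2E. Qed.

(* the point of column [i] on the antidiagonal of index [d] *)
Let pt i d := (i, if i <= d then d - i else d + m - i).
Let ptE i j : i < m -> j < m -> (i, j) = pt i (if i + j < m then i + j else i + j - m).
Proof. by rewrite /pt => im jm; congr pair; do 2?case: ifP; lia. Qed.

Let stepd i d i' d' : i < m -> d < m ->
  even_tab2 m i (if i <= d then d - i else d + m - i) = pt i' d' -> reach R (pt i d) (pt i' d').
Proof. by move=> im dm h; apply: step => //; case: ifP; lia. Qed.

Let down i d s : i < m -> d <= m - 3 -> 0 < d - s -> reach R (pt i d) (pt i (d - s)).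
Proof.
move=> im dm; elim: s => [|s IH] h; first by rewrite subn0; apply: reach0.
apply: (@reach_trans _ _ (pt i (d - s))); first by apply: IH; lia.
by apply: stepd; try lia; rewrite /even_tab2 /pt; table.
Qed.

Let top1 c : c < m -> reach R (pt c m.-1) (pt c (m - 2)).
Proof. by move=> cm; apply: stepd; try lia; rewrite /even_tab2 /pt; table. Qed.

Let col c d : c < m -> 1 <= d <= m - 3 -> reach R (pt c m.-1) (pt (succ_wrap m c) d).
Proof.
move=> cm h; apply: reach_trans (top1 cm) _.
apply: (@reach_trans _ _ (pt (succ_wrap m c) (m - 3))).
  by apply: stepd; try lia; rewrite /even_tab2 /pt; table.
have -> : d = m - 3 - (m - 3 - d) by lia.
by apply: down; rewrite /succ_wrap; try case: ifP; lia.
Qed.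

Let lift c : 1 <= c <= m - 2 -> reach R (pt c 0) (pt c.+1 m.-1).
Proof. by move=> h; apply: stepd; try lia; rewrite /even_tab2 /pt; table. Qed.

Let next c : c < m -> 2 <= succ_wrap m c -> reach R (pt c m.-1) (pt (succ_wrap m c) 0).
Proof.
move=> cm h; apply: (@reach_trans _ _ (pt (succ_wrap m c) 1)); first by apply: col; lia.
by move: h; rewrite /succ_wrap; case: ifP => // e h; apply: stepd; try lia; rewrite /even_tab2 /pt; table.
Qed.

Let p0 : (0, 0) = pt 0 0. Proof. by []. Qed.

Let t0 : reach R (0, 0) (pt 0 m.-1).
Proof. by rewrite p0; apply: stepd; try lia; rewrite /even_tab2 /pt; table. Qed.

Let t1 : reach R (0, 0) (pt 1 m.-1).
Proof.
apply: reach_trans t0 _; apply: (@reach_trans _ _ (pt (succ_wrap m 0) 1)).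
  by apply: col; lia.
by have -> : succ_wrap m 0 = 1 by [rewrite /succ_wrap; case: ifP; lia]; apply: stepd; try lia; rewrite /even_tab2 /pt; table.
Qed.

Let zero c : c < m -> reach R (0, 0) (pt c 0).
Proof.
have evens k : k.*2.+2 < m -> reach R (0, 0) (pt k.*2.+2 0).
  elim: k => [|k IH] h.
    apply: reach_trans t1 _; have e : succ_wrap m 1 = 2 by rewrite /succ_wrap; case: ifP; lia.
    by have := @next 1; rewrite e; apply; lia.
  apply: reach_trans (IH _) _; first lia.
  apply: reach_trans (lift _) _; first lia.
  have e : succ_wrap m k.*2.+3 = k.+1.*2.+2 by rewrite /succ_wrap; case: ifP; lia.
  by have := @next k.*2.+3; rewrite e; apply; lia.
have odds k : k.*2.+1 < m -> reach R (0, 0) (pt k.*2.+1 0).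
  elim: k => [|k IH] h.
    apply: (@reach_trans _ _ (pt (m - 2) 0)).
      by have -> : m - 2 = (m./2 - 2).*2.+2 by [lia]; apply: evens; lia.
    apply: reach_trans (lift _) _; first lia.
    have -> : (m - 2).+1 = m.-1 by lia.
    have e : succ_wrap m m.-1 = 0 by rewrite /succ_wrap; case: ifP; lia.
    apply: (@reach_trans _ _ (pt 0 1)); first by rewrite -e; apply: col; lia.
    by apply: stepd; try lia; rewrite /even_tab2 /pt; table.
  apply: reach_trans (IH _) _; first lia.
  apply: reach_trans (lift _) _; first lia.
  have e : succ_wrap m k.*2.+2 = k.+1.*2.+1 by rewrite /succ_wrap; case: ifP; lia.
  by have := @next k.*2.+2; rewrite e; apply; lia.
move=> cm; case: c cm => [|c] cm; first by rewrite -p0; apply: reach0.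
case o: (odd c); last by have -> : c.+1 = c./2.*2.+1 by [lia]; apply: odds; lia.
by have -> : c.+1 = c./2.*2.+2 by [lia]; apply: evens; lia.
Qed.

Let top c : c < m -> reach R (0, 0) (pt c m.-1).
Proof.
case: c => [|[|c]] cm; [exact: t0|exact: t1|].
by apply: (@reach_trans _ _ (pt c.+1 0)); [apply: zero | apply: lift]; lia.
Qed.

Lemma even2 i j : i < m -> j < m -> reach R (0, 0) (i, j).
Proof.
move=> im jm; pose d := if i + j < m then i + j else i + j - m.
rewrite (ptE im jm : (i, j) = pt i d).
have dm : d < m by rewrite /d; case: ifP; lia.
have [d0|d0] := posnP d; first by rewrite d0; apply: zero.
have [->|d1] := eqVneq d m.-1; first exact: top.
have [->|d2] := eqVneq d (m - 2); first by apply: reach_trans (top im) _; apply: top1.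
pose c := if i == 0 then m.-1 else i.-1.
have cm : c < m by rewrite /c; case: ifP; lia.
have <- : succ_wrap m c = i by rewrite /succ_wrap /c; do 2?case: ifP; lia.
by apply: reach_trans (top cm) _; apply: col; lia.
Qed.

Lemma even2_back : R (m.-1, 1) = (0, 0).
Proof. by rewrite /R ret2E; try lia; rewrite /even_tab2; table. Qed.

End C2.

(** Colour 1 moves to the left in a row and now and then to the next row.  From row
    0 it makes two long excursions, from column [m - 1] and from column 1.
    Between the first and the last row these alternate: one of them visits only
    two points of a row, and the other one all the rest of it. *)
Section C1.
Let R := even_ret m 1.
Let step i j x : i < m -> j < m -> even_tab1 m i j = x -> reach R (i, j) x.
Proof. by move=> im jm <-; apply: reach1; apply: ret1E. Qed.
Ltac one_step := apply: step; try lia; rewrite /even_tab1; table.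

Let left i j s : i < m -> 1 <= j <= m - 2 -> s <= i ->
  (i < m - 2 - j) || (m - 2 - j <= i - s) -> (i < m - j) || (m - j <= i - s) ->
  reach R (i, j) (i - s, j).
Proof.
move=> im jm; elim: s => [|s IH] si h1 h2; first by rewrite subn0; apply: reach0.
by apply: (@reach_trans _ _ (i - s, j)); [apply: IH; lia | one_step].
Qed.

Let start j := if j == m - 2 then m.-1 else m - j - 3.

Let long j x : 2 <= j <= m - 2 -> x < m -> x != m - j - 1 -> x != m - j - 2 ->
  reach R (start j, j) (x, j).
Proof.
move=> h xm x1 x2.
have hi y : m - j <= y < m -> reach R (m.-1, j) (y, j).
  by move=> hy; have -> : y = m.-1 - (m.-1 - y) by [lia]; apply: left; lia.
rewrite /start; case: ifP => e; first by apply: hi; lia.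
have lo y : y <= m - j - 3 -> reach R (m - j - 3, j) (y, j).
  move=> hy; rewrite (_ : y = m - j - 3 - (m - j - 3 - y)); last by lia.
  by apply: left; lia.
have [le|gt] := leqP x (m - j - 3); first exact: lo.
apply: (@reach_trans _ _ (0, j)); first by apply: lo.
by apply: (@reach_trans _ _ (m.-1, j)); [one_step | apply: hi; lia].
Qed.

Let long_up j : 2 <= j <= m - 3 -> reach R (start j, j) (m - j.+1 - 1, j.+1).
Proof.
by move=> h; apply: (@reach_trans _ _ (m - j, j)); [apply: long; lia | one_step].
Qed.

Let short j : 2 <= j <= m - 2 -> reach R (m - j - 1, j) (m - j - 2, j).
Proof. by move=> h; one_step. Qed.

Let short_up j : 2 <= j <= m - 3 -> reach R (m - j - 1, j) (start j.+1, j.+1).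
Proof.
move=> h; apply: reach_trans (short _) _; first lia.
by rewrite /start; one_step.
Qed.

Let alt x k : k <= m - 4 -> reach R x (start 2, 2) ->
  reach R x (if odd k then m - (k + 2) - 1 else start (k + 2), k + 2).
Proof.
elim: k => [|k IH] h hx //; apply: reach_trans (IH _ hx) _; first lia.
rewrite addSn /=; case: (odd k) => /=; first by apply: short_up; lia.
by apply: long_up; lia.
Qed.

Let alt' x k : k <= m - 4 -> reach R x (m - 3, 2) ->
  reach R x (if odd k then start (k + 2) else m - (k + 2) - 1, k + 2).
Proof.
elim: k => [|k IH] h hx; first by rewrite add0n -subnDA.
apply: reach_trans (IH _ hx) _; first lia.
rewrite addSn /=; case: (odd k) => /=; first by apply: long_up; lia.
by apply: short_up; lia.
Qed.

Let down0 i s : i <= m - 2 -> s.*2 <= i -> reach R (i, 0) (i - s.*2, 0).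
Proof.
move=> im; elim: s => [|s IH] h; first by rewrite subn0; apply: reach0.
by apply: (@reach_trans _ _ (i - s.*2, 0)); [apply: IH; lia | one_step].
Qed.

Let downm i s : i < m -> s.*2 <= i -> reach R (i, m.-1) (i - s.*2, m.-1).
Proof.
move=> im; elim: s => [|s IH] h; first by rewrite subn0; apply: reach0.
by apply: (@reach_trans _ _ (i - s.*2, m.-1)); [apply: IH; lia | one_step].
Qed.

Let a1 i : i <= m - 4 -> reach R (0, 0) (i, 1).
Proof.
move=> h; apply: (@reach_trans _ _ (m.-1, 0)); first by one_step.
apply: (@reach_trans _ _ (m - 4, 1)); first by one_step.
rewrite (_ : i = m - 4 - (m - 4 - i)); last by lia.
by apply: left; lia.
Qed.
Let a2 : reach R (0, 0) (m - 2, 1).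
Proof. by apply: reach_trans (a1 (leq0n _)) _; one_step. Qed.
Let a3 : reach R (0, 0) (m - 3, 1).
Proof. by apply: reach_trans a2 _; one_step. Qed.
Let a4 : reach R (0, 0) (start 2, 2).
Proof. by apply: reach_trans a3 _; rewrite /start; one_step. Qed.
Let am i : odd i -> i < m -> reach R (0, 0) (i, m.-1).
Proof.
move=> oi im; apply: (@reach_trans _ _ (m.-1, m.-1)); last first.
  have -> : i = m.-1 - (m.-1 - i)./2.*2 by lia.
  by apply: downm; lia.
have := alt (leqnn (m - 4)) a4; have -> : odd (m - 4) = false by lia.
move=> h; apply: reach_trans h _.
have -> : m - 4 + 2 = m - 2 by lia.
apply: (@reach_trans _ _ (2, m - 2)); first by apply: long; lia.
by one_step.
Qed.
Let b0 i : odd i -> i < m -> reach R (0, 0) (i, 0).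
Proof.
move=> oi im; have [->|ne] := eqVneq i m.-1; first by one_step.
apply: (@reach_trans _ _ (1, m.-1)); first by apply: am; lia.
apply: (@reach_trans _ _ (m - 3, 0)); first by one_step.
rewrite (_ : i = m - 3 - (m - 3 - i)./2.*2); last by lia.
by apply: down0; lia.
Qed.
Let b1 : reach R (0, 0) (m.-1, 1).
Proof. by apply: (@reach_trans _ _ (1, 0)); [apply: b0; lia | one_step]. Qed.
Let b2 : reach R (0, 0) (m - 3, 2).
Proof. by apply: reach_trans b1 _; one_step. Qed.

Let bm i : ~~ odd i -> i < m -> reach R (0, 0) (i, m.-1).
Proof.
move=> oi im; apply: (@reach_trans _ _ (m - 2, m.-1)); last first.
  have -> : i = m - 2 - (m - 2 - i)./2.*2 by lia.
  by apply: downm; lia.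
have := alt' (leqnn (m - 4)) b2; have -> : odd (m - 4) = false by lia.
move=> h; apply: reach_trans h _.
have -> : m - 4 + 2 = m - 2 by lia.
by apply: reach_trans (short _) _; [lia | one_step].
Qed.
Let c0 i : ~~ odd i -> i < m -> reach R (0, 0) (i, 0).
Proof.
move=> oi im; apply: (@reach_trans _ _ (0, m.-1)); first by apply: bm; lia.
apply: (@reach_trans _ _ (m - 2, 0)); first by one_step.
rewrite (_ : i = m - 2 - (m - 2 - i)./2.*2); last by lia.
by apply: down0; lia.
Qed.

Lemma even1 i j : i < m -> j < m -> reach R (0, 0) (i, j).
Proof.
move=> im jm; have [->|j0] := eqVneq j 0.
  by case o: (odd i); [apply: b0 | apply: c0; rewrite ?o].
have [->|jmm] := eqVneq j m.-1.
  by case o: (odd i); [apply: am | apply: bm; rewrite ?o].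
have [->|j1] := eqVneq j 1.
  have [le|gt] := leqP i (m - 4); first exact: a1.
  have [->|n2] := eqVneq i (m - 2); first exact: a2.
  have [->|n3] := eqVneq i (m - 3); first exact: a3.
  by have -> : i = m.-1 by [lia]; apply: b1.
have [LS1 LS2] : reach R (0, 0) (start j, j) /\ reach R (0, 0) (m - j - 1, j).
  have h1 := @alt (0, 0) (j - 2) _ a4; have h2 := @alt' (0, 0) (j - 2) _ b2.
  have e : j - 2 + 2 = j by lia.
  by move: h1 h2; rewrite e; case: (odd _) => h1 h2; split; [apply: h2|apply: h1|apply: h1|apply: h2]; lia.
have [->|n1] := eqVneq i (m - j - 1); first exact: LS2.
have [->|n2] := eqVneq i (m - j - 2).
  by apply: reach_trans LS2 _; apply: short; lia.
by apply: reach_trans LS1 _; apply: long; lia.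
Qed.

Lemma even1_back : R (2, 0) = (0, 0).
Proof. by rewrite /R ret1E; try lia; rewrite /even_tab1; table. Qed.

End C1.
End Even.

Local Open Scope ring_scope.

(** * Layered maps *)

Lemma cyc_forward (T : finType) (f : T -> T) x0 y0 :
  f y0 = x0 -> (forall y, exists n, iter n f x0 = y) -> cyc f.
Proof.
move=> h ex x y; have [n hn] := ex y0; have [k hk] := ex x; have [l hl] := ex y.
have l0 : iter n.+1 f x0 = x0 by rewrite iterS hn.
have lk j : iter (j * n.+1) f x0 = x0.
  by elim: j => // j IH; rewrite mulSn iterD IH.
exists (l + k * n)%N; rewrite -hk -hl -iterD -addnA -[X in (l + (_ + X))%N]muln1.
by rewrite -mulnDr addn1 iterD lk.
Qed.

Section Layered.
Variables (m : nat) (T : finType) (f : 'Z_m -> T -> T).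
Hypothesis m1 : (1 < m)%N.
Definition layered (x : T * 'Z_m) := (f x.2 x.1, x.2 + 1).
Definition word_upto n (v : T) := foldl (fun y k => f k%:R y) v (iota 0 n).

Lemma word_uptoS n v : word_upto n.+1 v = f n%:R (word_upto n v).
Proof. by rewrite /word_upto -addn1 iotaD foldl_cat. Qed.

(** Every orbit returns to the first layer, where a round acts by the word.  As the
    word is injective so are its initial pieces, and each layer is reached from
    the first one. *)
Lemma layered_cyc : cyc (word_upto m) -> cyc layered.
Proof.
move=> hc.
have run n v : iter n layered (v, 0) = (word_upto n v, n%:R).
  by elim: n => //= n ->; rewrite /layered /= word_uptoS mulrSr.
have inj n : (n <= m)%N -> injective (word_upto n).
  move=> nm v v' e; apply: (cyc_inj hc).
  have : forall k, word_upto (n + k) v = word_upto (n + k) v'.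
    by elim=> [|k IH]; rewrite ?addn0 // addnS !word_uptoS IH.
  by move/(_ (m - n)%N); rewrite subnKC.
have seam k v : iter (k * m) layered (v, 0) = (iter k (word_upto m) v, 0).
  elim: k => // k IH; rewrite mulSn iterD IH run Zn_n // iterS; congr pair.
have toend v t n : exists w, iter n layered (v, t) = (w, t + n%:R).
  elim: n => [|n [w hw]]; first by exists v; rewrite addr0.
  by exists (f (t + n%:R) w); rewrite /= hw /layered /= mulrSr addrA.
move=> [v t] [v' t'].
have [w hw] := toend v t (- t : 'Z_m); rewrite natr_Zp subrr in hw.
have lt' : (t' <= m)%N by apply/ltnW/Zn_lt.
have [v0 hv0] : exists v0, word_upto t' v0 = v'.
  by have [h _ Kh] := injF_bij (inj _ lt'); exists (h v').
have [k hk] := hc w v0.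
exists (t' + (k * m + (- t : 'Z_m)%R))%N.
by rewrite !iterD hw seam hk run hv0 natr_Zp.
Qed.
End Layered.

(** * Slices of the three-dimensional torus *)

Definition perm_codes := [:: p012; p021; p102; p120; p201; p210].

Section Slice.
Variable m : nat.
Hypothesis m1 : (1 < m)%N.
Variable pat : nat -> nat -> nat -> seq nat.

Definition step3 (k : nat) (w : 'Z_m * 'Z_m * 'Z_m) :=
  let: (a, b, z) := w in
  if k == 0%N then (a + 1, b, z) else if k == 1%N then (a, b + 1, z) else (a, b, z + 1).
Definition layer3 (w : 'Z_m * 'Z_m * 'Z_m) := w.1.1 + w.1.2 + w.2.
Definition slice (k : nat) (w : 'Z_m * 'Z_m * 'Z_m) :=
  step3 (nth 0%N (pat (layer3 w) w.1.2 w.2) k) w.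

Definition vmv g (v : 'Z_m * 'Z_m) :=
  if g == 0%N then v else if g == 1%N then (v.1 + 1, v.2) else (v.1, v.2 + 1).
Definition vlay k (t : 'Z_m) (v : 'Z_m * 'Z_m) := vmv (nth 0%N (pat t v.1 v.2) k) v.

Lemma val_up (x : 'Z_m) : val (x + 1) = succ_wrap m (val x).
Proof.
have -> : val (x + 1) = ((val x).+1 %% m)%N.
  by rewrite -[in LHS](natr_Zp x) natr1; apply: val_ZnR.
have xm : (val x < m)%N by apply: Zn_lt.
rewrite /succ_wrap; case: eqP => [->|ne]; first by rewrite modnn.
by rewrite modn_small //; lia.
Qed.

(** The layer replaces the first coordinate. *)
Lemma slice_cyc k : cyc (word_upto (vlay k) m) -> cyc (slice k).
Proof.
move/(layered_cyc m1) => h.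
apply: (cyc_conj (h := fun w => ((w.1.2, w.2), layer3 w)) _ _ h).
  move=> [[a b] z] [[a' b'] z'] /pairE /= [/pairE /= [-> ->]].
  by rewrite /layer3 /= => /addIr /addIr ->.
move=> [[a b] z]; rewrite /slice /layered /vlay /layer3 /step3 /vmv /=.
by case: eqP => _ /=; [|case: eqP => _ /=]; congr (_, _); ring.
Qed.

Lemma word_reach k :
  (exists i j, [/\ i < m, j < m &
     foldl (fun y t => layer_step m (pat t) k y) (i, j) (iota 0 m) = (0, 0)])%N ->
  (forall i j, (i < m)%N -> (j < m)%N ->
     reach (fun x => foldl (fun y t => layer_step m (pat t) k y) x (iota 0 m)) (0, 0)%N (i, j)) ->
  cyc (slice k).
Proof.
move=> [i [j [im jm back]]] rch; apply: slice_cyc.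
set R := (fun x => foldl _ x _) in rch.
pose h (v : 'Z_m * 'Z_m) : nat * nat := (val v.1, val v.2).
have h_inj : injective h by move=> [a b] [a' b'] [/val_inj -> /val_inj ->].
have iS n : iota 0 n.+1 = iota 0 n ++ [:: n] by rewrite -addn1 iotaD.
have hR v : h (word_upto (vlay k) m v) = R (h v).
  rewrite /R /word_upto; have : forall n, (n <= m)%N ->
    h (foldl (fun y t => vlay k t%:R y) v (iota 0 n)) =
    foldl (fun y t => layer_step m (pat t) k y) (h v) (iota 0 n).
    elim=> // n IH nm; rewrite iS !foldl_cat /= -IH; last exact: ltnW.
    move: (foldl _ v _) => u; rewrite /vlay /layer_step /vmv /move val_ZnR // modn_small //=.
    by do 2?case: eqP => _ //; rewrite /h /= -val_up.
  exact.
apply: (@cyc_forward _ _ (0, 0) (i%:R, j%:R)) => [|v].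
  by apply: h_inj; rewrite hR {1}/h /= !val_ZnR // !modn_small.
have [n hn] := rch _ _ (Zn_lt m1 v.1) (Zn_lt m1 v.2); exists n.
by apply: h_inj; rewrite (iter_conj _ _ hR).
Qed.

End Slice.

Local Close Scope ring_scope.

(** * Patterns for every m *)

(** What the higher odd dimensions require: the default pattern in layer 1, and in
    layer 2 the default generator of colour 1 somewhere in each row and that of
    colour 2 somewhere.  Only [m = 3] needs this weak form for layer 2. *)
Definition good_slices (m : nat) (pat : nat -> nat -> nat -> seq nat) :=
  [/\ forall t i j, pat t i j \in perm_codes,
      forall k, k < 3 -> cyc (@slice m pat k),
      pat 1 = pRow m.-1,
      forall j, j < m -> exists2 i, i < m & nth 0 (pat 2 i j) 1 = nth 0 (pRow 0 i j) 1
    & exists i j, [/\ i < m, j < m & nth 0 (pat 2 i j) 2 = 2]].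

Lemma pRow_six r i j : pRow r i j \in perm_codes.
Proof. by rewrite /pRow; case: ifP. Qed.

Lemma good_row m pat : 1 < m -> (forall t i j, pat t i j \in perm_codes) ->
  (forall k, k < 3 -> cyc (@slice m pat k)) -> pat 1 = pRow m.-1 -> pat 2 = pRow 0 ->
  good_slices m pat.
Proof.
move=> m1 p6 pc p1 p2; split=> //; rewrite p2; first by exists 0 => //; lia.
by exists 0, 1; split=> //; lia.
Qed.

Section Tables.
Variables (m : nat) (pat : nat -> nat -> nat -> seq nat).
Definition wordn k x := foldl (fun y t => layer_step m (pat t) k y) x (iota 0 m).
Definition covers k :=
  let o := traject (wordn k) (0, 0) (m * m) in
  all (fun i => all (fun j => (i, j) \in o) (iota 0 m)) (iota 0 m) &&
  has (fun i => has (fun j => wordn k (i, j) == (0, 0)) (iota 0 m)) (iota 0 m).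

Lemma full_cyc k : 1 < m -> covers k -> cyc (@slice m pat k).
Proof.
move=> m1; have mi x : x < m -> x \in iota 0 m by rewrite mem_iota.
move=> /andP[/allP h1 /hasP[i +] /hasP[j]].
rewrite !mem_iota !add0n => im jm /eqP back; apply: word_reach => //.
  by exists i, j.
move=> i' j' im' jm'.
have /allP h2 := h1 i' (mi _ im').
have /trajectP[n _ hn] := h2 j' (mi _ jm').
by exists n; rewrite -hn.
Qed.
End Tables.

Definition tab (n : nat) (T : seq (seq nat)) (i j : nat) := nth p012 T (i * n + j).
Lemma tab_six n T i j : all (mem perm_codes) T -> tab n T i j \in perm_codes.
Proof.
move=> h; rewrite /tab; have [lt|ge] := ltnP (i * n + j) (size T).
  by apply: (allP h); apply: mem_nth.
by rewrite nth_default.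
Qed.

Definition pats (l : seq (nat -> nat -> seq nat)) t := nth (fun _ _ => p012) l t.

Lemma pats_six l t i j : all (fun p => p i j \in perm_codes) l -> pats l t i j \in perm_codes.
Proof.
move=> h; rewrite /pats; have [lt|ge] := ltnP t (size l).
  by move/all_nthP: h => /(_ (fun _ _ => p012) _ lt).
by rewrite nth_default.
Qed.

Definition slices3 := pats
  [:: tab 3 [:: p012; p102; p021; p120; p210; p201; p201; p120; p012]; pRow 2;
      tab 3 [:: p201; p120; p210; p012; p102; p021; p021; p210; p102]].

Lemma good3 : good_slices 3 slices3.
Proof.
split=> //.
- by move=> t i j; apply: pats_six; rewrite /= pRow_six !tab_six; vm_compute.
- by move=> [|[|[|k]]] // _; apply: (@full_cyc 3 slices3 _ isT); vm_compute.
- move=> [|[|[|j]]] // _; [by exists 0|by exists 2|by exists 0].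
by exists 1, 0; split.
Qed.

Definition slices4 := pats
  [:: tab 4 [:: p021; p120; p120; p012; p102; p102; p201; p210; p120; p210; p102;
             p021; p210; p120; p120; p021]; pRow 3; pRow 0; fun _ _ => p021].

Lemma good4 : good_slices 4 slices4.
Proof.
apply: good_row => //.
- by move=> t i j; apply: pats_six; rewrite /= !pRow_six tab_six; vm_compute.
by move=> [|[|[|k]]] // _; apply: (@full_cyc 4 slices4 _ isT); vm_compute.
Qed.

Section EvenSlices.
Variable m : nat.
Hypotheses (m6 : 6 <= m) (ev : ~~ odd m).

Definition slices_even := pats
  [:: pG m; pRow m.-1; pRow 0; pC; pR; pD m].

Let bounded (x : nat * nat) := (x.1 < m) && (x.2 < m).

Lemma up_lt i : i < m -> succ_wrap m i < m.
Proof. by rewrite /succ_wrap; case: eqP; lia. Qed.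

Lemma mv_bounded g x : bounded x -> bounded (move m g x).
Proof.
rewrite /bounded /move => /andP[h1 h2].
by do 2?case: eqP => _ /=; rewrite ?up_lt ?h1 ?h2.
Qed.

Lemma iter_up q i : i < m -> q <= m -> iter q (succ_wrap m) i = if i + q < m then i + q else i + q - m.
Proof.
move=> im; elim: q => [|q IH] qm; first by rewrite addn0 im.
by rewrite iterS IH ?(ltnW qm) // /succ_wrap; do 3?case: ifP; lia.
Qed.

Lemma even_word k x : k < 3 -> bounded x -> wordn m slices_even k x = even_ret m k x.
Proof.
move=> k3 bx; have ek : nth 0 p012 k = k by case: k k3 => [|[|[|]]].
rewrite /wordn -[in iota 0 m](subnKC m6) iotaD foldl_cat add0n.
rewrite [foldl _ x _]/= /even_ret.
set y := layer_step m (pD m) k _; rewrite -[foldl _ _ _]/(foldl (fun y t => layer_step m (slices_even t) k y) y (iota 6 (m - 6))).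
have by1 : bounded y by do 6!apply: mv_bounded.
have -> : foldl (fun y t => layer_step m (slices_even t) k y) y (iota 6 (m - 6)) =
   iter (m - 6) (move m k) y.
  have : forall q s, foldl (fun y t => layer_step m (slices_even t) k y) s (iota 6 q) = iter q (move m k) s.
    elim=> // q IH s; rewrite -[q.+1]addn1 iotaD foldl_cat IH addn1 /=.
    have -> : slices_even (6 + q) = fun _ _ => p012 by rewrite /slices_even /pats nth_default.
    by rewrite /layer_step ek.
  exact.
have /andP[y1 y2] := by1; clearbody y; case: k k3 ek => [|[|[|//]]] _ _; rewrite /coast_rest /=.
- by elim: (m - 6) => //= q ->.
- have -> : iter (m - 6) (move m 1) y = (iter (m - 6) (succ_wrap m) y.1, y.2).
    by elim: (m - 6) => [|q IH] /=; [case: (y) | rewrite IH].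
  by rewrite iter_up ?leq_subr // /coast; congr (_, _); do 2?case: ifP; lia.
have -> : iter (m - 6) (move m 2) y = (y.1, iter (m - 6) (succ_wrap m) y.2).
  by elim: (m - 6) => [|q IH] /=; [case: (y) | rewrite IH].
by rewrite iter_up ?leq_subr // /coast; congr (_, _); do 2?case: ifP; lia.
Qed.

Lemma good_even : good_slices m slices_even.
Proof.
apply: good_row => //; first by lia.
- move=> t i j; apply: pats_six; rewrite /= !pRow_six /= /pG /pC /pR /pD.
  by do 9?case: ifP.
move=> k k3; have m1 : 1 < m by lia.
have tr i j : i < m -> j < m -> reach (even_ret m k) (0, 0) (i, j) -> reach (wordn m slices_even k) (0, 0) (i, j).
  move=> im jm [n <-]; exists n.
  suff : iter n (wordn m slices_even k) (0, 0) = iter n (even_ret m k) (0, 0) /\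
    bounded (iter n (wordn m slices_even k) (0, 0)) by case.
  elim: n => [|n [IH b]] /=; first by rewrite /bounded /= !(ltnW m1).
  rewrite -IH even_word //; split=> //; rewrite -even_word // /wordn.
  by elim: (iota 0 m) (iter n _ _) b => //= t l IHl x bx; apply: IHl; apply: mv_bounded.
apply: word_reach => //; last first.
  move=> i j im jm; apply: tr => //.
  by case: k k3 => [|[|[|//]]] _; [apply: even0|apply: even1|apply: even2].
case: k k3 {tr} => [|[|[|//]]] _.
- exists (m - 2), 0; split; try lia.
  by rewrite -[LHS]/(wordn _ _ _ _) even_word ?even0_back // /bounded /=; lia.
- exists 2, 0; split; try lia.
  by rewrite -[LHS]/(wordn _ _ _ _) even_word ?even1_back // /bounded /=; lia.
exists m.-1, 1; split; try lia.
by rewrite -[LHS]/(wordn _ _ _ _) even_word ?even2_back // /bounded /=; lia.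
Qed.
End EvenSlices.

Section OddSlices.
Variable m : nat.
Hypotheses (m5 : 5 <= m) (od : odd m).
Let m1 : 1 < m. Proof. lia. Qed.
Local Open Scope ring_scope.

(** Up to scaling the second coordinate is a clock, and one turn moves the first
    one by the sum of [f]. *)
Lemma skew_cyc (c c' : 'Z_m) (f : 'Z_m -> 'Z_m) s : c * c' = 1 ->
  \sum_j f j = s%:R -> coprime s m -> cyc (fun v => (v.1 + f v.2, v.2 + c)).
Proof.
move=> cc fs co; pose F (t x : 'Z_m) := x + f (t * c).
have KK : cancel (fun j : 'Z_m => j * c') (fun j : 'Z_m => j * c).
  by move=> j; rewrite -mulrA [c' * _]mulrC cc mulr1.
have KK' : cancel (fun j : 'Z_m => j * c) (fun j : 'Z_m => j * c').
  by move=> j; rewrite -mulrA cc mulr1.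
apply: (cyc_conj (h := fun v => (v.1, v.2 * c')) (g := layered F)).
- by move=> [i j] [i' j'] /pairE /= [-> /(can_inj KK) ->].
- by move=> [i j]; rewrite /layered /F /= KK; congr pair; rewrite mulrDl cc.
apply: (layered_cyc m1).
have wE x : word_upto F m x = x + s%:R.
  have : forall n, word_upto F n x = x + \sum_(k < n) f (k%:R * c).
    elim=> [|n IH]; first by rewrite big_ord0 addr0.
    by rewrite word_uptoS IH big_ord_recr /= /F addrA.
  move=> ->; rewrite -fs; congr (_ + _).
  rewrite [RHS](reindex_inj (can_inj KK')) /=.
  rewrite -(big_mkord xpredT (fun k : nat => f (k%:R * c))).
  rewrite -[X in index_iota 0 X](Zp_cast m1) big_mkord.
  by apply: eq_bigr => k _; rewrite natr_Zp.
by move=> x y; have [n <-] := cyc_addZ_coprime m1 co x y; exists n; apply: eq_iter => z; rewrite wE.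
Qed.

(** Each colour moves the last coordinate by a constant, namely 1, 1 and -2, which
    are units for odd [m].  The rows of exchanges are chosen to make the total
    moves of the other coordinate units as well: 1, 1 and -2 modulo [m]. *)
Definition slices_odd := pats
  [:: fun _ j => if (j < 3)%N then p210 else p201; pRow m.-1; pRow 0;
      fun _ j => if j == 0%N then p021 else p120].

Lemma sum_count (P : pred nat) : (\sum_(j : 'Z_m) P j = count P (iota 0 m))%N.
Proof.
rewrite -sum1_count -[X in iota 0 X](Zp_cast m1) -[X in iota 0 X]subn0.
by rewrite -/(index_iota 0 _) big_mkord [RHS]big_mkcond.
Qed.

Lemma sum_pt r : (r < m)%N -> (\sum_(j : 'Z_m) ((j : nat) == r) = 1)%N.
Proof. by move=> rm; rewrite (sum_count (pred1 r)) count_uniq_mem ?iota_uniq // mem_iota rm. Qed.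

Lemma sum_not (P : pred nat) : (\sum_(j : 'Z_m) ~~ P j = m - \sum_(j : 'Z_m) P j)%N.
Proof. by rewrite (sum_count (predC P)) sum_count -{2}(size_iota 0 m) -(count_predC P) addKn. Qed.

Lemma sum_lt3 : (\sum_(j : 'Z_m) (j < 3) = 3)%N.
Proof.
rewrite (sum_count (fun j => j < 3))%N; have m3 : (3 <= m)%N by lia.
rewrite -[m](subnKC m3) iotaD count_cat /= (_ : count _ _ = 0)%N ?addn0 //.
apply/eqP; rewrite -leqn0 leqNgt -has_count; apply/hasPn => x.
by rewrite mem_iota; lia.
Qed.

Lemma sum_shift (P : 'Z_m -> nat) c : (\sum_j P (j + c)%R = \sum_j P j)%N.
Proof. by rewrite [RHS](reindex_inj (addIr c)). Qed.

Definition odd_lay k t (u : 'Z_m * 'Z_m) :=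
  vmv (nth 0%N (slices_odd t u.1 u.2) k) u.

Lemma odd_word k v : (k < 3)%N -> word_upto (vlay slices_odd k) m v =
  iter (m - 4) (vmv k) (odd_lay k 3 (odd_lay k 2 (odd_lay k 1 (odd_lay k 0 v)))).
Proof.
move=> k3; have m4 : (4 <= m)%N by lia.
have ek : nth 0%N p012 k = k by case: k k3 => [|[|[|]]].
have lE n : (n < m)%N -> word_upto (vlay slices_odd k) n.+1 v =
    odd_lay k n (word_upto (vlay slices_odd k) n v).
  by move=> nm; rewrite word_uptoS /vlay (val_ZnR m1) (modn_small nm).
have <- : word_upto (vlay slices_odd k) 4 v =
    odd_lay k 3 (odd_lay k 2 (odd_lay k 1 (odd_lay k 0 v))).
  by do 4!(rewrite lE; last by lia).
have : forall q, (4 + q <= m)%N ->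
    word_upto (vlay slices_odd k) (4 + q) v = iter q (vmv k) (word_upto (vlay slices_odd k) 4 v).
  elim=> [|q IH] qm; first by rewrite addn0.
  rewrite addnS lE -?addnS // IH; last by lia.
  by rewrite /odd_lay (_ : slices_odd _ = fun _ _ => p012) ?ek // /slices_odd /pats nth_default.
by move/(_ (m - 4)%N); rewrite subnKC // => ->.
Qed.

Lemma vmv_if (b : bool) (v : 'Z_m * 'Z_m) : vmv (if b then 1 else 0)%N v = (v.1 + b%:R, v.2).
Proof. by case: b; case: v => i j; rewrite /vmv /= ?addr0. Qed.

Lemma good_odd : good_slices m slices_odd.
Proof.
apply: good_row => //.
- by move=> t i j; apply: pats_six; rewrite /= !pRow_six; do 2?case: ifP.
move=> k k3; apply: slice_cyc => //.
have it1 q (v : 'Z_m * 'Z_m) : iter q (vmv 1) v = (v.1 + q%:R, v.2).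
  by elim: q => [|q IH]; rewrite ?addr0 -?surjective_pairing //= IH /vmv /= -addrA -mulrSr.
have it2 q (v : 'Z_m * 'Z_m) : iter q (vmv 2) v = (v.1, v.2 + q%:R).
  by elim: q => [|q IH]; rewrite ?addr0 -?surjective_pairing //= IH /vmv /= -addrA -mulrSr.
have it0 q (v : 'Z_m * 'Z_m) : iter q (vmv 0) v = v by elim: q => //= q ->.
have ext f g : (forall v, f v = g v) -> @cyc ('Z_m * 'Z_m) f -> cyc g.
  by move=> fg h x y; have [n <-] := h x y; exists n; apply: eq_iter => z; rewrite fg.
have L0 l (v : 'Z_m * 'Z_m) : odd_lay l 0%N v =
    vmv (nth 0%N (if (v.2 < 3)%N then p210 else p201) l) v by [].
have L1 l (v : 'Z_m * 'Z_m) : odd_lay l 1%N v =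
    vmv (nth 0%N (if (v.2 : nat) == m.-1 then p102 else p012) l) v by [].
have L2 l (v : 'Z_m * 'Z_m) : odd_lay l 2%N v =
    vmv (nth 0%N (if (v.2 : nat) == 0%N then p102 else p012) l) v by [].
have L3 l (v : 'Z_m * 'Z_m) : odd_lay l 3%N v =
    vmv (nth 0%N (if (v.2 : nat) == 0%N then p021 else p120) l) v by [].
have nif (b : bool) (s s' : seq nat) l : nth 0%N (if b then s else s') l = if b then nth 0%N s l else nth 0%N s' l by case: b.
have ifN (b : bool) : (if b then 0 else 1)%N = (if ~~ b then 1 else 0)%N by case: b.
have ifC (T : Type) (b : bool) (x : T) : (if b then x else x) = x by case: b.
have V2 (v : 'Z_m * 'Z_m) : vmv 2 v = (v.1, v.2 + 1) by [].
have V1 (v : 'Z_m * 'Z_m) : vmv 1 v = (v.1 + 1, v.2) by [].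
case: k k3 => [|[|[|//]]] _.
- pose f j := let j' := (j + 1 : 'Z_m) in (((j' : nat) == m.-1) + ((j' : nat) == 0%N) + ((j' : nat) != 0%N))%N.
  apply: (ext _ _ _ (@skew_cyc 1 1 (fun j => (f j)%:R) (m.+1) _ _ _)).
  + move=> v; rewrite odd_word // it0 L3 L2 L1 L0 !nif /= ifC V2 ifN !vmv_if /= /f.
    by rewrite !natrD !addrA.
  + by rewrite mulr1.
  + rewrite -natr_sum (sum_shift (fun j => ((j : nat) == m.-1) + ((j : nat) == 0) + ((j : nat) != 0))%N).
    rewrite !big_split /= (sum_not (fun j => j == 0%N)) !sum_pt //; try by lia.
    by congr (_%:R); lia.
  by rewrite /coprime gcdnC -[m.+1]addn1 gcdnDl gcdn1.
- pose f (j : 'Z_m) := ((j < 3) + ((j : nat) != m.-1) + ((j : nat) != 0%N) + (m - 4))%N.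
  apply: (ext _ _ _ (@skew_cyc 1 1 (fun j => (f j)%:R) (1 + (m - 2) * m) _ _ _)).
  + move=> v; rewrite odd_word // it1 L3 L2 L1 L0 !nif /= ifC V2 !ifN !vmv_if /= /f.
    by rewrite !natrD !addrA.
  + by rewrite mulr1.
  + rewrite -natr_sum /f !big_split /= sum_lt3 (sum_not (fun j => j == 0%N)) (sum_not (fun j => j == m.-1)) !sum_pt //; try by lia.
    rewrite sum_nat_const card_Zn //; congr (_%:R); nia.
  by rewrite /coprime gcdnC addnC gcdnMDl gcdn1.
pose f (j : 'Z_m) := (~~ (j < 3) + (((j + 1 + 1)%R : 'Z_m) == 0%N :> nat))%N.
have m22 : (m - 4).+2 = (m - 2)%N by lia.
have c2 : 1 + 1 + (m - 4)%:R = (m - 2)%:R :> 'Z_m by rewrite -m22 !mulrSr addrC addrA.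
apply: (ext _ _ _ (@skew_cyc (1 + 1 + (m - 4)%:R) (- ((m.+1)./2)%:R) (fun j => (f j)%:R) (m - 2) _ _ _)).
- move=> v; rewrite odd_word // it2 L3 L2 L1 L0 !nif /= !ifC !V2 ifN !vmv_if /= /f.
  by rewrite !natrD !addrA.
- have -> : 1 + 1 + (m - 4)%:R = - 2%:R :> 'Z_m.
    by rewrite c2 natrB ?(Zn_n m1) ?sub0r //; lia.
  rewrite mulrNN -natrM; have -> : (2 * (m.+1)./2 = m + 1)%N by lia.
  by rewrite natrD Zn_n // add0r.
- have s2 : (\sum_(j : 'Z_m) (((j + 1 + 1)%R : 'Z_m) == 0%N :> nat) = 1)%N.
    rewrite -(sum_pt (ltnW m1)) -(sum_shift (fun j => ((j : nat) == 0%N) : nat) (1 + 1)).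
    by apply: eq_bigr => j _; rewrite addrA.
  rewrite -natr_sum /f big_split s2 (sum_not (fun j => j < 3)%N) sum_lt3.
  by congr (_%:R); rewrite /=; lia.
have -> : coprime (m - 2) m = coprime (m - 2) (m - 2 + 2) by rewrite subnK //; lia.
by rewrite /coprime gcdnDl -/(coprime _ 2) coprimen2; lia.
Qed.
End OddSlices.

Lemma good_slices_exist m : 3 <= m -> exists pat, good_slices m pat.
Proof.
move=> m3; have [->|n3] := eqVneq m 3; first by exists slices3; apply: good3.
have [->|n4] := eqVneq m 4; first by exists slices4; apply: good4.
case o: (odd m); first by exists (slices_odd m); apply: good_odd => //; lia.
by exists (slices_even m); apply: good_even; lia.
Qed.

Local Open Scope ring_scope.

(** * Default arcs and slices *)

Section Three.
Variable m : nat.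
Hypothesis m3 : (3 <= m)%N.
Let m1 : (1 < m)%N. Proof. lia. Qed.
Notation Y := ('Z_m * 'Z_m)%type.
Notation W := ('Z_m * 'Z_m * 'Z_m)%type.

Definition code (c : option bool) : nat :=
  match c with Some b => b | None => 2 end.
Definition decode n := if n == 0%N then Some false else if n == 1%N then Some true else None.

Definition gen3 (c : option bool) (w : W) := step3 (code c) w.

(** Colours [Some false] and [Some true] advance in the first two coordinates, in
    exchanged roles on one antidiagonal; colour [None] advances in the third. *)
Definition eta (b : bool) (y : Y) : Y :=
  if (y.1 + y.2 == 2%:R) (+) b then (y.1, y.2 + 1) else (y.1 + 1, y.2).
Definition dflt (c : option bool) (w : W) : W :=
  match c with Some b => (eta b w.1, w.2) | None => (w.1, w.2 + 1) end.
Definition dperm (w : W) (c : option bool) :=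
  match c with Some b => Some ((w.1.1 + w.1.2 == 2%:R) (+) b) | None => None end.

Lemma dflt_gen c w : dflt c w = gen3 (dperm w c) w.
Proof.
by case: w => -[a b] z; case: c => [e|] //=; rewrite /eta /gen3 /=; case: (_ (+) e).
Qed.

Lemma dperm_inj w : injective (dperm w).
Proof. by move=> [b|] [b'|] //= [] /addbI ->. Qed.

Lemma eta_lay b y : (eta b y).1 + (eta b y).2 = y.1 + y.2 + 1.
Proof. by rewrite /eta; case: ifP => _ /=; ring. Qed.

(** The sum of the coordinates is a clock, and one turn moves the coordinate of the
    exchanged step once. *)
Lemma eta_cyc b : cyc (eta b).
Proof.
pose F (t x : 'Z_m) := if t == 2%:R then x + 1 else x.
pose h (y : Y) := ((if b then y.1 else y.2), y.1 + y.2).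
apply: (cyc_conj (h := h) (g := layered F)).
- move=> [x y] [x' y'] /pairE /= []; case: b {h} => -> h; congr pair.
    exact: (addrI x' h).
  exact: (addIr y' h).
- move=> y; rewrite /h /layered /F /= eta_lay /eta; case: eqP => e; case: b {h} => //=.
apply: layered_cyc => //.
have wE x : word_upto F m x = x + 1 :> 'Z_m.
  have : forall n, (n <= m)%N -> word_upto F n x = x + (2 < n)%N%:R :> 'Z_m.
    elim=> [|n IH] nm; first by rewrite addr0.
    rewrite word_uptoS {1}/F IH; last exact: ltnW.
    rewrite ZnR_eq // !modn_small //; case: (ltngtP n 2) => hn.
    + by rewrite ltnNge hn.
    + by have -> : (2 < n.+1)%N by lia.
    by rewrite hn /= addr0.
  by move/(_ _ (leqnn m)); rewrite m3.
move=> x y; have [n <-] := cyc_addZ x y; exists n.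
by apply: eq_iter => z; rewrite wE.
Qed.

Lemma card_Y : #|{: Y}| = (m ^ 2)%N.
Proof. by rewrite card_prod !card_Zn // mulnn. Qed.

(** [y1 z] and [y2 z] are points of the layers 1 and 2 where the first and the second
    colour of the slice have their default arc, so that they may be exchanged
    there.  The third colour is exchanged in layer 2 on the line [y0], and in
    layer 1 on all other lines. *)
Lemma slices_exist : exists (pi : W -> option bool -> option bool) (y0 : Y) (y1 y2 : 'Z_m -> Y),
  let L c w := gen3 (pi w c) w in
  [/\ forall w, injective (pi w), forall c, cyc (L c),
      forall z, layer3 (y1 z, z) = 1 /\ L (Some false) (y1 z, z) = dflt (Some false) (y1 z, z),
      forall z, layer3 (y2 z, z) = 2%:R /\ L (Some true) (y2 z, z) = dflt (Some true) (y2 z, z)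
    & forall w, (layer3 w = 1 /\ w.1 != y0) \/ (layer3 w = 2%:R /\ w.1 = y0) ->
       L None w = dflt None w].
Proof.
have [pat [p6 pc p1 p2 [i0 [j0 [i0m j0m p0]]]]] := good_slices_exist m3.
pose pi (w : W) c := decode (nth 0%N (pat (layer3 w) w.1.2 w.2) (code c)).
have LE c w : gen3 (pi w c) w = slice pat (code c) w.
  rewrite /gen3 /pi /slice; move: (nth _ _ _) => n.
  by case: w => -[a b] z; case: n => [|[|n]].
have p2' (j : 'Z_m) : exists i : 'Z_m, nth 0%N (pat 2%N i j) 1 = nth 0%N (pRow 0%N i j) 1.
  have [i im h] := p2 _ (Zn_lt m1 j); exists i%:R.
  by rewrite val_ZnR // modn_small.
have [q2 q2P] := fin_all_exists p2'.
have v1 : nat_of_ord (1 : 'Z_m) = 1%N by rewrite (val_ZnR m1 1) modn_small.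
have v2 : nat_of_ord (2%:R : 'Z_m) = 2%N by rewrite val_ZnR // modn_small.
have last0 (z : 'Z_m) : ((z : nat) == m.-1) = (z == -1).
  apply/eqP/eqP => [h|->]; first by rewrite -[z]natr_Zp h -subn1 natrB ?(ltnW m1) // Zn_n // sub0r.
  have -> : -1 = (m.-1)%:R :> 'Z_m by rewrite -subn1 natrB ?(ltnW m1) // Zn_n // sub0r.
  by rewrite val_ZnR // modn_small ?prednK // ltnW.
exists pi, (2%:R - i0%:R - j0%:R, i0%:R), (fun z => (1 - z, 0)), (fun z => (2%:R - q2 z - z, q2 z)).
split.
- move=> w c c'; rewrite /pi; move: (p6 (layer3 w) w.1.2 w.2).
  by case: c => [[]|]; case: c' => [[]|] //; rewrite !inE => /or4P[/eqP->|/eqP->|/eqP->|/or3P[]/eqP->].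
- move=> c x y; have [|n <-] := pc (code c) _ x y; first by case: c => [[]|].
  by exists n; apply: eq_iter => w; rewrite LE.
- move=> z; have l1 : layer3 ((1 - z, 0), z) = 1 :> 'Z_m by rewrite /layer3 /=; ring.
  split=> //; rewrite LE /slice l1 v1 p1 /pRow /= last0 /eta /= addbF addr0 subr_eq.
  have -> : (1 == 2%:R + z) = (z == -1).
    by apply/eqP/eqP => [h|->]; [apply: (addrI 2%:R); rewrite -h|]; ring.
  by case: (z == -1).
- move=> z; have l2 : layer3 ((2%:R - q2 z - z, q2 z), z) = 2%:R :> 'Z_m by rewrite /layer3 /=; ring.
  split=> //; rewrite LE /slice l2 v2 q2P /pRow /= /eta /= addbT.
  have -> : (2%:R - q2 z - z + q2 z == 2%:R) = ((z : nat) == 0%N).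
    have -> : 2%:R - q2 z - z + q2 z = 2%:R - z by ring.
    rewrite -[(z : nat) == 0%N]/(z == 0); apply/eqP/eqP => [h|->]; last by rewrite subr0.
    by have -> : z = 2%:R - (2%:R - z) by [ring]; rewrite h subrr.
  by case: ((z : nat) == 0%N).
move=> [[a b] z] h; rewrite LE /slice.
case: h => [[-> ne]|[l2 e]]; first by rewrite v1 p1 /pRow; case: ifP.
move: e l2 => [ea eb] l2; rewrite l2 v2 eb /=.
have -> : z = j0%:R.
  have : z = 2%:R - a - b by rewrite -l2 /layer3 /=; ring.
  by rewrite ea eb => ->; ring.
by rewrite !(val_ZnR m1) !modn_small // p0.
Qed.

End Three.

(** * Hosts and guests *)

Section HostEvent.
Variables (m Q M k : nat) (A B Y : finType).
Hypotheses (m1 : (1 < m)%N) (Q1 : (1 < Q)%N) (M1 : (1 < M)%N).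
Hypotheses (mQ : (m %| Q)%N) (QM : (Q %| M)%N) (Mm : (M %| m ^ k)%N) (mM : (m < M)%N).
Hypotheses (coQ : coprime m.-1 Q) (cardY : #|Y| = Q).
Variables (H : A -> A) (K : B -> B) (iH : A -> 'Z_M) (iK : B -> 'Z_M).
Hypotheses (iH_inj : injective iH) (iK_inj : injective iK).
Hypotheses (iHE : forall u, iH (H u) = iH u + 1) (iKE : forall v, iK (K v) = iK v + 1).
Variables (eta : Y -> Y) (idx : Y -> 'Z_Q).
Hypotheses (idx_inj : injective idx) (idx_eta : forall y, idx (eta y) = idx y + 1).
Variables (c : 'Z_m -> 'Z_Q) (S : {set Y}) (s1 s2 : 'Z_m).
Hypotheses (cP : forall z, red m (c z) + z = s1) (s12 : s1 != s2).
Hypotheses (s10 : s1 != 0) (s20 : s2 != 0) (coS : coprime #|S| m).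
Let W : finType := (Y * 'Z_m)%type.
Variables (g : W -> 'Z_M) (w0 : W) (dbl : bool) (E : pred nat).
Hypothesis gP : forall w, red m (g w) + red m (idx w.1) + w.2 = 0.
Variable C : A * B * W -> A * B * W.

Definition exits T w := (T == g w) || [&& dbl, w == w0 & T == g w0 + m%:R].

Hypothesis CE : forall u v w, let T := iH u + iK v in
  C (u, v, w) =
    if exits T w then (u, K v, w)
    else if E (iK v) && on_chain idx c (red Q T) w then (u, v, (eta w.1, w.2))
    else if E (iK v) && on_line idx S s2 (red m T) w then (u, v, (w.1, w.2 + 1))
    else (H u, v, w).
Hypothesis EP : if dbl then exists n, [/\ forall k, (k < M)%N -> E k = (k < n)%N,
      (n <= M)%N, ~~ odd (M - n) & coprime n (Q * m).+1]
  else coprime (count E (iota 0 M)) m.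

Lemma exits_layer T w : exits T w -> red m T + red m (idx w.1) + w.2 = 0.
Proof.
case/orP => [/eqP ->|/and3P[_ /eqP -> /eqP ->]]; first exact: gP.
by rewrite redD ?red_nat ?(Zn_n m1) ?addr0 // (dvdn_trans mQ QM).
Qed.

(** Exits lie in layer 0 and events in the layers [s1] and [s2], so that they do not
    interfere. *)
Lemma host_event : cyc C.
Proof.
have mM' : (m %| M)%N := dvdn_trans mQ QM.
have redr (T : 'Z_M) : red m (red Q T) = red m T.
  by apply: (red_nat m1 (T : nat) Q1 mQ).
pose stay (T : 'Z_M) (w : W) := on_chain idx c (red Q T) w || on_line idx S s2 (red m T) w.
pose nx (T : 'Z_M) (w : W) : W := if on_chain idx c (red Q T) w then (eta w.1, w.2) else (w.1, w.2 + 1).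
have stayJ T w : exits T w -> ~~ stay T w.
  move=> /exits_layer e; apply/orP => -[h|/andP[_ /eqP h]].
    have := chain_layer m1 Q1 mQ cP h; rewrite redr e => e'.
    by move: s10; rewrite -e' eqxx.
  by move: s20; rewrite -h e eqxx.
have FEc : cyc (@event m Q Y eta idx c S s2 M).
  by apply: (event_cyc m1 Q1 mQ coQ cardY idx_inj idx_eta cP s12 coS M1 QM Mm).
have FEE T w : event eta idx c S s2 (T, w) = if stay T w then (T, nx T w) else (T + 1, w).
  by rewrite /event /stay /nx /=; case: ifP => //= _; case: ifP.
have CE' u v w : let T := iH u + iK v in
  C (u, v, w) = if E (iK v) && stay T w then (u, v, nx T w)
    else if exits T w then (u, K v, w) else (H u, v, w).
  move=> T; rewrite CE -/T; case: ifP => [x|_].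
    by rewrite (negPf (stayJ _ _ x)) andbF.
  by rewrite /stay /nx; case: (E _) => //=; case: ifP => // _; case: ifP.
have [d|d] := boolP dbl; move: EP; rewrite ?d ?(negPf d).
  move=> [n [h1 h2 h3 h4]].
  have em : (0 < m < M)%N by rewrite mM ltnW.
  apply: (host_swap M1 iH_inj iK_inj iHE iKE FEc FEE stayJ CE' em _ h1 h2 h3) => [T w|].
    by rewrite /exits d.
  by rewrite card_prod cardY card_Zn.
move=> co.
apply: (host_id M1 iH_inj iK_inj iHE iKE FEc w0 FEE stayJ CE') => [T w|].
  by rewrite /exits (negPf d) /= orbF.
rewrite card_prod cardY card_Zn // coprimeMr co andbT.
by apply: (coprime_dvdr (dvdn_trans QM Mm)); apply: coprimeXr.
Qed.
End HostEvent.

Section WGrid.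
Variables (m Q : nat) (A B : finType) (Y : finType).
Hypotheses (m1 : (1 < m)%N) (Q1 : (1 < Q)%N) (mQ : (m %| Q)%N) (cardY : #|Y| = Q).
Let W : finType := (Y * 'Z_m)%type.
Let X : finType := (A * B * W)%type.
Variables (us u1 : A) (vs v1 : B) (L : W -> W).
Hypotheses (u1P : u1 != us) (L_cyc : cyc L).

(** A guest that moves by [eta] in the default fibres.  The chains of points where
    it is exchanged meet each of its classes once above every [(u, v)]. *)
Section Eta.
Variables (eta : Y -> Y) (idx : Y -> 'Z_Q) (md en : bool) (R1 R2 : A -> B -> 'Z_Q).
Variables (c c' : 'Z_m -> 'Z_Q).
Variables (H1 H2 : B -> A -> A) (K1 K2 : A -> B -> B).
Hypotheses (eta_cyc : cyc eta) (idx_inj : injective idx).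
Hypothesis idx_eta : forall y, idx (eta y) = idx y + 1.
Hypotheses (H1_cyc : forall v, cyc (H1 v)) (K1_cyc : forall u, cyc (K1 u)).
Hypotheses (H2_cyc : forall v, cyc (H2 v)) (K2_cyc : forall u, cyc (K2 u)).
Hypothesis R1E : forall u v, if md then R1 (H1 v u) v = R1 u v + 1 else R1 u (K1 u v) = R1 u v + 1.
Hypothesis R2E : en -> forall u v, if md then R2 u (K2 u v) = R2 u v + 1 else R2 (H2 v u) v = R2 u v + 1.
Definition eta_E1 u v (w : W) := R1 u v + idx w.1 == c w.2.
Definition eta_E2 u v (w : W) :=
  [&& en, (if md then u == u1 else v == v1) & R2 u v + idx w.1 == c' w.2].
Hypothesis E12 : forall u v w, eta_E2 u v w -> ~~ eta_E1 u v w.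
Hypothesis E1_slice : forall w, eta_E1 us vs w -> L w = (eta w.1, w.2).
Hypothesis v1P : v1 != vs \/ md.
Hypothesis enP : en \/ (md /\ forall v v' : B, v = v').
Variable C : X -> X.
Hypothesis CE : forall u v w, C (u, v, w) =
  if eta_E1 u v w then (if md then (H1 v u, v, w) else (u, K1 u v, w))
  else if eta_E2 u v w then (if md then (u, K2 u v, w) else (H2 v u, v, w))
  else if (u == us) && (v == vs) then (u, v, L w) else (u, v, (eta w.1, w.2)).

Lemma eta_grid_cyc : cyc C.
Proof.
pose g (w : W) := (eta w.1, w.2).
have g_inj : injective g.
  by move=> [y z] [y' z'] /pairE /= [/(cyc_inj eta_cyc) -> ->].
have fg (w : W) : idx (finv g w).1 + 1 = idx w.1 /\ (finv g w).2 = w.2.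
  by rewrite -{2 4}(f_finv g_inj w) /= idx_eta.
have idx_ex q : exists y, idx y = q.
  have b : bijective idx by apply: inj_card_bij => //; rewrite cardY card_Zn.
  by have [j _ jK] := b; exists (j q).
have ext f h : (forall x, f x = h x) -> @cyc X f -> cyc h.
  by move=> fh hc x y; have [n <-] := hc x y; exists n; apply: eq_iter => z; rewrite fh.
pose G := grid2 snd (fun=> md) g L us vs eta_E1 eta_E2 (fun=> H1) (fun=> H2) (fun=> K1) (fun=> K2).
apply: (ext G).
  move=> [[u v] w]; rewrite CE /G /grid2 /grid1 /exch /slide /=.
  case e2: (eta_E2 u v w); first by rewrite (negPf (E12 e2)); case: (md).
  by case: ifP => _; case: (md).
apply: (@grid_cyc A B W _ snd (fun=> md) g L us vs g_inj L_cyc _ _ eta_E1 eta_E2 u1 v1) => //=.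
- move=> [y z] [y' z'] /= <-; have /cycE h := eta_cyc.
  apply: (fconnect_iter_sub (f := eta) (h := fun y => (y, z))) (h y y') => y2.
  exact: (fconnect1 g (y2, z)).
- move=> [[u v] w]; rewrite /exch /eta_E1 /slide /=; have [e1 e2] := fg w.
  case: (md) R1E => h; rewrite /gback /= e2 h => /eqP <-;
    by rewrite -e1 addrAC addrA.
- move=> u v [y z] [y' z']; rewrite /eta_E1 /= => /eqP h + e.
  by rewrite -e -h => /eqP /addrI /idx_inj ->.
- move=> u v [y z]; have [y' hy] := idx_ex (c z - R1 u v).
  by exists (y', z); rewrite /eta_E1 //= hy addrC subrK.
- move=> [[u v] w]; rewrite /exch /eta_E2 /slide /=; have [e1 e2] := fg w.
  case: (md) R2E => h /and3P[en1 e4 /eqP e3] /=; rewrite /gback /= e2 (h en1) -e3 en1 e4 /=;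
    by rewrite -e1 addrAC addrA.
- move=> u v [y z] [y' z']; rewrite /eta_E2 /= => /and3P[_ _ /eqP h] /and3P[_ _ +] e.
  by rewrite -e -h => /eqP /addrI /idx_inj ->.
- by move=> u v w e; split; [apply: E12|move: e; rewrite /eta_E2; case: (md) => /and3P[_ /eqP ->]].
- by case: v1P; [left|right].
- move=> [y z] /= hm; case: enP => [he|[_ h]]; [right|by left] => v.
  have [y' hy] := idx_ex (c' z - R2 u1 v).
  by exists (y', z); rewrite /eta_E2 //= he hm eqxx /= hy addrC subrK.
move=> [y z] /= hm u; case: enP => [he|[h _]]; last by rewrite h in hm.
have [y' hy] := idx_ex (c' z - R2 u v1).
by exists (y', z); rewrite /eta_E2 //= he (negPf hm) eqxx /= hy addrC subrK.
Qed.
End Eta.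

(** A guest that moves the last coordinate.  It is exchanged above [(u, v)] in the
    one point of the line [y] that lies in the layer [s y], and for [t y] only on
    one line of the grid. *)
Section Zeta.
Variables (lay : A -> B -> Y -> 'Z_m) (en : bool) (mode : Y -> bool).
Variables (s t : Y -> 'Z_m).
Variables (H1 H2 : Y -> B -> A -> A) (K1 K2 : Y -> A -> B -> B).
Hypotheses (H1_cyc : forall y v, cyc (H1 y v)) (K1_cyc : forall y u, cyc (K1 y u)).
Hypotheses (H2_cyc : forall y v, cyc (H2 y v)) (K2_cyc : forall y u, cyc (K2 y u)).
Hypothesis layE1 : forall u v y, if mode y then lay (H1 y v u) v y = lay u v y + 1
  else lay u (K1 y u v) y = lay u v y + 1.
Hypothesis layE2 : en -> forall u v y, if mode y then lay u (K2 y u v) y = lay u v y + 1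
  else lay (H2 y v u) v y = lay u v y + 1.
Definition zeta_E1 u v (w : W) := lay u v w.1 + w.2 == s w.1.
Definition zeta_E2 u v (w : W) :=
  [&& en, (if mode w.1 then u == u1 else v == v1) & lay u v w.1 + w.2 == t w.1].
Hypothesis st : forall y, s y != t y.
Hypothesis E1_slice : forall w, zeta_E1 us vs w -> L w = (w.1, w.2 + 1).
Hypothesis v1P : v1 != vs \/ forall y, mode y.
Hypothesis enP : en \/ (forall y, mode y) /\ forall v v' : B, v = v'.
Variable C : X -> X.
Hypothesis CE : forall u v w, C (u, v, w) =
  if zeta_E1 u v w then (if mode w.1 then (H1 w.1 v u, v, w) else (u, K1 w.1 u v, w))
  else if zeta_E2 u v w then (if mode w.1 then (u, K2 w.1 u v, w) else (H2 w.1 v u, v, w))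
  else if (u == us) && (v == vs) then (u, v, L w) else (u, v, (w.1, w.2 + 1)).

Lemma zeta_grid_cyc : cyc C.
Proof.
pose g (w : W) := (w.1, w.2 + 1).
have g_inj : injective g by move=> [y z] [y' z'] /pairE /= [-> /addIr ->].
have fg (w : W) : (finv g w).1 = w.1 /\ (finv g w).2 + 1 = w.2.
  by rewrite -{2 4}(f_finv g_inj w).
have ext f h : (forall x, f x = h x) -> @cyc X f -> cyc h.
  by move=> fh hc x y; have [n <-] := hc x y; exists n; apply: eq_iter => z; rewrite fh.
have E12 u v w : zeta_E2 u v w -> ~~ zeta_E1 u v w.
  by case/and3P => _ _ /eqP e; rewrite /zeta_E1 e eq_sym.
pose G := grid2 fst mode g L us vs zeta_E1 zeta_E2 H1 H2 K1 K2.
apply: (ext G).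
  move=> [[u v] w]; rewrite CE /G /grid2 /grid1 /exch /slide /=.
  case e2: (zeta_E2 u v w); first by rewrite (negPf (E12 _ _ _ e2)); case: (mode _).
  by case: ifP => _ //; case: (mode _).
apply: (@grid_cyc A B W _ fst mode g L us vs g_inj L_cyc _ _ zeta_E1 zeta_E2 u1 v1) => //=.
- move=> [y z] [y' z'] /= <-; have /cycE h := cyc_addZ (n := m).
  apply: (fconnect_iter_sub (f := fun x : 'Z_m => x + 1) (h := fun z => (y, z))) (h z z') => z2.
  exact: (fconnect1 g (y, z2)).
- move=> [[u v] w]; rewrite /exch /zeta_E1 /slide /=; have [e1 e2] := fg w.
  by have := layE1 u v w.1; case: (mode _) => h; rewrite /gback /= e1 h => /eqP <-;
    rewrite -e2 addrAC addrA.
- move=> u v [y z] [y' z']; rewrite /zeta_E1 /= => /eqP h + e.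
  by rewrite -e -h => /eqP /addrI ->.
- move=> u v [y z]; exists (y, s y - lay u v y) => //.
  by rewrite /zeta_E1 /= addrC subrK.
- move=> [[u v] w]; rewrite /exch /zeta_E2 /slide /=; have [e1 e2] := fg w.
  case: (boolP en) => //= he; have := layE2 he u v w.1.
  case: (boolP (mode _)) => hm h; rewrite /gback /= e1 ?hm ?(negPf hm) h => /andP[-> /eqP <-];
    by rewrite /= -e2 addrAC addrA.
- move=> u v [y z] [y' z']; rewrite /zeta_E2 /= => /and3P[_ _ /eqP h] /and3P[_ _ +] e.
  by rewrite -e -h => /eqP /addrI ->.
- move=> u v w e; split; [exact: E12|move: e; rewrite /zeta_E2].
  by case: (mode _) => /and3P[_ /eqP ->].
- move=> [y z] /= hm; case: enP => [he|[_ h]]; [right|by left] => v.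
  exists (y, t y - lay u1 v y) => //.
  by rewrite /zeta_E2 /= he hm eqxx /= addrC subrK.
move=> [y z] /= hm u; case: enP => [he|[h _]]; last by rewrite h in hm.
exists (y, t y - lay u v1 y) => //.
by rewrite /zeta_E2 /= he (negPf hm) eqxx /= addrC subrK.
Qed.
End Zeta.
End WGrid.

Section Marks.
Variables (M : nat) (B : finType) (f : B -> 'Z_M).
Hypotheses (M1 : (1 < M)%N) (f_inj : injective f) (cB : #|B| = M).

(** The rows of a fibration indexed by [f] that lie in [P]. *)
Definition marks (P : pred B) (k : nat) : bool := (k%:R : 'Z_M) \in f @: [set v | P v].

Lemma marksE P v : marks P (f v) = P v.
Proof. by rewrite /marks natr_Zp mem_imset // inE. Qed.

Lemma count_marks P : count (marks P) (iota 0 M) = #|[set v | P v]|.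
Proof. by rewrite count_Zn // card_imset. Qed.

Lemma card_by_index (P : pred nat) : #|[set v | P (f v)]| = count P (iota 0 M).
Proof.
rewrite -(card_imset _ f_inj) -count_Zn //; apply: eq_in_count => k.
rewrite mem_iota /= => km; apply/imsetP/idP => [[v + e]|Pk].
  by rewrite inE -e val_ZnR // modn_small.
have [h _ hK] : bijective f by apply: inj_card_bij => //; rewrite cB card_Zn.
by exists (h k%:R); rewrite ?inE hK // val_ZnR // modn_small.
Qed.
End Marks.

Section Odd.
Variable m : nat.
Hypothesis m3 : (3 <= m)%N.
Let m1 : (1 < m)%N. Proof. lia. Qed.
Let Q := (m ^ 2)%N.
Let Q1 : (1 < Q)%N. Proof. rewrite /Q; nia. Qed.
Let mQ : (m %| Q)%N. Proof. exact: dvdn_exp. Qed.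
Let coQ : coprime m.-1 Q.
Proof. by apply: coprimeXr; rewrite coprime_sym coprimenP // ltnW. Qed.

Notation Y := ('Z_m * 'Z_m)%type.
Notation W := ('Z_m * 'Z_m * 'Z_m)%type.
Let lY (y : Y) := y.1 + y.2.

Variables (pi : W -> option bool -> option bool) (y0 : Y) (yy : bool -> 'Z_m -> Y).
Hypothesis pi_inj : forall w, injective (pi w).
Let L c w := gen3 (pi w c) w.
Hypothesis L_cyc : forall c, cyc (L c).
(** The layer of the chain exchange of colour [b]. *)
Definition s1 (b : bool) : 'Z_m := if b then 2%:R else 1.
Hypothesis yyP : forall b z, lY (yy b z) + z = s1 b /\
  L (Some b) (yy b z, z) = (eta b (yy b z), z).
Hypothesis lineP : forall w, lY w.1 + w.2 = s1 (w.1 == y0) -> L None w = (w.1, w.2 + 1).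
Variable idx : bool -> Y -> 'Z_Q.
Hypothesis idx_inj : forall b, injective (idx b).
Hypothesis idxE : forall b y, idx b (eta b y) = idx b y + 1.
Hypothesis idx_red : forall b y, red m (idx b y) = lY y.

Lemma s1_neq b : s1 b != s1 (~~ b).
Proof.
have h : 1 != 2%:R :> 'Z_m.
  by rewrite (ZnR_eq m1 1 2) !modn_small //; lia.
by case: b => //=; rewrite eq_sym.
Qed.

Lemma s1_neq0 b : s1 b != 0.
Proof. by case: b; rewrite /s1; [rewrite (ZnR_eq m1 2 0)|rewrite (ZnR_eq m1 1 0)]; rewrite !modn_small //; lia. Qed.

(** The lines of the third guest that are hosted on side [b].  Both sets have a
    number of elements prime to [m], namely 1 and [m ^ 2 - 1]. *)
Definition lineset (b : bool) : {set Y} := [set y | (y == y0) (+) b].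

Lemma lineset_co b : coprime #|lineset b| m.
Proof.
have c1 : lineset false = [set y0] by apply/setP => y; rewrite !inE addbF.
have c2 : lineset true = ~: [set y0] by apply/setP => y; rewrite !inE addbT.
case: b; last by rewrite c1 cards1 coprime1n.
rewrite c2 cardsCs setCK cards1 card_Y //.
by rewrite subn1 coprime_sym (coprime_dvdl mQ) // coprimenP // ltnW.
Qed.

(** * Dimension 5 *)

(** The two cyclic colours [eta false] and [eta true] of a further pair of
    coordinates act as hosts of the three colours of the slices: each is
    exchanged with the guest of the same name along a chain, and with the third
    guest on the lines of its set. *)
Section Five.
Let us : Y := (0, 0).
Let lus : lY us = 0. Proof. by rewrite /lY addr0. Qed.
(** The chain passes in the slice through the points [yy b z], where the guest has
    its default arc. *)
Let cc b z := idx b us + idx b (yy b z).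
Let P b (u : Y) (w : W) := idx b u + idx b w.1 == cc b w.2.
Let lay (u : Y) (w : W) := lY u + (lY w.1 + w.2).
Let ccP b z : red m (cc b z) + z = s1 b.
Proof. by rewrite redD // !idx_red lus add0r (yyP b z).1. Qed.
Let P_lay b u w : P b u w -> lay u w = s1 b.
Proof. by move/eqP => e; rewrite -(ccP b w.2) -e redD // !idx_red /lay addrA. Qed.
Let P_slice b w : P b us w -> L (Some b) w = (eta b w.1, w.2).
Proof.
case: w => y z; rewrite /P /cc /= => /eqP /addrI /idx_inj ->.
exact: (yyP b z).2.
Qed.

Let sw (x : Y * W) (c : bool + option bool) :=
  match c with
  | inl b => if P b x.1 x.2 then inr (Some b)
     else if ((x.2.1 == y0) (+) b) && (lay x.1 x.2 == s1 (~~ b)) then inr None else inl b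
  | inr (Some b) => if P b x.1 x.2 then inl b else c
  | inr None => let b := x.2.1 != y0 in if lay x.1 x.2 == s1 (~~ b) then inl b else c
  end.

Let swK x : involutive (sw x).
Proof.
case: x => u w; case=> [b|[b|]] /=.
- case: ifP => h /=; first by rewrite h.
  case: ifP => [/andP[e l]|e] /=; last by rewrite h e.
  have -> : (w.1 != y0) = b by move: e; case: (_ == y0); case: (b).
  by rewrite l.
- by case: ifP => h /=; rewrite h.
case: ifP => h /=; last by rewrite h.
have -> : P (w.1 != y0) u w = false.
  by apply/negP => /P_lay e; move: (s1_neq (w.1 != y0)); rewrite -e (eqP h) eqxx.
by rewrite h; case: (w.1 == y0).
Qed.

Let base (x : Y * W) (c : bool + option bool) :=
  match c with inl b => inl b
  | inr k => inr (if x.1 == us then pi x.2 k else dperm x.2 k) end.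

Lemma res_five : Res (tsum (@eta m) (@gen3 m)).
Proof.
exists (fun x => base x \o sw x) => [x|c].
  apply: inj_comp; last exact: can_inj (swK x).
  move=> [b|k] [b'|k'] //= [].
  by case: ifP => _; [move/pi_inj|move/dperm_inj] => ->.
have D x k : tsum (@eta m) (@gen3 m) (base x (inr k)) x =
   (x.1, if x.1 == us then L k x.2 else dflt k x.2).
  by rewrite /=; case: ifP; rewrite ?dflt_gen.
have Pd b u w : P b u w -> tsum (@eta m) (@gen3 m) (base (u, w) (inr (Some b))) (u, w) = (u, (eta b w.1, w.2)).
  by move=> h; rewrite D /=; case: eqP => // e; rewrite P_slice // -e.
have Zd u w : lay u w = s1 (w.1 == y0) ->
    tsum (@eta m) (@gen3 m) (base (u, w) (inr None)) (u, w) = (u, (w.1, w.2 + 1)).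
  by move=> h; rewrite D /=; case: eqP => // e; rewrite lineP // -h /lay e lus add0r.
case: c => [b|[b|]].
- apply: (cyc_conj (h := fun x => (idx b x.1, x.2)) (g := @event m Q _ (eta b) (idx b) (cc b) (lineset b) (s1 (~~ b)) Q)).
  + by move=> [u w] [u' w'] /pairE /= [/idx_inj -> ->].
  + move=> [u w]; rewrite /event /on_chain /on_line /=.
    have -> : red Q (idx b u) = idx b u by apply: natr_Zp.
    rewrite -/(P b u w) inE !idx_red -addrA -/(lay u w).
    case: ifP => hP; first by rewrite Pd.
    case: ifP => [/andP[e /eqP h]|_]; last by rewrite /= idxE.
    by rewrite Zd // h; congr s1; move: e; case: (_ == y0); case: (b).
  exact (event_base_cyc m1 Q1 mQ coQ (@idx_inj b) (idxE b) (ccP b) (s1_neq b) (lineset_co b)).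
- pose R1 (u : Y) (v : unit) := idx b u.
  pose C (x : Y * unit * W) := let: (u, v, w) := x in
    if P b u w then (eta b u, v, w) else
    if u == us then (u, v, L (Some b) w) else (u, v, (eta b w.1, w.2)).
  apply: (cyc_conj (h := fun x => (x.1, tt, x.2)) (g := C)).
  + by move=> [u w] [u' w'] /pairE /= [[->] ->].
  + move=> [u w]; rewrite /C /=; case: ifP => hP //.
    by rewrite D /=; case: ifP.
  apply: (@eta_grid_cyc m Q _ unit _ Q1 (card_Y m3) us (1, 0) tt tt (L (Some b)) _ (@L_cyc _)
    (eta b) (idx b) true false R1 R1 (cc b) (cc b) (fun=> eta b) (fun=> eta b) (fun=> id) (fun=> id)) => //.
  + exact: eta_cyc.
  + by move=> v; apply: eta_cyc.
  + by move=> _ [] []; exists 0%N.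
  + by move=> v; apply: eta_cyc.
  + by move=> _ [] []; exists 0%N.
  + by move=> u v; apply: idxE.
  + by move=> w; apply: P_slice.
  + by right.
  + by right; split=> // -[] [].
  by move=> u [] w; rewrite /C /eta_E1 /eta_E2 /R1 /= -/(P b u w) andbT.
pose C (x : Y * unit * W) := let: (u, v, w) := x in
    if lay u w == s1 (w.1 == y0) then (eta (w.1 != y0) u, v, w) else
    if u == us then (u, v, L None w) else (u, v, (w.1, w.2 + 1)).
apply: (cyc_conj (h := fun x => (x.1, tt, x.2)) (g := C)).
- by move=> [u w] [u' w'] /pairE /= [[->] ->].
- move=> [u w]; rewrite /C /= negbK; case: ifP => hP //.
  by rewrite D /=; case: ifP.
have lay_eta b u (y : Y) : lY (eta b u) + lY y = lY u + lY y + 1.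
  by rewrite /lY eta_lay addrAC.
apply: (@zeta_grid_cyc m _ unit _ us (1, 0) tt tt (L None) _ (@L_cyc _)
  (fun u _ y => lY u + lY y) false predT (fun y => s1 (y == y0)) (fun y => s1 (y != y0))
  (fun y _ => eta (y != y0)) (fun y _ => eta (y != y0)) (fun _ _ => id) (fun _ _ => id)) => //.
- by move=> y v; apply: eta_cyc.
- by move=> _ _ [] []; exists 0%N.
- by move=> y v; apply: eta_cyc.
- by move=> _ _ [] []; exists 0%N.
- by move=> u v y /=; apply: lay_eta.
- by move=> y; apply: s1_neq.
- by move=> w; rewrite /zeta_E1 lus add0r => /eqP; apply: lineP.
- by right.
- by right; split=> // -[] [].
by move=> u [] w; rewrite /C /zeta_E1 /zeta_E2 /= andbT -addrA.
Qed.
End Five.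

(** * Dimension 2 p + 3 *)

(** The hosts are the colours [H i] (side false) and [K i] (side true).  In the
    default layers the guest [Some b] is exchanged with the colour [host b] of
    side [b] along a chain, and on one line of the grid with the colour
    [last] of the other side; the third guest is treated alike on its lines.
    The host of a point depends only on the row of the host's own clock, and it
    is never [last], so the exchanges at a point do not collide. *)
Section Big.
Variables (p : nat) (A B : finType) (H : 'I_p -> A -> A) (K : 'I_p -> B -> B).
Variables (lA : A -> 'Z_m) (lB : B -> 'Z_m).
Let M := (m ^ p)%N.
Hypotheses (p2 : (2 <= p)%N) (cA : #|A| = M) (cB : #|B| = M).
Hypotheses (lAE : forall i u, lA (H i u) = lA u + 1) (lBE : forall i v, lB (K i v) = lB v + 1).
Hypotheses (H_cyc : forall i, cyc (H i)) (K_cyc : forall i, cyc (K i)).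
Variables (iH : 'I_p -> A -> 'Z_M) (iK : 'I_p -> B -> 'Z_M).
Hypotheses (iH_inj : forall i, injective (iH i)) (iK_inj : forall i, injective (iK i)).
Hypotheses (iHE : forall i u, iH i (H i u) = iH i u + 1) (iKE : forall i v, iK i (K i v) = iK i v + 1).
Hypotheses (iHr : forall i u, red m (iH i u) = lA u) (iKr : forall i v, red m (iK i v) = lB v).
(** For even [p] the hosts are in odd number, and colour [i0] of each side has a
    second exit to serve a number of rows divisible by [m]. *)
Let dbl := ~~ odd p.
Variables (hf : nat -> 'I_p) (i0 last : 'I_p).
Hypotheses (i0_last : i0 != last) (hf_last : forall n, hf n != last).
Hypothesis hf_co : forall i, i != last -> ~~ (dbl && (i == i0)) ->
  coprime (count (fun n => hf n == i) (iota 0 M)) m.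
Hypothesis hf_dbl : dbl -> exists n, [/\ forall k, (k < M)%N -> (hf k == i0) = (k < n)%N,
  (n <= M)%N, ~~ odd (M - n) & coprime n (Q * m).+1].
Variables (us u1 : A) (vs v1 : B).
Hypotheses (slice0 : lA us + lB vs = 0) (u1P : u1 != us) (v1P : v1 != vs).

Let QM : (Q %| M)%N. Proof. exact: dvdn_exp2l. Qed.
Let mM : (m %| M)%N. Proof. exact: dvdn_trans mQ QM. Qed.
Let mltM : (m < M)%N.
Proof. by apply: (leq_trans (n := Q)); [rewrite /Q; nia | rewrite leq_exp2l]. Qed.
Let M1 : (1 < M)%N. Proof. exact: ltn_trans mltM. Qed.

Notation X := (A * B * W)%type.
Notation Col := ('I_p + 'I_p + option bool)%type.
Let F := tsum (tsum H K) (@gen3 m).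
Let T i u v := iH i u + iK i v.
Let R i u v : 'Z_Q := red Q (T i u v).
Let lay u v (w : W) := lA u + lB v + (lY w.1 + w.2).
Let host (s : bool) u v := hf (if s then iH i0 u : nat else iK i0 v).
Let edge (s : bool) u v := if s then u == u1 else v == v1.
Let cc b z := R (host b us vs) us vs + idx b (yy b z).
Let cc' b z : 'Z_Q := (((s1 (~~ b) - z)%R : 'Z_m) : nat)%:R.
Let P b u v (w : W) := R (host b u v) u v + idx b w.1 == cc b w.2.
Let P' b u v (w : W) := edge (~~ b) u v && (R last u v + idx b w.1 == cc' b w.2).
Let g (w : W) : 'Z_M := (((- (lY w.1 + w.2))%R : 'Z_m) : nat)%:R.
Let w0 : W := (0, 0, 0).
Let ex i u v w := @exits m M Y g w0 (dbl && (i == i0)) (T i u v) w.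
Let line (s : bool) (w : W) := (w.1 == y0) (+) s.
Let side (s : bool) (i : 'I_p) : Col := inl (if s then inr i else inl i).

Let Rr i u v : red m (R i u v) = lA u + lB v.
Proof.
have -> : red m (R i u v) = red m (T i u v) by apply: (red_nat m1 _ Q1 mQ).
by rewrite redD // iHr iKr.
Qed.
Let ccP b z : red m (cc b z) + z = s1 b.
Proof. by rewrite redD // Rr slice0 idx_red add0r (yyP b z).1. Qed.
Let ccP' b z : red m (cc' b z) + z = s1 (~~ b).
Proof. by rewrite red_nat // natr_Zp subrK. Qed.
Let gP w : red m (g w) + red m (idx true w.1) + w.2 = 0.
Proof. by rewrite red_nat // natr_Zp idx_red -addrA addNr. Qed.

Let P_lay b u v w : P b u v w -> lay u v w = s1 b.
Proof. by move/eqP => e; rewrite -(ccP b w.2) -e redD // idx_red Rr /lay addrA. Qed.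
Let P'_lay b u v w : P' b u v w -> lay u v w = s1 (~~ b).
Proof. by case/andP => _ /eqP e; rewrite -(ccP' b w.2) -e redD // idx_red Rr /lay addrA. Qed.
Let ex_lay i u v w : ex i u v w -> lay u v w = 0.
Proof.
move=> /(exits_layer m1 M1 mQ QM gP) <-.
by rewrite idx_red redD // iHr iKr /lay addrA.
Qed.
Let P_slice b w : P b us vs w -> L (Some b) w = (eta b w.1, w.2).
Proof.
case: w => y z; rewrite /P /cc /= => /eqP /addrI /idx_inj ->.
exact: (yyP b z).2.
Qed.

Let sw (x : X) (c : Col) : Col :=
  let: (u, v, w) := x in
  match c with
  | inl si =>
    let: (s, i) := match si with inl i => (false, i) | inr i => (true, i) end in
    if ex i u v w then side (~~ s) i
    else if (i == host s u v) && P s u v w then inr (Some s)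
    else if (i == last) && P' (~~ s) u v w then inr (Some (~~ s))
    else if [&& i == host s u v, line s w & lay u v w == s1 (~~ s)] then inr None
    else if [&& i == last, edge s u v, ~~ line s w & lay u v w == s1 (~~ s)] then inr None
    else c
  | inr (Some b) =>
    if P b u v w then side b (host b u v)
    else if P' b u v w then side (~~ b) last else c
  | inr None =>
    let s := w.1 != y0 in
    if lay u v w == s1 (~~ s) then side s (host s u v)
    else if (lay u v w == s1 s) && edge (~~ s) u v then side (~~ s) last else c
  end.

Let sw_side u v w s i : sw (u, v, w) (side s i) =
    if ex i u v w then side (~~ s) i
    else if (i == host s u v) && P s u v w then inr (Some s)
    else if (i == last) && P' (~~ s) u v w then inr (Some (~~ s))
    else if [&& i == host s u v, line s w & lay u v w == s1 (~~ s)] then inr None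
    else if [&& i == last, edge s u v, ~~ line s w & lay u v w == s1 (~~ s)] then inr None
    else side s i.
Proof. by case: s. Qed.

Let lineE s w : line s w = (s == (w.1 != y0)).
Proof. by rewrite /line; case: s; case: (_ == y0). Qed.

Let swK x : involutive (sw x).
Proof.
case: x => -[u v] w.
have nl b : P b u v w -> ~~ P' b u v w.
  move=> /P_lay e; apply/negP => /P'_lay e'.
  by move: (s1_neq b); rewrite -e -e' eqxx.
have hl s : (host s u v == last) = false by apply/negbTE/hf_last.
have lh s : (last == host s u v) = false by rewrite eq_sym hl.
have sides s i : sw (u, v, w) (sw (u, v, w) (side s i)) = side s i.
  rewrite [in X in sw _ X]sw_side.
  case: ifP => [e|ne].
    by rewrite sw_side e negbK.
  case: ifP => [/andP[/eqP e h]|n1]; first by rewrite /= h e.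
  case: ifP => [/andP[/eqP e h]|n2].
    by rewrite /= (negbTE (contraL (nl (~~ s)) h)) h negbK e.
  case: ifP => [/and3P[/eqP e]|n3].
    by rewrite lineE => /eqP es h; rewrite /= -es h e.
  case: ifP => [/and4P[/eqP e h]|n4].
    rewrite lineE => hs h2; have es : (w.1 != y0) = ~~ s by move: hs; case: (s); case: (_ != y0).
    by rewrite /= es negbK (eqP h2) eqxx eq_sym (negPf (s1_neq s)) h e.
  by rewrite sw_side ne n1 n2 n3 n4.
case=> [[i|i]|[b|]].
- exact: (sides false).
- exact: (sides true).
- rewrite [in X in sw _ X]/=; case: ifP => h.
    rewrite sw_side eqxx h /=; case: ifP => // /ex_lay e.
    by move: (s1_neq0 b); rewrite -(P_lay h) e eqxx.
  case: ifP => h'; last by rewrite /= h h'.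
  rewrite sw_side negbK eqxx h' lh /=; case: ifP => // /ex_lay e.
  by move: (s1_neq0 (~~ b)); rewrite -(P'_lay h') e eqxx.
rewrite [in X in sw _ X]/=; set s := w.1 != y0; case: ifP => [/eqP h|n].
  rewrite sw_side lineE -/s h !eqxx hl /=.
  case: ifP => [/ex_lay e|_]; first by move: (s1_neq0 (~~ s)); rewrite -h e eqxx.
  by case: ifP => // /P_lay e; move: (s1_neq s); rewrite -h -e eqxx.
case: ifP => [/andP[/eqP h he]|n']; last by rewrite /= -/s n n'.
rewrite sw_side lineE -/s h negbK !eqxx lh he /=.
case: ifP => [/ex_lay e|_]; first by move: (s1_neq0 s); rewrite -h e eqxx.
case: ifP => [/P'_lay e|_]; first by move: (s1_neq s); rewrite -h -e eqxx.
by case: (s).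
Qed.


Let base (x : X) (c : Col) : Col :=
  match c with inl i => inl i
  | inr k => inr (if (x.1.1 == us) && (x.1.2 == vs) then pi x.2 k else dperm x.2 k) end.
Let Phi c x := F (base x (sw x c)) x.

Let Fside s i u v w : F (base (u, v, w) (side s i)) (u, v, w) =
  if s then (u, K i v, w) else (H i u, v, w).
Proof. by case: s. Qed.

Let Dk x k : F (base x (inr k)) x =
  (x.1, if (x.1.1 == us) && (x.1.2 == vs) then L k x.2 else dflt k x.2).
Proof. by rewrite /F /=; case: ifP; rewrite ?dflt_gen. Qed.

Let edge_off s u v : edge s u v -> (u == us) && (v == vs) = false.
Proof. by case: s => /eqP -> /=; rewrite ?(negPf u1P) ?(negPf v1P) ?andbF. Qed.

Let FP b u v w : P b u v w ->
  F (base (u, v, w) (inr (Some b))) (u, v, w) = (u, v, (eta b w.1, w.2)).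
Proof. by rewrite Dk /=; case: andP => // -[/eqP -> /eqP ->] /P_slice ->. Qed.

Let FP' b u v w : P' b u v w ->
  F (base (u, v, w) (inr (Some b))) (u, v, w) = (u, v, (eta b w.1, w.2)).
Proof. by rewrite Dk /= => /andP[/edge_off ->]. Qed.

Let FZ u v w : lay u v w = s1 (w.1 == y0) \/ (exists s, edge s u v) ->
  F (base (u, v, w) (inr None)) (u, v, w) = (u, v, (w.1, w.2 + 1)).
Proof.
rewrite Dk /= => -[h|[s /edge_off -> //]].
case: andP => // -[/eqP eu /eqP ev]; rewrite lineP //.
by rewrite -h /lay eu ev slice0 add0r.
Qed.

(** The two ways in which a colour of side [s] uses the last three dimensions. *)
Let Phi_side s i u v w : Phi (side s i) (u, v, w) =
  if ex i u v w then (if s then (H i u, v, w) else (u, K i v, w))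
  else if i == last then
    if edge s u v && (R last u v + idx (~~ s) w.1 == cc' (~~ s) w.2)
    then (u, v, (eta (~~ s) w.1, w.2))
    else if [&& edge s u v, w.1 \in lineset (~~ s) & lay u v w == s1 (~~ s)]
    then (u, v, (w.1, w.2 + 1))
    else (if s then (u, K i v, w) else (H i u, v, w))
  else
    if (host s u v == i) && (R i u v + idx s w.1 == cc s w.2)
    then (u, v, (eta s w.1, w.2))
    else if [&& host s u v == i, w.1 \in lineset s & lay u v w == s1 (~~ s)]
    then (u, v, (w.1, w.2 + 1))
    else (if s then (u, K i v, w) else (H i u, v, w)).
Proof.
rewrite /Phi sw_side; case: ifP => [_|ne]; first by rewrite Fside; case: (s).
have hl : (last == host s u v) = false by rewrite eq_sym; apply/negbTE/hf_last.
rewrite !inE; have [->|nl] := eqVneq i last.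
  rewrite hl /= {1}/P' negbK; case: ifP => [h|_]; first by rewrite FP' // /P' negbK.
  have -> : (w.1 == y0) (+) ~~ s = ~~ line s w by rewrite /line; case: (s); case: (_ == y0).
  case: ifP => [/and3P[h _ _]|_]; last by rewrite Fside.
  by rewrite FZ //; right; exists s.
rewrite /= -[(w.1 == y0) (+) s]/(line s w) [i == _]eq_sym; case: eqP => e; rewrite ?andTb ?andFb; last by rewrite Fside.
rewrite {1}/P e; case: ifP => [h|_]; first by rewrite FP // /P e.
case: ifP => [/andP[]|_]; last by rewrite Fside.
rewrite lineE => /eqP es /eqP h; rewrite FZ //; left.
by rewrite h es negbK.
Qed.


Let marks_co (S : finType) (f : 'I_p -> S -> 'Z_M) i : (forall i, injective (f i)) -> #|S| = M ->
  i != last -> ~~ (dbl && (i == i0)) ->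
  coprime (count (marks (f i) (fun v => hf (f i0 v) == i)) (iota 0 M)) m.
Proof.
move=> fi cS nl nd; rewrite count_marks //.
rewrite (card_by_index M1 (fi i0) cS (fun n => hf n == i)); exact: hf_co.
Qed.

Let rows (S : finType) (f : 'I_p -> S -> 'Z_M) i : pred nat :=
  if dbl && (i == i0) then fun k => hf k == i0
  else marks (f i) (fun v => hf (f i0 v) == i).

Let rowsE (S : finType) (f : 'I_p -> S -> 'Z_M) i v : (forall i, injective (f i)) ->
  rows f i (f i v) = (hf (f i0 v) == i).
Proof. by move=> fi; rewrite /rows; case: ifP => [/andP[_ /eqP ->]|_] //; rewrite marksE. Qed.

Let rowsP (S : finType) (f : 'I_p -> S -> 'Z_M) i : (forall i, injective (f i)) -> #|S| = M ->
  i != last ->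
  if dbl && (i == i0) then exists n, [/\ forall k, (k < M)%N -> rows f i k = (k < n)%N,
      (n <= M)%N, ~~ odd (M - n) & coprime n (Q * m).+1]
  else coprime (count (rows f i) (iota 0 M)) m.
Proof.
move=> fi cS nl; rewrite /rows; case nd: (dbl && (i == i0)); first by case/andP: nd => d _; exact: (hf_dbl d).
by apply: marks_co => //; rewrite nd.
Qed.

Let nolast : dbl && (last == i0) = false.
Proof. by rewrite eq_sym (negPf i0_last) andbF. Qed.

Let on_lineE s i u v w S s2 : on_line (idx s) S s2 (red m (T i u v)) w =
  (w.1 \in S) && (lay u v w == s2).
Proof. by rewrite /on_line redD // iHr iKr idx_red /lay -!addrA. Qed.

Let Phi_false i : cyc (Phi (side false i)).
Proof.
have [e|nl] := eqVneq i last.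
  apply: (@host_event m Q M p A B _ m1 Q1 M1 mQ QM (dvdnn M) mltM coQ (card_Y m3) (H i) (K i)
    (iH i) (iK i) (@iH_inj i) (@iK_inj i) (iHE i) (iKE i) (eta true) (idx true) (@idx_inj true)
    (idxE true) (cc' true) (lineset true) (s1 false) (s1 true) (ccP' true) (s1_neq false)
    (s1_neq0 _) (s1_neq0 _) (lineset_co _) g w0 (dbl && (i == i0)) (marks (iK i) (pred1 v1)) gP).
    move=> u v w; cbv zeta; rewrite -/(T i u v) Phi_side marksE // on_lineE /on_chain.
    rewrite -/(ex i u v w) e eqxx /edge /= -/(R last u v).
    by case: ifP => // _; case: ifP => // _; rewrite -andbA.
  rewrite e nolast count_marks // (_ : [set v | _] = [set v1]) ?cards1 ?coprime1n //.
  by apply/setP => v; rewrite !inE.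
apply: (@host_event m Q M p A B _ m1 Q1 M1 mQ QM (dvdnn M) mltM coQ (card_Y m3) (H i) (K i)
    (iH i) (iK i) (@iH_inj i) (@iK_inj i) (iHE i) (iKE i) (eta false) (idx false) (@idx_inj false)
    (idxE false) (cc false) (lineset false) (s1 false) (s1 true) (ccP false) (s1_neq false)
    (s1_neq0 _) (s1_neq0 _) (lineset_co _) g w0 (dbl && (i == i0)) (rows iK i)).
- by move=> w; rewrite idx_red -(gP w) idx_red.
- move=> u v w; cbv zeta; rewrite -/(T i u v) Phi_side rowsE // on_lineE /on_chain.
  by rewrite -/(ex i u v w) (negPf nl) -?andbA.
exact: rowsP.
Qed.

Let Phi_true i : cyc (Phi (side true i)).
Proof.
have TC u v : iK i v + iH i u = T i u v by rewrite addrC.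
(* at an exit this colour moves in the first factor, so the factors are swapped *)
pose C (x : B * A * W) : B * A * W :=
  let: (u, v, w) := Phi (side true i) (x.1.2, x.1.1, x.2) in (v, u, w).
apply: (cyc_conj (h := fun x : X => (x.1.2, x.1.1, x.2)) (g := C)).
- by move=> [[u v] w] [[u' v'] w'] /= [-> -> ->].
- by move=> [[u v] w]; rewrite /C /=; case: (Phi _ _) => -[].
have CE v u w : C (v, u, w) = if ex i u v w then (v, H i u, w)
  else if i == last then
    if edge true u v && (R last u v + idx false w.1 == cc' false w.2)
    then (v, u, (eta false w.1, w.2))
    else if [&& edge true u v, w.1 \in lineset false & lay u v w == s1 false]
    then (v, u, (w.1, w.2 + 1)) else (K i v, u, w)
  else
    if (host true u v == i) && (R i u v + idx true w.1 == cc true w.2)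
    then (v, u, (eta true w.1, w.2))
    else if [&& host true u v == i, w.1 \in lineset true & lay u v w == s1 false]
    then (v, u, (w.1, w.2 + 1)) else (K i v, u, w).
  by rewrite /C /= Phi_side; do 5?[case: ifP => //=].
have [e|nl] := eqVneq i last.
  apply: (@host_event m Q M p B A _ m1 Q1 M1 mQ QM (dvdnn M) mltM coQ (card_Y m3) (K i) (H i)
    (iK i) (iH i) (@iK_inj i) (@iH_inj i) (iKE i) (iHE i) (eta false) (idx false) (@idx_inj false)
    (idxE false) (cc' false) (lineset false) (s1 true) (s1 false) (ccP' false) (s1_neq true)
    (s1_neq0 _) (s1_neq0 _) (lineset_co _) g w0 (dbl && (i == i0)) (marks (iH i) (pred1 u1))).
  + by move=> w; rewrite idx_red -(gP w) idx_red.
  + move=> v u w; cbv zeta; rewrite TC CE marksE // on_lineE /on_chain.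
    rewrite -/(ex i u v w) e eqxx /edge /= -/(R last u v).
    by case: ifP => // _; case: ifP => // _; rewrite -andbA.
  rewrite e nolast count_marks // (_ : [set v | _] = [set u1]) ?cards1 ?coprime1n //.
  by apply/setP => v; rewrite !inE.
apply: (@host_event m Q M p B A _ m1 Q1 M1 mQ QM (dvdnn M) mltM coQ (card_Y m3) (K i) (H i)
    (iK i) (iH i) (@iK_inj i) (@iH_inj i) (iKE i) (iHE i) (eta true) (idx true) (@idx_inj true)
    (idxE true) (cc true) (lineset true) (s1 true) (s1 false) (ccP true) (s1_neq true)
    (s1_neq0 _) (s1_neq0 _) (lineset_co _) g w0 (dbl && (i == i0)) (rows iH i) gP).
  move=> v u w; cbv zeta; rewrite TC CE rowsE // on_lineE /on_chain.
  by rewrite -/(ex i u v w) (negPf nl) -?andbA.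
exact: rowsP.
Qed.


Let R1 b u v := R (host b u v) u v.
Let RH i u v : R i (H i u) v = R i u v + 1.
Proof. by rewrite /R /T iHE addrAC [LHS]redD // red1. Qed.
Let RK i u v : R i u (K i v) = R i u v + 1.
Proof. by rewrite /R /T iKE addrA [LHS]redD // red1. Qed.

Let Phi_eta b : cyc (Phi (inr (Some b))).
Proof.
apply: (@eta_grid_cyc m Q A B _ Q1 (card_Y m3) us u1 vs v1 (L (Some b)) u1P (@L_cyc _)
  (eta b) (idx b) (~~ b) true (R1 b) (R last) (cc b) (cc' b)
  (fun v => H (hf (iK i0 v))) (fun _ => H last) (fun u => K (hf (iH i0 u))) (fun _ => K last)) => //.
- exact: eta_cyc.
- by move=> u v; case: b; rewrite /R1 /host /= ?RH ?RK.
- by move=> _ u v; case: b; rewrite /= ?RH ?RK.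
- move=> u v w h; apply/negP => /P_lay e.
  by have /P'_lay e' : P' b u v w by []; move: (s1_neq b); rewrite -e -e' eqxx.
- by move=> w; apply: P_slice.
- by left.
- by left.
move=> u v w; rewrite /Phi [sw _ _]/= -/(P b u v w) -/(P' b u v w).
case: ifP => h1; first by rewrite /eta_E1 -/(P b u v w) h1 Fside /host; case: (b).
rewrite /eta_E1 -/(P b u v w) h1.
case: ifP => h2; first by rewrite [eta_E2 _ _ _ _ _ _ _ _ _ _](h2 : _ = true) Fside; case: (b).
by rewrite [eta_E2 _ _ _ _ _ _ _ _ _ _](h2 : _ = false) Dk /=; case: ifP.
Qed.

Let Phi_zeta : cyc (Phi (inr None)).
Proof.
apply: (@zeta_grid_cyc m A B _ us u1 vs v1 (L None) u1P (@L_cyc _)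
  (fun u v y => lA u + lB v + lY y) true (fun y => y == y0) (fun y => s1 (y == y0)) (fun y => s1 (y != y0))
  (fun _ v => H (hf (iK i0 v))) (fun _ _ => H last) (fun _ u => K (hf (iH i0 u))) (fun _ _ => K last)) => //.
- by move=> u v y; case: ifP => _; rewrite ?lAE ?lBE; ring.
- by move=> _ u v y; case: ifP => _; rewrite ?lAE ?lBE; ring.
- by move=> y; apply: s1_neq.
- by move=> w; rewrite /zeta_E1 slice0 add0r => /eqP; apply: lineP.
- by left.
- by left.
move=> u v w; rewrite /Phi [sw _ _]/= /zeta_E1 /zeta_E2 -addrA -/(lay u v w) negbK /=.
case: ifP => h1; first by rewrite Fside /host; case: (w.1 == y0).
rewrite andbC; have -> : (if w.1 == y0 then u == u1 else v == v1) = edge (w.1 == y0) u v by [].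
case: ifP => h2; first by rewrite Fside; case: (w.1 == y0).
by rewrite Dk /=; case: ifP.
Qed.

Lemma res_big : Res F.
Proof.
exists (fun x => base x \o sw x) => [x|c].
  apply: inj_comp; last exact: can_inj (swK x).
  move=> [i|k] [i'|k'] //= [].
  by case: ifP => _; [move/pi_inj|move/dperm_inj] => ->.
case: c => [[i|i]|[b|]].
- exact: (Phi_false i).
- exact: (Phi_true i).
- exact: Phi_eta.
exact: Phi_zeta.
Qed.

End Big.
End Odd.

Local Close Scope ring_scope.

(** * Sharing out the rows among the hosts *)

Section Hosts.
Variables (m p : nat).
Hypotheses (m3 : 3 <= m) (p2 : 2 <= p).
Let M := m ^ p.


(** Rows are handed out in blocks of [m], one row of a block to one host and
    [m - 1] to the next. *)
Definition blocks q := flatten [seq j.*2 :: nseq m.-1 j.*2.+1 | j <- iota 0 q].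

Lemma blocksS q : blocks q.+1 = blocks q ++ q.*2 :: nseq m.-1 q.*2.+1.
Proof. by rewrite /blocks -[q.+1]addn1 iotaD map_cat flatten_cat /= cats0. Qed.

Lemma size_blocks q : size (blocks q) = q * m.
Proof. elim: q => // q IH. rewrite blocksS size_cat IH /= size_nseq. rewrite prednK; last by lia. by rewrite mulSn addnC. Qed.

Lemma count_blocks q x : count_mem x (blocks q) =
  if x < q.*2 then (if odd x then m.-1 else 1) else 0.
Proof.
elim: q => [|q IH]; first by [].
rewrite blocksS count_cat /= count_nseq IH /=.
case: (ltngtP x q.*2) => [lt|gt|->].
- have -> : x < q.+1.*2 = true by lia.
  by have -> : (q.*2.+1 == x) = false by [lia]; rewrite addn0.
- case: (ltngtP x q.*2.+1) => [lt|gt2|->]; first by lia.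
    by have -> : x < q.+1.*2 = false by [lia].
  have -> : q.*2.+1 < q.+1.*2 = true by lia.
  by rewrite /= odd_double mul1n.
have -> : q.*2 < q.+1.*2 = true by lia.
by have -> : (q.*2.+1 == q.*2) = false by [lia]; rewrite odd_double.
Qed.
Lemma host_sizes (r q : nat) : p = r + q.*2 + 1 -> r <= 1 ->
  exists e c, [/\ M = (r * e + q + c) * m, (q = 0 -> c = 0) &
    r = 1 -> (q = 0 -> e * m = M) /\ (0 < q -> e = 1)].
Proof.
move=> pE r1; have h : p <= m ^ p.-1 by have := ltn_expl p.-1 (ltnW m3); lia.
have ME : M = m ^ p.-1 * m by rewrite -expnSr prednK // ltnW.
move: (m ^ p.-1) (M) h ME => E M' h ->.
case: (posnP q) pE => [-> pE|q0 pE].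
  have -> : r = 1 by lia.
  by exists E, 0; split=> //; rewrite mul1n !addn0.
exists 1, (E - (r + q)); rewrite muln1 subnKC; last by lia.
by split=> // [e|_]; [lia | split=> // e; lia].
Qed.

(** For odd [p] the even number of hosts is served by blocks, and surplus rows go to
    a host in multiples of [m].  For even [p] the first host gets the initial
    [m] rows, or all of them if it is alone, and blocks serve the others. *)
Lemma hosts : exists (hf : nat -> 'I_p) (i0 last : 'I_p),
  [/\ i0 != last, forall n, hf n != last,
   forall i, i != last -> ~~ (~~ odd p && (i == i0)) ->
     coprime (count (fun n => hf n == i) (iota 0 M)) m
   & ~~ odd p -> exists n, [/\ forall k, k < M -> (hf k == i0) = (k < n),
      n <= M, ~~ odd (M - n) & coprime n (m ^ 2 * m).+1]].
Proof.
pose r : nat := ~~ odd p; pose q := (p - r.+1)./2.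
have pE : p = r + q.*2 + 1 by rewrite /q /r; case: (boolP (odd p)) => o /=; lia.
have r1 : r <= 1 by rewrite /r; case: (odd p).
(* every list entry is the number of the host of a row *)
have [e [c [ME c0 eP]]] := host_sizes pE r1.
have rp : ~~ odd p -> r = 1 by rewrite /r => ->.
have rp' : r = 1 -> ~~ odd p by rewrite /r; case: (odd p).
clearbody r q; have pM : odd M = odd m by rewrite /M oddX; case: (p) p2.
have ME' : M = m ^ p by []; move: (M) ME' ME eP pM => M' ME' ME eP pM.
pose l := nseq (r * e * m) 0 ++ map (addn r) (blocks q) ++ nseq (c * m) r.+1.
have sl : size l = M' by rewrite !size_cat !size_nseq size_map size_blocks ME !mulnDl addnA.
have cl x : count_mem x l = (0 == x) * (r * e * m)
    + ((if r <= x < r + q.*2 then (if odd (x - r) then m.-1 else 1) else 0) + (r.+1 == x) * (c * m)).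
  rewrite !count_cat !count_nseq count_map; congr (_ + (_ + _)) => /=.
  have [rx|xr] /= := leqP r x.
    rewrite -ltn_subLR // -count_blocks; apply: eq_count => y /=.
    by apply/eqP/eqP => [<-|->]; rewrite ?addKn ?subnKC.
  rewrite (@eq_count _ _ pred0) ?count_pred0 // => y /=.
  by apply/negbTE; lia.
have al n : nth 0 l n < p.-1.
  have [lt|ge] := ltnP n (size l); last by rewrite nth_default //; lia.
  have := mem_nth 0 lt; rewrite -has_pred1 has_count cl.
  move: (nth 0 l n) => x.
  have [/eqP <-|nx] := boolP (0 == x); first by lia.
  case: ifP => [|_]; first by lia.
  by have [/eqP <-|] := boolP (r.+1 == x); case: (posnP q) => [/c0 ->|]; lia.
have p0 : 0 < p by lia.
have ip n : nth 0 l n < p by have := al n; lia.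
pose hf n := Ordinal (ip n).
have i0p : 0 < p by []; have lp : p.-1 < p by lia.
have cE i : count (fun n => hf n == i) (iota 0 M') = count_mem (nat_of_ord i) l.
  rewrite -sl -[in RHS](mkseq_nth 0 l) count_map; apply: eq_count => n /=.
  by rewrite -val_eqE.
exists hf, (Ordinal i0p), (Ordinal lp); split.
- by rewrite -val_eqE /=; lia.
- by move=> n; rewrite -val_eqE /=; have := al n; lia.
- move=> i il ni; rewrite cE cl.
  have ip' : i < p.-1 by move: il (ltn_ord i); rewrite -val_eqE /=; lia.
  have -> : (0 == i) * (r * e * m) = 0.
    move: ni; rewrite -val_eqE /= eq_sym; case: eqP => //= _; rewrite andbT negbK => o.
    by have -> : r = 0 by [case: (r) r1 rp' => [|[|]] // _ /(_ erefl); rewrite o].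
  rewrite add0n (_ : (r <= i < _) = true); last first.
    move: ni; rewrite -val_eqE /=; case: (r) r1 pE rp' => [|[|//]] _ pE rp'; first by lia.
    by rewrite rp' //=; lia.
  case: ifP => o.
    case: eqP => e1; rewrite ?mul1n ?mul0n ?addn0; last first.
      by rewrite coprime_sym coprimenP // ltnW // ltnW.
    by rewrite /coprime addnC gcdnC gcdnMDl -/(coprime _ _) coprimenP // ltnW // ltnW.
  rewrite (_ : (r.+1 == i) = false) ?mul0n ?addn0 ?coprime1n //.
  by apply/negbTE/eqP => e1; move: o; rewrite -{1}e1 subSn // subnn.
move=> /rp rE; have [e0 e1] := eP rE; exists (e * m); split.
- move=> k kM; rewrite -val_eqE /= /l rE mul1n nth_cat size_nseq.
  case: ifP => h; first by rewrite nth_nseq h.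
  set x := nth _ _ _; suff : 0 < x by case: (x).
  have : x \in map (addn 1) (blocks q) ++ nseq (c * m) 2.
    apply: mem_nth; move: sl; rewrite /l rE mul1n size_cat size_nseq => sl.
    by rewrite ltn_subLR ?sl // leqNgt h.
  rewrite mem_cat => /orP[/mapP[y _ ->] //|].
  by rewrite mem_nseq => /andP[_ /eqP ->].
- by rewrite ME rE mul1n; rewrite leq_mul2r -addnA leq_addr orbT.
- have [q0|q0] := posnP q; first by rewrite e0 // subnn.
  rewrite e1 // mul1n oddB ?pM ?addbb //.
  by rewrite ME rE e1 // mul1n -addnA mulnDl mul1n leq_addr.
have cop k : coprime (m ^ k) (m ^ 2 * m).+1.
  apply: coprimeXl; rewrite -expnSr expnSr /coprime -addn1 gcdnMDl.
  by rewrite gcdn1.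
have [q0|q0] := posnP q; last by rewrite e1 // mul1n; have := cop 1; rewrite expn1.
by rewrite e0 // ME'; apply: cop.
Qed.
End Hosts.

Local Open Scope ring_scope.

(** * The torus in every dimension *)

Section Torus.
Variable m : nat.
Hypothesis m3 : (3 <= m)%N.
Let m1 : (1 < m)%N. Proof. lia. Qed.
Notation Y := ('Z_m * 'Z_m)%type.
Notation W := ('Z_m * 'Z_m * 'Z_m)%type.

Definition toW (x : tor m (option bool)) : W := (x (Some false), x (Some true), x None).

Lemma toW_inj : injective toW.
Proof. by move=> x y [h1 h2 h3]; apply/ffunP => -[[]|]. Qed.

Lemma toW_bump c x : toW (bump c x) = gen3 c (toW x).
Proof. by case: c => [[]|]; rewrite /toW !ffunE /gen3 /= ?addr0. Qed.

Definition gen2 (b : bool) (y : Y) : Y := if b then (y.1, y.2 + 1) else (y.1 + 1, y.2).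
Definition toY (x : tor m bool) : Y := (x false, x true).

Lemma toY_inj : injective toY.
Proof. by move=> x y [h1 h2]; apply/ffunP => -[]. Qed.

Lemma toY_bump b x : toY (bump b x) = gen2 b (toY x).
Proof. by case: b; rewrite /toY !ffunE /gen2 /= ?addr0. Qed.

Lemma tsum_conj (I J : finType) (X X' Z Z' : finType) (F : I -> X -> X) (F' : I -> X' -> X')
    (G : J -> Z -> Z) (G' : J -> Z' -> Z') (h : X -> X') (k : Z -> Z') :
  injective h -> injective k -> (forall i x, h (F i x) = F' i (h x)) ->
  (forall j z, k (G j z) = G' j (k z)) -> Res (tsum F' G') -> Res (tsum F G).
Proof.
move=> hi ki hF kG; apply: (@res_conj _ _ _ _ (fun x => (h x.1, k x.2)) id).
- by move=> [x z] [x' z'] /pairE /= [/hi -> /ki ->].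
- by exists id.
by case=> [i|j] x /=; rewrite ?hF ?kG.
Qed.

Notation T d := (TorRes m 'I_d).

Lemma torres_of (I : finType) d : #|I| = d -> TorRes m I -> T d.
Proof. by move=> c; apply: torres_card; rewrite card_ord. Qed.

Lemma card_torI p : #|{: tor m 'I_p}| = (m ^ p)%N.
Proof. by rewrite card_tor // card_ord. Qed.

(** Both copies carry the same decomposition, so that the two cycles joined have
    equal length and grading. *)
Lemma torres_double p : (0 < p)%N -> T p -> T (p + p).
Proof.
move=> p0 [rho ri rc]; apply: (@torres_of ('I_p + 'I_p)%type).
  by rewrite card_sum !card_ord.
apply: torres_sum => //.
apply: (res_sum (r := rho) (s := rho)
  (D := fun c x => bump (rho x c) x) (E := fun c x => bump (rho x c) x)) => //.
apply: (@res_join m (m ^ p) _ _ _ _ _ (@lay m _) (@lay m _)) => //.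
- by rewrite -{1}(exp1n p) ltn_exp2r.
- exact: dvdn_exp.
- exact: card_torI.
- exact: card_torI.
- by move=> i x; apply: lay_bump.
by move=> i x; apply: lay_bump.
Qed.

Lemma torres_3 : T 3.
Proof.
apply: (@torres_of (option bool)); first by rewrite card_option card_bool.
have [pi [_ [_ [_ [pi_inj Lc _ _ _]]]]] := slices_exist m3.
apply: (@res_conj _ W _ _ toW id _ (@gen3 m) toW_inj) => [|c x|].
- by exists id.
- exact: toW_bump.
by exists pi.
Qed.

(** The data shared by the two constructions for odd dimensions. *)
Lemma odd_data : exists (pi : W -> option bool -> option bool) (y0 : Y)
    (yy : bool -> 'Z_m -> Y) (idx : bool -> Y -> 'Z_(m ^ 2)),
  let L c w := gen3 (pi w c) w in
  [/\ forall w, injective (pi w), forall c, cyc (L c),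
      forall b z, (yy b z).1 + (yy b z).2 + z = s1 m b /\
        L (Some b) (yy b z, z) = (eta b (yy b z), z)
    & forall w, w.1.1 + w.1.2 + w.2 = s1 m (w.1 == y0) -> L None w = (w.1, w.2 + 1)]
  /\ forall b, [/\ injective (idx b), forall y, idx b (eta b y) = idx b y + 1
      & forall y, red m (idx b y) = y.1 + y.2].
Proof.
have [pi [y0 [y1 [y2 [pi_inj Lc P1 P2 P3]]]]] := slices_exist m3.
have [|||||idx idxP] := @idx_family m (m ^ 2) _ _ (@eta m) (fun y => y.1 + y.2) m1 _ _ _ _ _.
- by rewrite -{1}(exp1n 2) ltn_exp2r.
- exact: dvdn_exp.
- exact: card_Y.
- exact: eta_cyc.
- exact: eta_lay.
exists pi, y0, (fun b => if b then y2 else y1), idx; split=> //; split=> //.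
  by case=> z; [apply: P2|apply: P1].
move=> w; rewrite /s1; case: eqP => e h; apply: P3; first by right.
by left; split=> //; apply/eqP.
Qed.

Lemma torres_5 : T 5.
Proof.
apply: (@torres_of (bool + option bool)%type).
  by rewrite card_sum card_option card_bool.
apply: torres_sum => //.
apply: (tsum_conj toY_inj toW_inj toY_bump toW_bump).
have [pi [y0 [yy [idx [[pi_inj Lc yyP lP] idxP]]]]] := odd_data.
apply: (res_sum (r := fun y b => (y.1 + y.2 == 2%:R) (+) b) (s := fun _ => id)
  (D := @eta m) (E := @gen3 m)) => //.
- by move=> y b b' /addbI.
- by move=> ? ? ?.
by refine (@res_five m m3 pi y0 yy pi_inj Lc yyP lP idx _ _ _) => b; have [] := idxP b.
Qed.

Lemma torres_triple p : (2 <= p)%N -> T p -> T (p + p + 3).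
Proof.
move=> p2 [rho ri rc]; apply: (@torres_of ('I_p + 'I_p + option bool)%type).
  by rewrite !card_sum !card_ord card_option card_bool.
apply: torres_sum => //.
pose h (x : tor m ('I_p + 'I_p)%type) : tor m 'I_p * tor m 'I_p :=
  ([ffun i => x (inl i)], [ffun i => x (inr i)]).
apply: (@tsum_conj _ _ _ _ _ _ _ (tsum (@bump m 'I_p) (@bump m 'I_p)) _ _ h toW _ toW_inj _ toW_bump).
- move=> x y /pairE /= [/ffunP h1 /ffunP h2]; apply/ffunP => -[i|j].
    by have := h1 i; rewrite !ffunE.
  by have := h2 j; rewrite !ffunE.
- by case=> [i|j] x /=; congr pair; apply/ffunP => k; rewrite !ffunE //= addr0.
pose D c (x : tor m 'I_p) := bump (rho x c) x.
have lD c x : lay (D c x) = lay x + 1 by apply: lay_bump.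
have Mp : (1 < m ^ p)%N by rewrite -{1}(exp1n p) ltn_exp2r // ltnW.
have mM : (m %| m ^ p)%N by apply: dvdn_exp; rewrite // ltnW.
have [i iP] := idx_family m1 Mp mM (card_torI p) rc lD.
have [pi [y0 [yy [idx [[pi_inj Lc yyP lP] idxP]]]]] := odd_data.
have [hf [i0 [last [h1 h2 h3 h4]]]] := hosts m3 p2.
have l0 : lay (0 : tor m 'I_p) = 0 by rewrite /lay big1 // => j _; rewrite ffunE.
have ne : D i0 0 != 0.
  apply/eqP => /(congr1 (@lay m _)); rewrite lD l0 add0r => /eqP.
  by rewrite (ZnR_eq m1 1 0) !modn_small // ltnW.
apply: (res_sum (D := tsum D D) (E := @gen3 m) (s := fun _ => id)
  (r := fun x c => match c with inl i => inl (rho x.1 i) | inr j => inr (rho x.2 j) end)) => //.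
- by move=> x [k|k] [k'|k'] // [] /ri ->.
- by case=> k x.
- by move=> ? ? ?.
apply: (@res_big m m3 pi y0 yy pi_inj Lc yyP lP idx _ _ _ p _ _ D D (@lay m _) (@lay m _) p2
  (card_torI p) (card_torI p) lD lD rc rc i i _ _ _ _ _ _ hf i0 last h1 h2 h3 h4 0 _ 0 _ _ ne ne).
all: try by move=> b; have [] := idxP b.
all: try by move=> b; have [] := iP b.
by rewrite l0 addr0.
Qed.

Theorem torus d : (0 < d)%N -> T d.
Proof.
elim/ltn_ind: d => d IH d0.
case o: (odd d); last first.
  have -> : (d = d./2 + d./2)%N by lia.
  by apply: torres_double; [lia | apply: IH; lia].
have [->|n1] := eqVneq d 1%N.
  by apply: (torres_of (I := unit)); [rewrite card_unit | apply: torres1].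
have [->|n3] := eqVneq d 3%N; first exact: torres_3.
have [->|n5] := eqVneq d 5%N; first exact: torres_5.
have -> : (d = (d - 3)./2 + (d - 3)./2 + 3)%N by lia.
by apply: torres_triple; [lia | apply: IH; lia].
Qed.

End Torus.

Local Close Scope ring_scope.

(** * The digraph as an unrolled torus *)

Section Final.
Local Open Scope ring_scope.
Variables (m d a : nat).
Hypotheses (m3 : (3 <= m)%N) (d2 : (2 <= d)%N) (a1 : (1 <= a)%N).
Let m1 : (1 < m)%N. Proof. lia. Qed.
Let N := (a * m)%N.
Let N1 : (1 < N)%N. Proof. by apply: (leq_trans m1); rewrite leq_pmull. Qed.
Let mN : (m %| N)%N. Proof. exact: dvdn_mull. Qed.
Let n := (d - 1)%N.
Notation V := (Gam_group m d a).
Notation RV := 'rV['Z_m]_n.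

Definition row_shift (c : option 'I_n) : RV := if c is Some i then delta_mx 0 i else 0.
Definition gam_arc (c : option 'I_n) : V := (1, row_shift c).

Lemma shift_inj : injective row_shift.
Proof.
have d0 i : delta_mx 0 i != 0 :> RV.
  by apply/eqP => /matrixP /(_ 0 i) /eqP; rewrite !mxE !eqxx (ZnR_eq m1 1 0) !modn_small // ltnW.
case=> [i|] [j|] //= => [/matrixP /(_ 0 i)|/eqP|/esym /eqP]; rewrite ?(negPf (d0 _)) //.
rewrite !mxE !eqxx /=; case: eqP => [-> //|_] /eqP.
by rewrite (ZnR_eq m1 1 0) !modn_small // ltnW.
Qed.

Lemma gen_inj : injective gam_arc.
Proof. by move=> c c' [] /shift_inj. Qed.

Lemma gen_conn s : (s \in Gam_conn m d a) = [exists c, s == gam_arc c].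
Proof.
rewrite !inE; apply/orP/existsP => [[/eqP ->|/imsetP[i _ ->]]|[[i|] /eqP ->]].
- by exists None.
- by exists (Some i).
- by right; apply/imsetP; exists i.
by left.
Qed.

Lemma GamE (x y : V) : Gam m d a x y = [exists c, y == x + gam_arc c].
Proof.
apply/existsP/existsP => [[s /andP[+ /eqP ->]]|[c /eqP ->]].
  by rewrite gen_conn => /existsP[c /eqP ->]; exists c.
by exists (gam_arc c); rewrite gen_conn eqxx andbT; apply/existsP; exists c.
Qed.

(** * Unrolling the first coordinate *)

(** The coordinate [None] makes the sum of all coordinates equal to [s]. *)
Definition torpt (s : 'Z_m) (r : RV) : tor m (option 'I_n) :=
  [ffun c => if c is Some i then r 0 i else s - \sum_i r 0 i].

Lemma torpt_bump c s r : torpt (s + 1) (r + row_shift c) = bump c (torpt s r).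
Proof.
apply/ffunP => c'; rewrite !ffunE; case: c' => [i|]; case: c => [j|] /=.
- by rewrite !mxE eqxx /= (inj_eq (@Some_inj _)).
- by rewrite !mxE.
- rewrite addr0 (eq_bigr (fun i => r 0 i + (i == j : nat)%:R)) => [|i _]; last by rewrite !mxE eqxx.
  rewrite big_split /= [X in _ - (_ + X)](bigD1 j) //= eqxx [X in _ - (_ + (_ + X))]big1 ?addr0.
    by rewrite (_ : true%:R = 1 :> 'Z_m) //; ring.
  by move=> i /negPf ->.
by rewrite addr0 addrAC.
Qed.

Definition total (x : tor m (option 'I_n)) := x None + \sum_i x (Some i).

Lemma total_torpt s r : total (torpt s r) = s.
Proof.
have e : \sum_i torpt s r (Some i) = \sum_i r 0 i by apply: eq_bigr => i _; rewrite ffunE.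
by rewrite /total e ffunE subrK.
Qed.

Lemma total_bump c x : total (bump c x) = total x + 1.
Proof.
rewrite /total ffunE (eq_bigr (fun i => x (Some i) + (Some i == c : nat)%:R)) => [|i _]; last by rewrite ffunE.
rewrite big_split /= addrACA -!addrA; congr (_ + (_ + _)).
case: c => [j|]; last by rewrite big1 ?addr0.
rewrite add0r (bigD1 j) //= eqxx big1 ?addr0 // => i ne.
by rewrite (inj_eq (@Some_inj _)) (negPf ne).
Qed.

Lemma torpt_inj s : injective (torpt s).
Proof.
by move=> r r' /ffunP h; apply/rowP => i; have := h (Some i); rewrite !ffunE.
Qed.

Section Unroll.
Variable rho : tor m (option 'I_n) -> option 'I_n -> option 'I_n.
Hypothesis rho_inj : forall x, injective (rho x).
Hypothesis rho_cyc : forall c, cyc (fun x => bump (rho x c) x).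

Definition colour (x : V) (c : option 'I_n) :=
  if (x.1 < m)%N then rho (torpt (red m x.1) x.2) c else c.

(** In the layers from [m] on the colour repeats one generator a multiple of [m]
    times, so a round acts on the other coordinates as [m] steps in the torus do:
    as the first return to the points with coordinate sum 0. *)
Lemma colour_cyc c : cyc (fun x : V => x + gam_arc (colour x c)).
Proof.
pose f (s : 'Z_N) (r : RV) := r + row_shift (colour (s, r) c).
pose g (x : tor m (option 'I_n)) := bump (rho x c) x.
apply: (cyc_conj (h := fun x : V => (x.2, x.1)) (g := layered f)).
- by move=> [s r] [s' r'] [-> ->].
- by move=> [s r].
apply: (layered_cyc N1).
have start k r : (k <= m)%N -> iter k g (torpt 0 r) = torpt k%:R (word_upto f k r).
  elim: k => // k IH km; rewrite iterS IH ?(ltnW km) // word_uptoS mulrSr /f /colour /=.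
  have kN : (k < N)%N by apply: (leq_trans km); apply: dvdn_leq mN; apply: ltnW.
  rewrite val_ZnR // modn_small // km red_nat // torpt_bump.
  by [].
have rest k r : (m + k <= N)%N -> word_upto f (m + k) r = word_upto f m r + row_shift c *+ k.
  elim: k => [|k IH] kN; first by rewrite addn0 addr0.
  rewrite addnS word_uptoS IH; last by apply: ltnW; rewrite -addnS.
  rewrite /f /colour /= val_ZnR // modn_small; last by rewrite -addnS.
  by rewrite ltnNge leq_addr /= mulrSr addrA.
have wN r : word_upto f N r = word_upto f m r.
  have e : N = (m + (a.-1 * m))%N by rewrite -mulSn prednK.
  have := rest (a.-1 * m)%N r; rewrite -e => ->; last exact: leqnn.
  have -> : row_shift c *+ (a.-1 * m) = 0; last by rewrite addr0.
  by apply/rowP => i; rewrite mulmxnE mxE -mulr_natr natrM Zn_n // !mulr0.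
have seam k r : iter (k * m) g (torpt 0 r) = torpt 0 (iter k (word_upto f m) r).
  by elim: k => // k IH; rewrite mulSn iterD IH start // Zn_n.
have layk k x : total (iter k g x) = total x + k%:R.
  by elim: k => [|k IH]; rewrite ?addr0 // iterS total_bump IH mulrSr addrA.
have cw : cyc (word_upto f m).
  move=> r r'; have [k hk] := rho_cyc c (torpt 0 r) (torpt 0 r').
  have := layk k (torpt 0 r); rewrite hk !total_torpt add0r => /esym /eqP.
  rewrite (ZnR_eq m1 k 0) mod0n -/(dvdn m k) => /dvdnP[q kq].
  by exists q; apply: (@torpt_inj 0); rewrite -seam -kq.
by move=> r r'; have [k <-] := cw r r'; exists k; apply: eq_iter => z; rewrite wN.
Qed.

Lemma colour_inj x : injective (colour x).
Proof. by move=> c c'; rewrite /colour; case: ifP => _ //; apply: rho_inj. Qed.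
End Unroll.


(** * From cyclic colour maps to a decomposition *)

Lemma decomposition : hamilton_decomposable (Gam m d a) d.
Proof.
have [rho ri rc] : TorRes m (option 'I_n).
  apply: (torres_card _ (torus m3 (ltnW d2))).
  by rewrite card_ord card_option card_ord /n subn1 prednK // ltnW.
pose G c (x : V) := x + gam_arc (colour rho x c).
have Gc c : cyc (G c) by apply: colour_cyc.
have G_inj x c c' : G c x = G c' x -> c = c'.
  by move=> /addrI /gen_inj /(colour_inj ri).
pose Hc c : {set V * V} := [set (x, G c x) | x : V].
have Hc_inj : injective Hc.
  move=> c c' e; have : (0, G c 0) \in Hc c' by rewrite -e; apply/imsetP; exists 0.
  by case/imsetP => x _ /pairE /= [<-]; apply: G_inj.
have HcP c x y : ((x, y) \in Hc c) = (y == G c x).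
  by apply/imsetP/eqP => [[z _ /pairE /= [-> ->]] //|->]; exists x.
exists [set Hc c | c : option 'I_n]; split.
- apply/and3P; split.
  + rewrite cover_imset; apply/eqP/setP => -[x y]; rewrite inE /= GamE.
    apply/bigcupP/existsP => [[c _]|[c /eqP ->]].
      by rewrite HcP => /eqP ->; exists (colour rho x c).
    have [h _ hK] := injF_bij (colour_inj ri (x := x)).
    by exists (h c) => //; rewrite HcP /G hK.
  + apply/trivIsetP => _ _ /imsetP[c _ ->] /imsetP[c' _ ->] ne.
    rewrite -setI_eq0; apply/eqP/setP => -[x y]; rewrite in_setI in_set0 !HcP.
    by apply/negP => /andP[/eqP -> /eqP /G_inj e]; rewrite e eqxx in ne.
  apply/imsetP => -[c _ e].
  by have := HcP c 0 (G c 0); rewrite -e in_set0 eqxx.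
- rewrite card_imset // card_option card_ord /n subn1 prednK //; exact: ltnW.
move=> _ /imsetP[c _ ->]; have Gi := cyc_inj (Gc c).
have fcy : fcycle (G c) (orbit (G c) 0) by apply: cycle_orbit.
have all_in x : x \in orbit (G c) 0 by rewrite -fconnect_orbit; move/cycE: (Gc c).
exists (orbit (G c) 0); split=> //.
  apply/andP; split; first by rewrite size_orbit order_gt0.
  rewrite /ucycleb orbit_uniq andbT; apply: sub_cycle fcy => x y /eqP <-.
  by rewrite GamE; apply/existsP; exists (colour rho x c).
have nE x : next (orbit (G c) 0) x = G c x.
  by apply/esym/eqP; apply: (next_cycle fcy (all_in x)).
apply/setP => -[x y]; rewrite HcP; apply/eqP/imsetP => [->|[z _ /pairE /= [-> ->]]].
  by exists x; rewrite ?nE.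
exact: nE.
Qed.

(** * Girth *)

Lemma path_first (x : V) p : path (Gam m d a) x p -> (last x p).1 = x.1 + (size p)%:R.
Proof.
elim: p x => [|y p IH] x /=; first by rewrite addr0.
rewrite GamE => /andP[/existsP[c /eqP ->] /IH ->] /=.
by rewrite mulrS addrA.
Qed.

(** The first coordinate counts the arcs. *)
Lemma cycle_long (c : seq V) : (0 < size c)%N -> cycle (Gam m d a) c -> (N <= size c)%N.
Proof.
case: c => // x p _ /path_first; rewrite last_rcons size_rcons /= => /eqP.
rewrite -subr_eq0 opprD addNKr oppr_eq0 (ZnR_eq N1 _ 0) mod0n => h.
exact: dvdn_leq.
Qed.

Lemma girth : has_directed_girth (Gam m d a) N.
Proof.
split; last by move=> c /andP[c0 /andP[cy _]]; apply: cycle_long.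
pose f (x : V) := x + gam_arc None.
have fi : injective f by apply: addIr.
have cy : directed_cycle (Gam m d a) (orbit f 0).
  apply/andP; split; first by rewrite size_orbit order_gt0.
  rewrite /ucycleb orbit_uniq andbT; apply: sub_cycle (cycle_orbit fi 0) => x y /eqP <-.
  by rewrite GamE; apply/existsP; exists None.
exists (orbit f 0) => //; apply/eqP; rewrite eqn_leq; apply/andP; split; last first.
  by case/andP: cy => c0 /andP[cy _]; apply: cycle_long.
rewrite size_orbit -[X in (_ <= X)%N](card_Zn N1).
have inj : injective (fun s : 'Z_N => (s, 0) : V) by move=> s s' [].
rewrite -(card_imset _ inj); apply: subset_leq_card; apply/subsetP => x.
rewrite inE => /fconnectP[k <-]; elim: k => [|k /imsetP[s _ e]] /=.
  by apply/imsetP; exists 0.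
by rewrite e; apply/imsetP; exists (s + 1); rewrite // /f /gam_arc /row_shift -[RHS]/((s + 1, 0) : V); congr pair; rewrite addr0.
Qed.

(** * The product of cycles has shorter directed cycles *)

(** Turning around one of the short cycles is a closed walk of [m] arcs; an
    isomorphism would carry it over. *)
Lemma not_product : (1 < a)%N -> ~ digraph_iso (Gam m d a)
  (cart_prod (dicycle (a * m)) (cart_pow (dicycle m) (d - 1))).
Proof.
move=> agt [f [g fK gK] fe].
have n0 : (0 < n)%N by rewrite /n; lia.
pose j0 : 'I_n := Ordinal n0.
pose T2 := {ffun 'I_n -> 'I_m}.
pose rot (x : 'I_(a * m) * T2) : 'I_(a * m) * T2 :=
  (x.1, [ffun j => if j == j0 then ordS (x.2 j) else x.2 j]).
have rotE x : cart_prod (dicycle (a * m)) (cart_pow (dicycle m) (d - 1)) x (rot x).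
  rewrite /cart_prod /= eqxx orbC; apply/orP; left; apply/existsP; exists j0.
  rewrite /dicycle /= ffunE eqxx eqxx; apply/forallP => j; apply/implyP => /negPf nj.
  by rewrite ffunE nj.
have rotm x : iter m rot x = x.
  have it k : (iter k rot x).1 = x.1 /\ forall j, ((iter k rot x).2 j : nat) =
      (if j == j0 then (x.2 j + k) %% m else x.2 j)%N.
    elim: k => [|k [h1 h2]]; split=> //.
      by move=> j; rewrite addn0; case: ifP => // _; rewrite modn_small.
    move=> j; rewrite /= ffunE; case: ifP => e; last by rewrite h2 e.
    by rewrite /= h2 e -addn1 modnDml addn1 addnS.
  have [h1 h2] := it m; case: (iter m rot x) h1 h2 => y1 y2 /= -> h2.
  case: x it h2 => x1 x2 /= _ h2; congr pair; apply/ffunP => j; apply: val_inj.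
  by rewrite /= h2; case: ifP => // _; rewrite modnDr modn_small.
pose s (x : V) := g (rot (f x)).
have sE x : Gam m d a x (s x) by rewrite -fe /s gK; apply: rotE.
have sm x : iter m s x = x.
  have it k : iter k s x = g (iter k rot (f x)).
    by elim: k => [|k IH] /=; [rewrite fK | rewrite IH /s gK].
  by rewrite it rotm fK.
have closed k : iter k.+1 s 0 = 0 -> cycle (Gam m d a) (traject s 0 k.+1).
  move=> sk /=; rewrite -cats1 cat_path /= andbT.
  have pt j x : path (Gam m d a) x (traject s (s x) j).
    by elim: j x => //= j IH x; rewrite sE IH.
  by rewrite pt last_traject -{2}sk sE.
have cy : cycle (Gam m d a) (traject s 0 m).
  by have := closed m.-1; rewrite prednK ?(ltnW m1) //; apply.
have := cycle_long _ cy; rewrite size_traject => /(_ (ltnW m1)).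
by rewrite /N -[X in (_ <= X)%N]mul1n leq_mul2r; lia.
Qed.

End Final.

Theorem corollary10p5 (m d a : nat) (hm : 3 <= m) (hd : 2 <= d) (ha : 1 <= a) :
  [/\ hamilton_decomposable (Gam m d a) d,
      has_directed_girth (Gam m d a) (a * m)
    & 1 < a ->
      ~ digraph_iso (Gam m d a)
          (cart_prod (dicycle (a * m)) (cart_pow (dicycle m) (d - 1)))].
Proof. by split; [exact: decomposition | exact: girth | exact: not_product]. Qed.
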